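(* Let $\mu$ be a positive Borel measure on $(0,\infty)$ satisfying $\int_0^\infty \frac{d\mu(t)}{t}=1$. The following are equivalent: (i) $\mathcal{H}_\mu: F^p_\alpha\to F^p_\alpha$ is bounded for all $0<p\le \infty$ and all $\alpha>0$. (ii) There exist $0<p\le \infty$ and $\alpha>0$ such that $\mathcal{H}_\mu: F^p_\alpha\to F^p_\alpha$ is bounded. (iii) There exist $0<p,q\leq \infty$ and $\alpha>0$ such that $\mathcal{H}_\mu: F^{\infty,q,\alpha}\to F^{p,\infty,\alpha}$ is bounded. (iv) $\mu((0,1))=0$. (v) $\sup_{n\ge 0} \mu_n < \infty$. (vi) $\mathcal{H}_\mu: F^{p,q,\alpha}\to F^{p,q,\alpha}$ is bounded for all $0<p,q\le \infty$ and all $\alpha>0$.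
   Context: For an entire function $f$ and $r\ge 0$, $M_p(f,r)=\left(\frac{1}{2\pi}\int_0^{2\pi}|f(re^{i\theta})|^p\,d\theta\right)^{1/p}$ for $0<p<\infty$ and $M_\infty(f,r)=\sup_{|z|=r}|f(z)|$. For $0<p,q\le\infty$ and $\alpha>0$, the mixed norm Fock space $F^{p,q,\alpha}$ is the space of entire functions $f$ with $\|f\|_{p,q,\alpha}<\infty$, where $\|f\|_{p,q,\alpha}=\left(\alpha q\int_0^\infty M_p(f,r)^q e^{-\frac{\alpha q}{2}r^2}\,r\,dr\right)^{1/q}$ if $0<q<\infty$ and $\|f\|_{p,\infty,\alpha}=\sup_{r\ge0}M_p(f,r)e^{-\frac{\alpha}{2}r^2}$. The Fock space is $F^p_\alpha=F^{p,p,\alpha}$, i.e. $\|f\|_{p,\alpha}=\left(\frac{\alpha p}{2\pi}\int_{\mathbb C}|f(z)e^{-\frac{\alpha}{2}|z|^2}|^p\,dA(z)\right)^{1/p}$ for $p<\infty$ and $\|f\|_{\infty,\alpha}=\sup_{z\in\mathbb C}|f(z)|e^{-\frac{\alpha}{2}|z|^2}$ ($dA$ is area measure). The Hausdorff operator is $\mathcal{H}_\mu(f)(z)=\int_0^\infty f\left(\frac{z}{t}\right)\frac{d\mu(t)}{t}$ for entire $f$, and $\mu_n=\int_0^\infty\frac{d\mu(t)}{t^{n+1}}\in[0,\infty]$ for $n=0,1,2,\dots$. ''$\mathcal{H}_\mu:X\to Y$ is bounded'' means it is well defined on $X$ with values in $Y$ and there is $C>0$ with $\|\mathcal{H}_\mu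 f\|_Y\le C\|f\|_X$ for all $f\in X$. *)

(* Defs.v *)
From mathcomp Require Export all_boot all_order all_algebra.
From mathcomp Require Export all_classical all_reals all_analysis.
From mathcomp Require Export complex.
Export Order.TTheory GRing.Theory Num.Theory.
Export numFieldNormedType.Exports.

Set Implicit Arguments.
Unset Strict Implicit.
Unset Printing Implicit Defensive.

Local Open Scope classical_set_scope.
Local Open Scope complex_scope.
Local Open Scope ring_scope.

(* [`|z|] lives in [R[i]]; this is the same absolute value as an element
   of [R]. *)
Definition cabs (R : realType) (z : R[i]) : R := complex.Re `|z|.

(* The scalar field is [R[i]], so the increments in the difference quotient
   are complex: this is complex differentiability at every point. *)
Definition entire (R : realType) (f : R[i] -> R[i]) : Prop :=
  forall z : R[i], derivable (f : R[i]^o -> R[i]^o) z 1.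

(* r e^(i theta) *)
Definition polar (R : realType) (r theta : R) : R[i] :=
  (r * cos theta) +i* (r * sin theta).

(* Exponents range over ]0, +oo]; the -oo branches are never used. *)
Definition Mp (R : realType) (p : \bar R) (f : R[i] -> R[i]) (r : R) : \bar R :=
  match p with
  | EFin s => (((2 * pi)^-1)%:E *
      \int[lebesgue_measure]_(theta in `[0%R, (2 * pi)%R])
         ((cabs (f (polar r theta)) `^ s)%R)%:E) `^ s^-1
  | +oo => ereal_sup [set (cabs (f z))%:E | z in [set z | cabs z = r]]
  | -oo => 0
  end%E.

Definition mixed_norm (R : realType) (p q : \bar R) (alpha : R)
    (f : R[i] -> R[i]) : \bar R :=
  match q with
  | EFin s => ((alpha * s)%:E *
      \int[lebesgue_measure]_(r in `[0%R, +oo[)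
         (Mp p f r `^ s * (expR (- (alpha * s / 2) * r ^+ 2) * r)%:E)) `^ s^-1
  | +oo => ereal_sup [set Mp p f r * (expR (- (alpha / 2) * r ^+ 2))%:E
                     | r in [set r : R | (0 <= r)%R]]
  | -oo => 0
  end%E.

Definition fock_norm (R : realType) (p : \bar R) (alpha : R)
    (f : R[i] -> R[i]) : \bar R :=
  mixed_norm p p alpha f.

(* The space of entire functions on which [N] is finite. *)
Definition entire_space (R : realType) (N : (R[i] -> R[i]) -> \bar R) :
    set (R[i] -> R[i]) :=
  [set f | entire f /\ (N f < +oo)%E].

(* A Borel measure on ]0, +oo[ is represented by its extension by zero, a Borel
   measure [mu] on [R] with [mu `]-oo, 0] = 0]. *)

(* Absolute convergence of the integral defining the operator at [z], written
   on real and imaginary parts. *)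
Definition hausdorff_integrable (R : realType)
    (mu : {measure set (measurableTypeR R) -> \bar R})
    (f : R[i] -> R[i]) (z : R[i]) : Prop :=
  mu.-integrable `]0, +oo[
    (fun t : R => (complex.Re (f (z / t%:C)) / t)%:E) /\
  mu.-integrable `]0, +oo[
    (fun t : R => (complex.Im (f (z / t%:C)) / t)%:E).

Definition hausdorff (R : realType)
    (mu : {measure set (measurableTypeR R) -> \bar R})
    (f : R[i] -> R[i]) (z : R[i]) : R[i] :=
  (\int[mu]_(t in `]0, +oo[) (complex.Re (f (z / t%:C)) / t)) +i*
  (\int[mu]_(t in `]0, +oo[) (complex.Im (f (z / t%:C)) / t)).

Definition hausdorff_bounded (R : realType)
    (mu : {measure set (measurableTypeR R) -> \bar R})
    (NX NY : (R[i] -> R[i]) -> \bar R) : Prop :=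
  (forall f, entire_space NX f ->
     (forall z, hausdorff_integrable mu f z) /\
     entire_space NY (hausdorff mu f)) /\
  exists2 C : R, 0 < C &
    forall f, entire_space NX f -> (NY (hausdorff mu f) <= C%:E * NX f)%E.

Definition mu_moment (R : realType)
    (mu : {measure set (measurableTypeR R) -> \bar R}) (n : nat) : \bar R :=
  (\int[mu]_(t in `]0%R, +oo[) ((t ^+ n.+1)^-1)%:E)%E.

(* Main.v *)
(* Testing on f(z) = z^n, for which H f = mu_n f, gives in case (ii) that mu_n
   is bounded.  In case (iii) the norms of z^n on the two sides differ by at
   most a factor C l^n, for every l > 1, whence mu_n <= C l^n; and
   a^-(n+1) mu(]0, a]) <= mu_n then forces mu(]0, 1[) = 0.

   Conversely suppose mu(]0, 1[) = 0.  As 1/t <= 1 almost everywhere,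
   |H f(z)| <= 2 sup_(0 <= s <= 1) |f(s z)|, so H only needs to be compared
   with a radial maximal function.  Subharmonicity of |f|^k (obtained, for
   every k > 0, from Cauchy's formula and a Fefferman-Stein argument) over
   boxes of radial size 1/r and angular size 1/r^2 bounds |f(s e^(i th))|^k,
   for all s <= r at once, by the integral of e^(a (r^2 - t^2)) |f|^k over
   t <= sqrt(r^2 + c) and |arg - th| <= C / t^2.  Integrating in th turns the
   angular window into a harmless factor, and the integral means
   n(r) of f satisfy n_H(r)^Q <= C int_(t <= sqrt(r^2 + c)) e^(b (r^2 - t^2)) n(t)^Q t dt
   for all Q, b > 0; Tonelli against the Gaussian weight gives all the norm
   inequalities. *)
Require Import Defs.
From HB Require Import structures.
From mathcomp Require Import ring lra measurable_realfun.

Set Implicit Arguments.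
Unset Strict Implicit.
Unset Printing Implicit Defensive.

Local Open Scope classical_set_scope.
Local Open Scope complex_scope.
Local Open Scope ring_scope.

(** * Complex differentiability *)

(** For exponents at least 1, Minkowski's inequality would pass the norm through the average over
    dilations. It fails below 1, which is why the average is replaced by a supremum along the ray.
    The resulting maximal function has to be bounded in a norm whose angular and radial exponents
    are unrelated. Hence two successive averagings: the angular one leaves a function of the radius
    alone, which inherits a one-dimensional sub-mean value inequality, and an arbitrary power of
    that function is reached by a second use of Fefferman-Stein, in dimension 1. Radial size 1/r is
    the scale at which exp(a r^2) varies by a bounded factor. The exponent of the kernel is a
    compromise: positive, so that integrals over t are bounded uniformly in r, and below that of the
    weight, so that the integral over r converges; half the weight is taken. Polar boxes degenerate
    at the origin. Values near it are recovered from a distant annulus, and the constant c added to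
    r^2 makes room for that annulus even when r is small. *)

Section complex_abs.
Variable R : realType.
Implicit Types (z w : R[i]) (x y : R).

Lemma normc_cabs z : `|z| = (cabs z)%:C.
Proof. by rewrite /cabs normc_def. Qed.

Lemma cabsE z : cabs z = Num.sqrt ((complex.Re z)^+2 + (complex.Im z)^+2).
Proof. by rewrite /cabs normc_def. Qed.

Lemma cabs_ge0 z : 0 <= cabs z. Proof. by rewrite cabsE sqrtr_ge0. Qed.

Lemma cabs0 : cabs (0 : R[i]) = 0. Proof. by rewrite /cabs normr0. Qed.

Lemma cabs1 : cabs (1 : R[i]) = 1. Proof. by rewrite /cabs normr1. Qed.

Lemma cabsM z w : cabs (z * w) = cabs z * cabs w.
Proof. by apply: complexI; rewrite -normc_cabs normrM !normc_cabs rmorphM. Qed.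

Lemma cabsX z n : cabs (z ^+ n) = cabs z ^+ n.
Proof. by apply: complexI; rewrite -normc_cabs normrX normc_cabs rmorphXn. Qed.

Lemma cabsN z : cabs (- z) = cabs z.
Proof. by rewrite /cabs normrN. Qed.

Lemma cabsV z : cabs z^-1 = (cabs z)^-1.
Proof. by apply: complexI; rewrite -normc_cabs normfV normc_cabs fmorphV. Qed.

Lemma cabsD z w : cabs (z + w) <= cabs z + cabs w.
Proof. by rewrite -lecR -normc_cabs rmorphD /= -!normc_cabs ler_normD. Qed.

Lemma cabsB z w : cabs (z - w) <= cabs z + cabs w.
Proof. by rewrite -(cabsN w) cabsD. Qed.

Lemma cabsBC z w : cabs (z - w) = cabs (w - z).
Proof. by rewrite -cabsN opprB. Qed.

Lemma cabs_eq0 z : (cabs z == 0) = (z == 0).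
Proof. by rewrite -[RHS]normr_eq0 normc_cabs eq_complex /= eqxx andbT. Qed.

Lemma cabs_gt0 z : (0 < cabs z) = (z != 0).
Proof. by rewrite lt_neqAle cabs_ge0 andbT eq_sym cabs_eq0. Qed.

Lemma cabs_real x : cabs x%:C = `|x|.
Proof. by rewrite cabsE /= expr0n addr0 sqrtr_sqr. Qed.

Lemma ler_Re_cabs z : `|complex.Re z| <= cabs z.
Proof. by rewrite cabsE -sqrtr_sqr ler_wsqrtr// lerDl sqr_ge0. Qed.

Lemma ler_Im_cabs z : `|complex.Im z| <= cabs z.
Proof. by rewrite cabsE -sqrtr_sqr ler_wsqrtr// lerDr sqr_ge0. Qed.

Lemma cabs_le_ReIm z : cabs z <= `|complex.Re z| + `|complex.Im z|.
Proof.
rewrite cabsE -[leRHS]ger0_norm ?addr_ge0// -sqrtr_sqr ler_wsqrtr//.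
rewrite -(real_normK (num_real (complex.Re z))) -(real_normK (num_real (complex.Im z))).
by rewrite sqrrD lerD2r lerDl mulrn_wge0// mulr_ge0.
Qed.

Lemma cabs_lipschitz z w : `|cabs z - cabs w| <= cabs (z - w).
Proof.
rewrite ler_norml; apply/andP; split.
- by rewrite lerNl opprB lerBlDr cabsBC; apply: le_trans (cabsD _ _); rewrite subrK.
- by rewrite lerBlDr; apply: le_trans (cabsD _ _); rewrite subrK.
Qed.

Lemma complex_ReD z w : complex.Re (z + w) = complex.Re z + complex.Re w.
Proof. by case: z w => [a b] [a' b']. Qed.

Lemma complex_ImD z w : complex.Im (z + w) = complex.Im z + complex.Im w.
Proof. by case: z w => [a b] [a' b']. Qed.

Lemma complex_ReB z w : complex.Re (z - w) = complex.Re z - complex.Re w.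
Proof. by case: z w => [a b] [a' b']. Qed.

Lemma complex_ImB z w : complex.Im (z - w) = complex.Im z - complex.Im w.
Proof. by case: z w => [a b] [a' b']. Qed.

Lemma complex_ReM z w : complex.Re (z * w) =
  complex.Re z * complex.Re w - complex.Im z * complex.Im w.
Proof. by case: z w => [a b] [a' b']. Qed.

Lemma complex_ImM z w : complex.Im (z * w) =
  complex.Re z * complex.Im w + complex.Im z * complex.Re w.
Proof. by case: z w => [a b] [a' b']. Qed.

End complex_abs.

Section complex_derivative.
Variable R : realType.
Implicit Types (f g : R[i] -> R[i]) (z w l h : R[i]).

(** Without division by [h] the case [h = 0] needs no exclusion, and every estimate is an inequality
    between real numbers. *)
Definition has_cderiv f z l := forall e : R, 0 < e -> exists2 d : R, 0 < d &
  forall h, cabs h < d -> cabs (f (z + h) - f z - l * h) <= e * cabs h.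

Lemma derivable_has_cderiv f z :
  derivable (f : R[i]^o -> R[i]^o) z 1 -> exists l, has_cderiv f z l.
Proof.
move=> /cvg_ex [/= l fl]; exists l => e e0.
have ec0 : 0 < e%:C by rewrite ltcR.
move/cvgrPdist_le : fl => /(_ _ ec0).
rewrite near_withinE => /nbhs_ballP [d /= d0 H].
(* Radii of balls of [R[i]] are complex; positivity forces this one to be real. *)
have dE : d = (complex.Re d)%:C.
  by case: d d0 {H} => a b; rewrite ltcE /= => /andP[/eqP -> _].
exists (complex.Re d); first by rewrite -ltcR -dE.
move=> h hd.
have [->|h0] := eqVneq h 0; first by rewrite addr0 mulr0 !subr0 subrr cabs0 mulr0.
have := H h; rewrite /ball /= sub0r normrN normc_cabs dE ltcR => /(_ hd h0).
rewrite normc_cabs lecR => le_e.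
have -> : f (z + h) - f z - l * h = - (h * (l - h^-1 * (f (h * 1 + z) - f z))).
  by rewrite mulrBr mulrA divff// mul1r mulr1 (addrC h z) (mulrC l); ring.
by rewrite cabsN cabsM mulrC ler_wpM2r ?cabs_ge0.
Qed.

Lemma has_cderiv_derivable f z l :
  has_cderiv f z l -> derivable (f : R[i]^o -> R[i]^o) z 1.
Proof.
move=> fl; apply/cvg_ex; exists l => /=; apply/cvgrPdist_le => e e0.
have eE : e = (complex.Re e)%:C.
  by case: e e0 => a b; rewrite ltcE /= => /andP[/eqP -> _].
have e0' : 0 < complex.Re e by rewrite -ltcR -eE.
have [d d0 H] := fl _ e0'.
rewrite near_withinE; apply/nbhs_ballP; exists d%:C => /=; first by rewrite ltcR.
move=> h; rewrite /ball /= sub0r normrN normc_cabs ltcR => /H hd h0.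
rewrite normc_cabs eE lecR.
have : cabs h * cabs (l - h^-1 * (f (h * 1 + z) - f z)) <= complex.Re e * cabs h.
  apply: le_trans hd; rewrite -cabsM -cabsN.
  by rewrite mulrBr mulrA divff// mul1r mulr1 (addrC h z) (mulrC l) opprB.
by rewrite mulrC ler_pM2r // cabs_gt0.
Qed.

End complex_derivative.

Section complex_derivative_rules.
Variable R : realType.
Implicit Types (f g : R[i] -> R[i]) (z w l m h c : R[i]).

Definition ccontinuous f z := forall e : R, 0 < e -> exists2 d : R, 0 < d &
  forall w, cabs (w - z) < d -> cabs (f w - f z) < e.

Lemma has_cderiv_lipschitz f z l : has_cderiv f z l ->
  exists2 d : R, 0 < d & forall h, cabs h < d ->
    cabs (f (z + h) - f z) <= (cabs l + 1) * cabs h.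
Proof.
move=> /(_ 1 ltr01) [d d0 H]; exists d => // h /H hd.
rewrite -[f (z + h) - f z](subrK (l * h)); apply: le_trans (cabsD _ _) _.
by rewrite mulrDl addrC cabsM lerD2l.
Qed.

Lemma has_cderiv_ccontinuous f z l : has_cderiv f z l -> ccontinuous f z.
Proof.
move=> /has_cderiv_lipschitz [d d0 H] e e0.
have k0 : 0 < cabs l + 1 by rewrite ltr_wpDl ?cabs_ge0.
exists (Num.min d (e / (cabs l + 1))); first by rewrite lt_min d0 divr_gt0.
move=> w; rewrite lt_min => /andP[wd we].
have := H _ wd; rewrite [z + _]addrC subrK => /le_lt_trans; apply.
by rewrite mulrC -ltr_pdivlMr.
Qed.

Lemma has_cderiv_cst c z : has_cderiv (fun=> c) z 0.
Proof.
move=> e e0; exists 1 => // h _.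
by rewrite subrr mul0r subr0 cabs0 mulr_ge0 ?cabs_ge0 ?ltW.
Qed.

Lemma has_cderiv_id z : has_cderiv id z 1.
Proof.
move=> e e0; exists 1 => // h _.
have -> : z + h - z - 1 * h = 0 by ring.
by rewrite cabs0 mulr_ge0 ?cabs_ge0 ?ltW.
Qed.

Lemma has_cderivD f g z l m : has_cderiv f z l -> has_cderiv g z m ->
  has_cderiv (fun z => f z + g z) z (l + m).
Proof.
move=> fl gm e e0; have e20 : 0 < e / 2 by rewrite divr_gt0.
have [d1 d10 H1] := fl _ e20; have [d2 d20 H2] := gm _ e20.
exists (Num.min d1 d2); first by rewrite lt_min d10.
move=> h; rewrite lt_min => /andP[/H1 h1 /H2 h2].
have -> : f (z + h) + g (z + h) - (f z + g z) - (l + m) * h =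
  (f (z + h) - f z - l * h) + (g (z + h) - g z - m * h) by ring.
apply: le_trans (cabsD _ _) _; lra.
Qed.

Lemma has_cderivM f g z l m : has_cderiv f z l -> has_cderiv g z m ->
  has_cderiv (fun z => f z * g z) z (l * g z + f z * m).
Proof.
move=> fl gm e e0.
set K := cabs (g z) + (cabs m + 1) + cabs (f z) + cabs l.
have cf := cabs_ge0 (f z); have cg := cabs_ge0 (g z).
have cl := cabs_ge0 l; have cm := cabs_ge0 m.
have K0 : 0 < K by rewrite /K; lra.
set P := cabs l * cabs m + 1.
have P0 : 0 < P by rewrite /P ltr_wpDl ?mulr_ge0.
have e1 : 0 < e / 2 / K by rewrite !divr_gt0.
have [d1 d10 H1] := fl _ e1; have [d2 d20 H2] := gm _ e1.
have [d3 d30 H3] := has_cderiv_lipschitz gm.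
exists (Num.min (Num.min d1 d2) (Num.min d3 (Num.min 1 (e / 2 / P)))).
  by rewrite !lt_min d10 d20 d30 ltr01 !divr_gt0.
move=> h; rewrite !lt_min => /andP[/andP[/H1 h1 /H2 h2] /and3P[/H3 h3 h4 h5]].
have -> : f (z + h) * g (z + h) - f z * g z - (l * g z + f z * m) * h =
   (f (z + h) - f z - l * h) * g (z + h)
   + (f z + l * h) * (g (z + h) - g z - m * h) + l * h * (m * h) by ring.
have ch := cabs_ge0 h.
have gh : cabs (g (z + h)) <= cabs (g z) + (cabs m + 1).
  rewrite -[g (z + h)](subrK (g z)) addrC; apply: le_trans (cabsD _ _) _.
  rewrite lerD2l; apply: le_trans h3 _; rewrite ger_pMr ?ltW //.
  by rewrite ltr_wpDl.
have fh : cabs (f z + l * h) <= cabs (f z) + cabs l.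
  apply: le_trans (cabsD _ _) _; rewrite lerD2l cabsM ler_piMr//.
  exact: ltW.
apply: le_trans (cabsD _ _) _; rewrite [leRHS](_ : _ =
   e / 2 / K * K * cabs h + e / 2 / P * P * cabs h); last first.
  by rewrite !divfK ?gt_eqF// -mulrDl -splitr.
apply: lerD.
  apply: le_trans (cabsD _ _) _; rewrite !cabsM.
  rewrite [leRHS](_ : _ = (e / 2 / K * cabs h) * (cabs (g z) + (cabs m + 1))
     + (cabs (f z) + cabs l) * (e / 2 / K * cabs h)); last by rewrite /K; ring.
  by apply: lerD; apply: ler_pM => //; exact: cabs_ge0.
rewrite !cabsM mulrACA.
apply: (@le_trans _ _ (P * (e / 2 / P * cabs h))); last by rewrite le_eqVlt; apply/orP; left; apply/eqP; ring.
apply: ler_pM; rewrite ?mulr_ge0//; first by rewrite /P lerDl.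
by rewrite ler_wpM2r// ltW.
Qed.

Lemma has_cderivB f g z l m : has_cderiv f z l -> has_cderiv g z m ->
  has_cderiv (fun z => f z - g z) z (l - m).
Proof.
move=> fl gm.
have := has_cderivD fl (has_cderivM (has_cderiv_cst (-1) z) gm).
by rewrite mul0r add0r mulN1r; under eq_fun do rewrite mulN1r.
Qed.

Lemma has_cderiv_comp f g z l m : has_cderiv g z m -> has_cderiv f (g z) l ->
  has_cderiv (fun z => f (g z)) z (l * m).
Proof.
move=> gm fl e e0.
have cl := cabs_ge0 l; have cm := cabs_ge0 m.
have m10 : 0 < cabs m + 1 by rewrite ltr_wpDl.
have l10 : 0 < cabs l + 1 by rewrite ltr_wpDl.
have e1 : 0 < e / 2 / (cabs m + 1) by rewrite !divr_gt0.
have e2 : 0 < e / 2 / (cabs l + 1) by rewrite !divr_gt0.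
have [d1 d10 H1] := fl _ e1; have [d2 d20 H2] := gm _ e2.
have [d3 d30 H3] := has_cderiv_lipschitz gm.
exists (Num.min d2 (Num.min d3 (d1 / (cabs m + 1)))).
  by rewrite !lt_min d20 d30 divr_gt0.
move=> h; rewrite !lt_min => /and3P[/H2 h2 /H3 h3 h1].
have ch := cabs_ge0 h.
have kd : cabs (g (z + h) - g z) < d1.
  by apply: le_lt_trans h3 _; rewrite mulrC -ltr_pdivlMr.
have := H1 _ kd; rewrite [g z + _]addrC subrK => H.
have -> : f (g (z + h)) - f (g z) - l * m * h =
  (f (g (z + h)) - f (g z) - l * (g (z + h) - g z)) + l * (g (z + h) - g z - m * h) by ring.
apply: le_trans (cabsD _ _) _; rewrite [leRHS](_ : _ =
   e / 2 / (cabs m + 1) * ((cabs m + 1) * cabs h) + (cabs l + 1) * (e / 2 / (cabs l + 1) * cabs h)); last first.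
  by field; rewrite !gt_eqF.
apply: lerD; first by apply: le_trans H _; rewrite ler_pM2l.
by rewrite cabsM; apply: ler_pM => //; rewrite ?cabs_ge0 ?lerDl.
Qed.

Lemma has_cderiv_invB c z : z != c ->
  has_cderiv (fun z => (z - c)^-1) z (- (z - c)^-2).
Proof.
move=> zc e e0.
have zc0 : z - c != 0 by rewrite subr_eq0.
set a := cabs (z - c); have a0 : 0 < a by rewrite cabs_gt0.
have a3 : 0 < a ^+ 3 / 2 by rewrite divr_gt0 ?exprn_gt0.
exists (Num.min (a / 2) (e * (a ^+ 3 / 2))); first by rewrite lt_min divr_gt0// mulr_gt0.
move=> h; rewrite lt_min => /andP[ha he].
have ah : a / 2 <= cabs (z + h - c).
  have : a <= cabs (z + h - c) + cabs h.
    by rewrite /a (_ : z - c = (z + h - c) - h); [exact: cabsB|ring].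
  lra.
have zhc0 : z + h - c != 0 by rewrite -cabs_gt0; apply: lt_le_trans ah; rewrite divr_gt0.
have -> : (z + h - c)^-1 - (z - c)^-1 - - (z - c)^-2 * h =
   h * (h * ((z - c) ^- 2 * (z + h - c)^-1)) by field; rewrite zc0 zhc0.
rewrite !cabsM mulrC ler_wpM2r ?cabs_ge0//.
rewrite cabsV cabsX -/a cabsV.
apply: (@le_trans _ _ (cabs h * (a ^+ 2 * (a / 2))^-1)).
  have zhc1 : 0 < cabs (z + h - c) by apply: lt_le_trans ah; rewrite divr_gt0.
  rewrite ler_wpM2l ?cabs_ge0// -invfM lef_pV2 ?posrE ?mulr_gt0 ?exprn_gt0 ?divr_gt0//.
  by rewrite ler_pM2l ?exprn_gt0.
rewrite ler_pdivrMr ?mulr_gt0 ?exprn_gt0 ?divr_gt0// mulrA -exprSr.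
exact: ltW.
Qed.

(** Bridge from continuity stated with moduli to topological continuity. The source is arbitrary,
    since segments, the plane and polar coordinates all occur. *)
Lemma ccontinuous_comp (T : topologicalType) (u : T -> R[i]) f (t : T) :
  {for t, continuous (fun s => complex.Re (u s))} ->
  {for t, continuous (fun s => complex.Im (u s))} ->
  ccontinuous f (u t) ->
  [/\ {for t, continuous (fun s => complex.Re (f (u s)))},
      {for t, continuous (fun s => complex.Im (f (u s)))} &
      {for t, continuous (fun s => cabs (f (u s)))}].
Proof.
move=> cR cI cf.
have H : forall e : R, 0 < e -> \forall s \near t, cabs (f (u s) - f (u t)) < e.
  move=> e /cf [d d0 H].
  have d20 : 0 < d / 2 by rewrite divr_gt0.
  move/cvgrPdist_lt : cR => /(_ _ d20) cR; move/cvgrPdist_lt : cI => /(_ _ d20) cI.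
  near=> s; apply: H; rewrite cabsBC; apply: le_lt_trans (cabs_le_ReIm _) _.
  rewrite (splitr d) complex_ReB complex_ImB.
  by apply: ltrD; near: s; [exact: cR|exact: cI].
split; apply/cvgrPdist_lt => e /H He; near=> s;
  (have : cabs (f (u s) - f (u t)) < e by near: s; exact: He);
  apply: le_lt_trans; rewrite distrC.
- by rewrite -complex_ReB; exact: ler_Re_cabs.
- by rewrite -complex_ImB; exact: ler_Im_cabs.
- exact: cabs_lipschitz.
Unshelve. all: by end_near. Qed.

End complex_derivative_rules.

(** * Goursat's theorem and Cauchy estimates *)

Section segment_integral.
Variable R : realType.
Implicit Types (a b c d x y : R) (u v : R -> R).

(** Continuity is two-sided at the end points as well, so that it restricts to subsegments with no
    change of topology. *)
Definition continuous_on_segment a b u :=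
  forall x, a <= x <= b -> {for x, continuous u}.

Definition segment_integral a b u : R :=
  (\int[lebesgue_measure]_(x in `[a, b]) u x)%R.

Local Notation cts := continuous_on_segment.
Local Notation I := segment_integral.

Lemma continuous_on_segmentD a b u v : cts a b u -> cts a b v ->
  cts a b (fun x => u x + v x).
Proof. by move=> cu cv x xab; apply: cvgD; [exact: cu|exact: cv]. Qed.

Lemma continuous_on_segmentB a b u v : cts a b u -> cts a b v ->
  cts a b (fun x => u x - v x).
Proof. by move=> cu cv x xab; apply: cvgB; [exact: cu|exact: cv]. Qed.

Lemma continuous_on_segment_within a b u : cts a b u ->
  {within `[a, b], continuous u}.
Proof.
move=> cu; apply: continuous_in_subspaceT => x.
by rewrite inE /= in_itv /=; exact: cu.
Qed.

Lemma continuous_on_segment_integrable a b u : cts a b u ->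
  (@lebesgue_measure R).-integrable `[a, b] (EFin \o u).
Proof.
move=> cu; apply: continuous_compact_integrable; first exact: segment_compact.
exact: continuous_on_segment_within.
Qed.

Lemma segment_integralB a b u v : cts a b u -> cts a b v ->
  I a b (fun x => u x - v x) = I a b u - I a b v.
Proof. by move=> cu cv; apply: RintegralB => //; exact: continuous_on_segment_integrable. Qed.

Lemma segment_integral_split a m b u : a <= m -> m <= b -> cts a b u ->
  I a b u = I a m u + I m b u.
Proof.
move=> am mb cu; have iu := continuous_on_segment_integrable cu.
have := @Rintegral_itvB R u (BLeft a) (BRight b) m iu.
rewrite !bnd_simp => /(_ am mb) H.
rewrite /I -[RHS]addrC -[X in X + _](@Rintegral_itv_obnd_cbnd _ m); last first.
  apply: (integrableS _ _ _ iu) => //.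
  by apply: subset_itvr; rewrite bnd_simp.
by rewrite -H subrK.
Qed.

Lemma segment_integral_cst a b k : a <= b -> I a b (fun=> k) = k * (b - a).
Proof.
move=> ab; rewrite /I Rintegral_cst//= lebesgue_measure_itv/= lte_fin.
by case: ltP => [//|ba]; rewrite (le_anti (introT andP (conj ab ba))) subrr.
Qed.

Lemma le_segment_integral a b u v : cts a b u -> cts a b v ->
  (forall x, a <= x <= b -> u x <= v x) -> I a b u <= I a b v.
Proof.
by move=> cu cv uv; apply: le_Rintegral => //; exact: continuous_on_segment_integrable.
Qed.

Lemma continuous_on_segment_cst a b k : cts a b (fun=> k).
Proof. by move=> x _; exact: cst_continuous. Qed.

Lemma segment_integral_near_cst a b u k M : a <= b -> cts a b u ->
  (forall x, a <= x <= b -> `|u x - k| <= M) -> `|I a b u - k * (b - a)| <= M * (b - a).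
Proof.
move=> ab cu uM; have ck j := @continuous_on_segment_cst a b j.
rewrite ler_norml; apply/andP; split.
  rewrite lerBrDr -mulNr -mulrDl -segment_integral_cst//.
  apply: le_segment_integral => // x /uM; rewrite ler_norml; lra.
rewrite lerBlDr -mulrDl -segment_integral_cst//.
apply: le_segment_integral => // x /uM; rewrite ler_norml; lra.
Qed.

Lemma segment_integral_bound a b u M : a <= b -> cts a b u ->
  (forall x, a <= x <= b -> `|u x| <= M) -> `|I a b u| <= M * (b - a).
Proof.
move=> ab cu uM; rewrite -[I _ _ _]subr0 -(mul0r (b - a)).
by apply: segment_integral_near_cst => // x /uM; rewrite subr0.
Qed.

End segment_integral.

Lemma nested_intervals (R : realType) (l r : nat -> R) :
  (forall n, l n <= l n.+1) -> (forall n, r n.+1 <= r n) -> (forall n, l n <= r n) ->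
  exists x, forall n, l n <= x <= r n.
Proof.
move=> lS rS lr.
have lm : nondecreasing_seq l by apply/nondecreasing_seqP.
have rm : nonincreasing_seq r by apply/nonincreasing_seqP.
have lb m n : l m <= r n.
  have [mn|/ltnW nm] := leqP m n; first exact: le_trans (lm _ _ mn) (lr n).
  exact: le_trans (lr m) (rm _ _ nm).
exists (sup (range l)) => n; apply/andP; split.
  by apply: ub_le_sup; [exists (r 0%N) => _ [m _ <-]|exists n].
by apply: ge_sup; [exists (l 0%N), 0%N|move=> _ [m _ <-]].
Qed.

Section goursat.
Variable R : realType.
Implicit Types (h : R[i] -> R[i]) (a b c d : R).

Local Notation I := segment_integral.
Local Notation cts := continuous_on_segment.

(* Real part of the integral of [h] along the boundary of
   [a, b] x [c, d], described counterclockwise. *)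
Definition rect_integral h a b c d : R :=
  I a b (fun x => complex.Re (h (x +i* c)) - complex.Re (h (x +i* d))) -
  I c d (fun y => complex.Im (h (b +i* y)) - complex.Im (h (a +i* y))).

Definition ccontinuous_on h a b c d :=
  forall x y, a <= x <= b -> c <= y <= d -> ccontinuous h (x +i* y).

Definition cderivable_on h a b c d :=
  forall x y, a <= x <= b -> c <= y <= d -> exists l, has_cderiv h (x +i* y) l.

Lemma cderivable_ccontinuous_on h a b c d :
  cderivable_on h a b c d -> ccontinuous_on h a b c d.
Proof. by move=> H x y xab ycd; have [l /has_cderiv_ccontinuous] := H x y xab ycd. Qed.

Lemma ccontinuous_horizontal h x y : ccontinuous h (x +i* y) ->
  [/\ {for x, continuous (fun x => complex.Re (h (x +i* y)))},
      {for x, continuous (fun x => complex.Im (h (x +i* y)))} &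
      {for x, continuous (fun x => cabs (h (x +i* y)))}].
Proof.
move=> ch; apply: (@ccontinuous_comp R R (fun x => x +i* y) h x) => //=.
by move=> ?; exact: cvg_cst.
Qed.

Lemma ccontinuous_vertical h x y : ccontinuous h (x +i* y) ->
  [/\ {for y, continuous (fun y => complex.Re (h (x +i* y)))},
      {for y, continuous (fun y => complex.Im (h (x +i* y)))} &
      {for y, continuous (fun y => cabs (h (x +i* y)))}].
Proof.
move=> ch; apply: (@ccontinuous_comp R R (fun y => x +i* y) h y) => //=.
by move=> ?; exact: cvg_cst.
Qed.

Lemma cts_Re_horizontal h a b c : (forall x, a <= x <= b -> ccontinuous h (x +i* c)) ->
  cts a b (fun x => complex.Re (h (x +i* c))).
Proof. by move=> H x /H /ccontinuous_horizontal []. Qed.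

Lemma cts_Im_vertical h a c d : (forall y, c <= y <= d -> ccontinuous h (a +i* y)) ->
  cts c d (fun y => complex.Im (h (a +i* y))).
Proof. by move=> H x /H /ccontinuous_vertical []. Qed.

(* Only continuity on the boundaries of the two pieces is required, so that
   the interior may contain a singularity. *)
Lemma rect_integral_splitx h a m b c d : a <= m -> m <= b ->
  (forall x, a <= x <= b -> ccontinuous h (x +i* c) /\ ccontinuous h (x +i* d)) ->
  (forall y, c <= y <= d -> [/\ ccontinuous h (a +i* y), ccontinuous h (m +i* y) &
    ccontinuous h (b +i* y)]) ->
  rect_integral h a b c d = rect_integral h a m c d + rect_integral h m b c d.
Proof.
move=> am mb hx hy.
have ca : cts c d (fun y => complex.Im (h (a +i* y))).
  by apply: cts_Im_vertical => y /hy[].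
have cm : cts c d (fun y => complex.Im (h (m +i* y))).
  by apply: cts_Im_vertical => y /hy[].
have cb : cts c d (fun y => complex.Im (h (b +i* y))).
  by apply: cts_Im_vertical => y /hy[].
rewrite /rect_integral (segment_integral_split am mb); last first.
  by apply: continuous_on_segmentB; apply: cts_Re_horizontal => x /hx[].
rewrite !(segment_integralB (a := c))//.
lra.
Qed.

Lemma rect_integral_splity h a b c m d : c <= m -> m <= d ->
  (forall y, c <= y <= d -> ccontinuous h (a +i* y) /\ ccontinuous h (b +i* y)) ->
  (forall x, a <= x <= b -> [/\ ccontinuous h (x +i* c), ccontinuous h (x +i* m) &
    ccontinuous h (x +i* d)]) ->
  rect_integral h a b c d = rect_integral h a b c m + rect_integral h a b m d.
Proof.
move=> cm md hy hx.
have cc : cts a b (fun x => complex.Re (h (x +i* c))).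
  by apply: cts_Re_horizontal => y /hx[].
have cm' : cts a b (fun x => complex.Re (h (x +i* m))).
  by apply: cts_Re_horizontal => y /hx[].
have cd : cts a b (fun x => complex.Re (h (x +i* d))).
  by apply: cts_Re_horizontal => y /hx[].
rewrite /rect_integral (segment_integral_split (a := c) cm md); last first.
  by apply: continuous_on_segmentB; apply: cts_Im_vertical => y /hy[].
rewrite !(segment_integralB (a := a))//.
lra.
Qed.

Lemma ccontinuous_onS h a b c d a' b' c' d' : a <= a' -> b' <= b -> c <= c' -> d' <= d ->
  ccontinuous_on h a b c d -> ccontinuous_on h a' b' c' d'.
Proof.
move=> aa bb cc dd ch x y /andP[ax xb] /andP[cy yd].
by apply: ch; rewrite ?(le_trans aa)// ?(le_trans cc)//= ?(le_trans xb)// (le_trans yd).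
Qed.

(** Goursat's bisection, one direction at a time: each cut keeps the half with the larger integral
    and loses a factor 2. *)
Lemma rect_integral_quarter h a c w k : 0 <= w -> 0 <= k ->
  ccontinuous_on h a (a + w) c (c + k) ->
  exists p : R * R, [/\ a <= p.1 <= a + w / 2, c <= p.2 <= c + k / 2 &
    `|rect_integral h a (a + w) c (c + k)| <=
      4 * `|rect_integral h p.1 (p.1 + w / 2) p.2 (p.2 + k / 2)|].
Proof.
move=> w0 k0 ch.
have half w' k' a' c' : 0 <= w' -> 0 <= k' -> ccontinuous_on h a' (a' + w') c' (c' + k') ->
  exists2 a1, a1 = a' \/ a1 = a' + w' / 2 &
  `|rect_integral h a' (a' + w') c' (c' + k')| <=
      2 * `|rect_integral h a1 (a1 + w' / 2) c' (c' + k')|.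
  move=> w'0 k'0 ch'.
  have e2 : a' + w' / 2 + w' / 2 = a' + w' by lra.
  have -> : rect_integral h a' (a' + w') c' (c' + k') =
      rect_integral h a' (a' + w' / 2) c' (c' + k') +
      rect_integral h (a' + w' / 2) (a' + w') c' (c' + k').
    apply: rect_integral_splitx; [lra|lra|move=> x xab|move=> y ycd].
      by split; apply: ch' => //; lra.
    by split; apply: ch' => //; lra.
  set r1 := rect_integral _ _ (a' + w' / 2) _ _; set r2 := rect_integral _ _ _ _ _.
  have := ler_normD r1 r2.
  have [r12|r21] := leP `|r1| `|r2|.
    by exists (a' + w' / 2); [right|rewrite e2 -/r2; lra].
  by exists a'; [left|rewrite -/r1; lra].
have [a1 a1E Ha1] := half w k a c w0 k0 ch.
have ch1 : ccontinuous_on h a1 (a1 + w / 2) c (c + k).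
  by apply: ccontinuous_onS ch => //; case: a1E => ->; lra.
have [c1 c1E Hc1] : exists2 c1, c1 = c \/ c1 = c + k / 2 &
  `|rect_integral h a1 (a1 + w / 2) c (c + k)| <=
      2 * `|rect_integral h a1 (a1 + w / 2) c1 (c1 + k / 2)|.
  have e2 : c + k / 2 + k / 2 = c + k by lra.
  have -> : rect_integral h a1 (a1 + w / 2) c (c + k) =
      rect_integral h a1 (a1 + w / 2) c (c + k / 2) +
      rect_integral h a1 (a1 + w / 2) (c + k / 2) (c + k).
    apply: rect_integral_splity; [lra|lra|move=> x xab|move=> y ycd].
      by split; apply: ch1 => //; lra.
    by split; apply: ch1 => //; lra.
  set r1 := rect_integral _ _ _ _ (c + k / 2); set r2 := rect_integral _ _ _ _ _.
  have := ler_normD r1 r2.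
  have [r12|r21] := leP `|r1| `|r2|.
    by exists (c + k / 2); [right|rewrite e2 -/r2; lra].
  by exists c; [left|rewrite -/r1; lra].
exists (a1, c1) => /=; split; [by case: a1E => ->; lra|by case: c1E => ->; lra|lra].
Qed.

(** The affine part contributes nothing: its horizontal and its vertical sides both give
    [l2 * (b - a) * (d - c)], with opposite signs in [rect_integral]. Only the error [M] survives,
    on a boundary of length 2 (b - a) + 2 (d - c). *)
Lemma rect_integral_near_affine h l w0 a b c d M : a <= b -> c <= d ->
  ccontinuous_on h a b c d ->
  (forall x y, a <= x <= b -> c <= y <= d ->
     cabs (h (x +i* y) - h w0 - l * (x +i* y - w0)) <= M) ->
  `|rect_integral h a b c d| <= 2 * M * (b - a) + 2 * M * (d - c).
Proof.
move=> ab cd ch hM.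
have cR y : c <= y <= d -> cts a b (fun x => complex.Re (h (x +i* y))).
  by move=> ycd; apply: cts_Re_horizontal => x xab; exact: ch.
have cI x : a <= x <= b -> cts c d (fun y => complex.Im (h (x +i* y))).
  by move=> xab; apply: cts_Im_vertical => y ycd; exact: ch.
have [h1 h2] : c <= c <= d /\ c <= d <= d by rewrite !lexx cd.
have [h3 h4] : a <= a <= b /\ a <= b <= b by rewrite !lexx ab.
have hR x y : a <= x <= b -> c <= y <= d ->
   `|complex.Re (h (x +i* y)) - complex.Re (h w0) - complex.Re (l * (x +i* y - w0))| <= M.
  move=> xab ycd; apply: le_trans (hM _ _ xab ycd); rewrite -2!complex_ReB.
  exact: ler_Re_cabs.
have hI x y : a <= x <= b -> c <= y <= d ->
   `|complex.Im (h (x +i* y)) - complex.Im (h w0) - complex.Im (l * (x +i* y - w0))| <= M.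
  move=> xab ycd; apply: le_trans (hM _ _ xab ycd); rewrite -2!complex_ImB.
  exact: ler_Im_cabs.
case: l w0 hM hR hI => [l1 l2] [w1 w2] hM hR hI; rewrite /= in hR hI.
rewrite /rect_integral.
set u := I a b _; set v := I c d _.
have U : `|u - l2 * (d - c) * (b - a)| <= 2 * M * (b - a).
  apply: segment_integral_near_cst => //.
    by apply: continuous_on_segmentB; exact: cR.
  move=> x xab; have := hR x c xab h1; have := hR x d xab h2.
  rewrite !ler_norml => /andP[? ?] /andP[? ?]; apply/andP; split; lra.
have V : `|v - l2 * (b - a) * (d - c)| <= 2 * M * (d - c).
  apply: segment_integral_near_cst => //.
    by apply: continuous_on_segmentB; exact: cI.
  move=> y ycd; have := hI a y h3 ycd; have := hI b y h4 ycd.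
  rewrite !ler_norml => /andP[? ?] /andP[? ?]; apply/andP; split; lra.
have E : l2 * (d - c) * (b - a) = l2 * (b - a) * (d - c) by ring.
move: U V; rewrite E !ler_norml => /andP[? ?] /andP[? ?]; apply/andP; split; lra.
Qed.

Theorem goursat h a b c d : a <= b -> c <= d -> cderivable_on h a b c d ->
  rect_integral h a b c d = 0.
Proof.
move=> ab cd dh; have ch := cderivable_ccontinuous_on dh.
pose W n := (b - a) / 2 ^+ n; pose K n := (d - c) / 2 ^+ n.
have W0 n : 0 <= W n by rewrite /W divr_ge0 ?exprn_ge0// subr_ge0.
have K0 n : 0 <= K n by rewrite /K divr_ge0 ?exprn_ge0// subr_ge0.
have WS n : W n.+1 = W n / 2 by rewrite /W exprSr invfM mulrA.
have KS n : K n.+1 = K n / 2 by rewrite /K exprSr invfM mulrA.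
pose inside n (p : R * R) := [/\ a <= p.1, p.1 + W n <= b, c <= p.2 & p.2 + K n <= d].
pose Jr n (p : R * R) := `|rect_integral h p.1 (p.1 + W n) p.2 (p.2 + K n)|.
have step (np : nat * (R * R)) : exists q : R * R, inside np.1 np.2 ->
   [/\ inside np.1.+1 q, np.2.1 <= q.1, q.1 + W np.1.+1 <= np.2.1 + W np.1 &
     [/\ np.2.2 <= q.2, q.2 + K np.1.+1 <= np.2.2 + K np.1 &
     Jr np.1 np.2 <= 4 * Jr np.1.+1 q]].
  (* The choice must be total: outside the admissible positions [p] is a dummy value and the claim
     is vacuous. *)
  case: np => n p; have [/= inp|] := pselect (inside n p); last by exists p.
  case: inp => p1 p2 p3 p4.
  have chp := ccontinuous_onS p1 p2 p3 p4 ch.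
  have [q [q1 q2 qJ]] := rect_integral_quarter (W0 n) (K0 n) chp.
  by exists q => _; rewrite /inside /Jr WS KS; split; [split; lra|lra|lra|split; [lra|lra|exact: qJ]].
have [F HF] := choice step.
pose s := fix s n := if n is m.+1 then F (m, s m) else (a, c).
have ins n : inside n (s n).
  elim: n => [|n IH]; last by have [] := HF (n, s n) IH.
  by rewrite /inside /= /W /K expr0 !divr1; split=> //; lra.
have sS n := HF (n, s n) (ins n).
have [x0 Hx0] : exists x, forall n, (s n).1 <= x <= (s n).1 + W n.
  apply: nested_intervals => n; first by case: (sS n).
    by case: (sS n).
  by rewrite lerDl.
have [y0 Hy0] : exists y, forall n, (s n).2 <= y <= (s n).2 + K n.
  apply: nested_intervals => n; first by case: (sS n) => _ _ _ [].
    by case: (sS n) => _ _ _ [].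
  by rewrite lerDl.
have Jn n : `|rect_integral h a b c d| <= 4 ^+ n * Jr n (s n).
  elim: n => [|n IH].
    by rewrite expr0 mul1r /Jr /W /K expr0 !divr1 /= !(addrC _ (_ - _)) !subrK.
  apply: le_trans IH _; rewrite exprSr -mulrA ler_pM2l ?exprn_gt0//.
  by case: (sS n) => _ _ _ [].
set S := (b - a) + (d - c).
have S0 : 0 <= S by rewrite addr_ge0 ?subr_ge0.
have x0ab : a <= x0 <= b.
  by have := Hx0 0%N; rewrite /= /W expr0 divr1 addrC subrK.
have y0cd : c <= y0 <= d.
  by have := Hy0 0%N; rewrite /= /K expr0 divr1 addrC subrK.
have [l hl] := dh _ _ x0ab y0cd.
apply/eqP; rewrite -normr_le0; apply/ler_addgt0Pl => e e0; rewrite addr0.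
have S1 : 0 < S + 1 by lra.
(* The final bound is 4^n * 2 e1 (S / 2^n)^2 = 2 e1 S^2, at most [e]; [S + 1] instead of [S] allows
   a rectangle reduced to a point. *)
pose e1 := e / 2 / (S + 1) ^+ 2.
have e10 : 0 < e1 by rewrite !divr_gt0 ?exprn_gt0.
have [del del0 Hdel] := hl _ e10.
have [n Hn] : exists n, S / 2 ^+ n < del.
  have [n /ltW Hn] : exists n : nat, S / del < n%:R.
    by exists (Num.truncn (S / del)).+1; apply: truncnS_gt.
  exists n; rewrite ltr_pdivrMr ?exprn_gt0// mulrC -ltr_pdivrMr//.
  by apply: le_lt_trans Hn _; rewrite -natrX ltr_nat ltn_expl.
have SWK : W n + K n = S / 2 ^+ n by rewrite /W /K -mulrDl.
case: (ins n) => i1 i2 i3 i4.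
have Mb x y : (s n).1 <= x <= (s n).1 + W n -> (s n).2 <= y <= (s n).2 + K n ->
    cabs (h (x +i* y) - h (x0 +i* y0) - l * (x +i* y - x0 +i* y0)) <= e1 * (S / 2 ^+ n).
  move=> xs ys.
  have le1 : cabs (x +i* y - x0 +i* y0) <= S / 2 ^+ n.
    apply: le_trans (cabs_le_ReIm _) _; rewrite -SWK /=.
    by apply: lerD; have := Hx0 n; have := Hy0 n; rewrite ler_norml; lra.
  have /Hdel : cabs (x +i* y - x0 +i* y0) < del by apply: le_lt_trans Hn.
  rewrite [x0 +i* y0 + _]addrC subrK => /le_trans; apply.
  by rewrite ler_pM2l.
have := rect_integral_near_affine _ _ (ccontinuous_onS i1 i2 i3 i4 ch) Mb.
rewrite !lerDl => /(_ (W0 n) (K0 n)).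
rewrite !(addrAC _ _ (- _)) !subrr !add0r -mulrDr SWK => HJ.
apply: le_trans (Jn n) _.
apply: (@le_trans _ _ (4 ^+ n * (2 * (e1 * (S / 2 ^+ n)) * (S / 2 ^+ n)))).
  by rewrite ler_pM2l ?exprn_gt0.
have -> : 4 ^+ n * (2 * (e1 * (S / 2 ^+ n)) * (S / 2 ^+ n)) = 2 * e1 * S ^+ 2.
  have -> : (4 : R) = 2 ^+ 2 by rewrite expr2 -natrM.
  rewrite -exprM mulnC exprM.
  by field; rewrite expf_neq0.
rewrite /e1; have -> : 2 * (e / 2 / (S + 1) ^+ 2) * S ^+ 2 = e * (S ^+ 2 / (S + 1) ^+ 2).
  by field; rewrite gt_eqF.
rewrite ger_pMr// ler_pdivrMr ?exprn_gt0// mul1r.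
by apply: lerXn2r; rewrite ?nnegrE; lra.
Qed.

End goursat.

Ltac neq_lra := rewrite -subr_eq0;
  first [by apply: lt0r_neq0; lra | by apply: ltr0_neq0; lra].

Section cauchy_square.
Variable R : realType.
Implicit Types (h q : R[i] -> R[i]) (a b c d : R).

Local Notation I := segment_integral.
Local Notation cts := continuous_on_segment.

(** Arc-length integral over the boundary of the square with centre c1 + i c2 and half-side [s]. *)
Definition square_boundary_integral (u : R[i] -> R) (c1 c2 s : R) : R :=
  I (c1 - s) (c1 + s) (fun x => u (x +i* (c2 - s)) + u (x +i* (c2 + s))) +
  I (c2 - s) (c2 + s) (fun y => u ((c1 - s) +i* y) + u ((c1 + s) +i* y)).

Lemma rect_integral_bound h a b c d M : a <= b -> c <= d ->
  (forall x, a <= x <= b -> ccontinuous h (x +i* c) /\ ccontinuous h (x +i* d)) ->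
  (forall y, c <= y <= d -> ccontinuous h (a +i* y) /\ ccontinuous h (b +i* y)) ->
  (forall x, a <= x <= b -> cabs (h (x +i* c)) <= M /\ cabs (h (x +i* d)) <= M) ->
  (forall y, c <= y <= d -> cabs (h (a +i* y)) <= M /\ cabs (h (b +i* y)) <= M) ->
  `|rect_integral h a b c d| <= 2 * M * (b - a) + 2 * M * (d - c).
Proof.
move=> ab cd hx hy Mx My; apply: le_trans (ler_normB _ _) _; apply: lerD.
  apply: segment_integral_bound => //.
    by apply: continuous_on_segmentB; apply: cts_Re_horizontal => x /hx[].
  move=> x /Mx[M1 M2]; apply: le_trans (ler_normB _ _) _.
  have := ler_Re_cabs (h (x +i* c)); have := ler_Re_cabs (h (x +i* d)); lra.
apply: segment_integral_bound => //.
  by apply: continuous_on_segmentB; apply: cts_Im_vertical => x /hy[].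
move=> x /My[M1 M2]; apply: le_trans (ler_normB _ _) _.
have := ler_Im_cabs (h (a +i* x)); have := ler_Im_cabs (h (b +i* x)); lra.
Qed.

(** The four strips between the two squares avoid the centre, so [goursat] applies to each of them
    whatever happens at the centre. *)
Lemma rect_integral_shrink h c1 c2 e s : 0 < e -> e <= s ->
  (forall z, z != c1 +i* c2 -> exists l, has_cderiv h z l) ->
  rect_integral h (c1 - s) (c1 + s) (c2 - s) (c2 + s) =
  rect_integral h (c1 - e) (c1 + e) (c2 - e) (c2 + e).
Proof.
move=> e0 es dh.
have ne x y : x != c1 \/ y != c2 -> (x +i* y)%C != c1 +i* c2.
  by rewrite eq_complex /=; case=> /negPf ->; rewrite ?andbF.
have chx x y : x != c1 -> ccontinuous h (x +i* y).
  by move=> xc; have [|l /has_cderiv_ccontinuous//] := dh (x +i* y); apply: ne; left.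
have chy x y : y != c2 -> ccontinuous h (x +i* y).
  by move=> xc; have [|l /has_cderiv_ccontinuous//] := dh (x +i* y); apply: ne; right.
have dx x y : x != c1 -> exists l, has_cderiv h (x +i* y) l by move=> xc; apply: dh; apply: ne; left.
have dy x y : y != c2 -> exists l, has_cderiv h (x +i* y) l by move=> xc; apply: dh; apply: ne; right.
rewrite (@rect_integral_splitx _ h _ (c1 - e)); [|lra|lra| |]; last 2 first.
- by move=> x _; split; apply: chy; neq_lra.
- by move=> y _; split; apply: chx; neq_lra.
rewrite (@goursat _ h (c1 - s)); [|lra|lra|]; last first.
  by move=> x y xs _; apply: dx; neq_lra.
rewrite add0r (@rect_integral_splitx _ h _ (c1 + e)); [|lra|lra| |]; last 2 first.
- by move=> x _; split; apply: chy; neq_lra.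
- by move=> y _; split; apply: chx; neq_lra.
rewrite (@goursat _ h (c1 + e)); [|lra|lra|]; last first.
  by move=> x y xs _; apply: dx; neq_lra.
rewrite addr0 (@rect_integral_splity _ h _ _ _ (c2 - e)); [|lra|lra| |]; last 2 first.
- by move=> y _; split; apply: chx; neq_lra.
- by move=> x _; split; apply: chy; neq_lra.
rewrite (@goursat _ h _ _ (c2 - s)); [|lra|lra|]; last first.
  by move=> x y _ ys; apply: dy; neq_lra.
rewrite add0r (@rect_integral_splity _ h _ _ _ (c2 + e)); [|lra|lra| |]; last 2 first.
- by move=> y _; split; apply: chx; neq_lra.
- by move=> x _; split; apply: chy; neq_lra.
rewrite (@goursat _ h _ _ (c2 + e)) ?addr0//; [lra|lra|].
by move=> x y _ ys; apply: dy; neq_lra.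
Qed.

(** Replaces the evaluation of the winding number: Im 1/(t - i s) = s/(t^2 + s^2) is at least 1/(2
    s) on the bottom side of the square. The other three sides follow by quarter turns. *)
Lemma Im_div_bottom (w : R[i]) (r t s : R) : 0 <= r -> 0 < s -> `|t| <= s ->
  complex.Im ((w - r%:C) / (t -i* s)) <= cabs w / s - r / (2 * s).
Proof.
move=> r0 s0 ts; rewrite mulrBl complex_ImB.
have n2 : 0 < t ^+ 2 + s ^+ 2 by rewrite ltr_wpDl ?sqr_ge0// exprn_gt0.
have n2s : t ^+ 2 + s ^+ 2 <= 2 * s ^+ 2.
  rewrite mulrC mulr_natr mulr2n lerD2r -real_normK ?num_real//.
  by apply: lerXn2r; rewrite ?nnegrE// ltW.
have n1 : s <= cabs (t -i* s).
  by rewrite -[leLHS]gtr0_norm// -normrN; exact: (ler_Im_cabs (t -i* s)).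
apply: lerB.
  apply: le_trans (ler_norm _) (le_trans (ler_Im_cabs _) _).
  rewrite cabsM cabsV ler_wpM2l ?cabs_ge0// lef_pV2 ?posrE//.
  exact: lt_le_trans n1.
rewrite complex_ImM /= mul0r addr0 ler_wpM2l// mulNr opprK sqrrN.
rewrite ler_pdivlMr// mulrC ler_pdivrMr ?mulr_gt0//.
by rewrite mulrCA -expr2.
Qed.

Let i_neq0 : 'i != 0 :> R[i].
Proof. by rewrite eq_complex /= eqxx /= oner_eq0. Qed.

Let invi : 'i^-1 = - 'i :> R[i].
Proof. by apply: (mulIf i_neq0); rewrite mulVf// mulNr -expr2 sqr_i opprK. Qed.

Let Re_Ni (w : R[i]) : complex.Re (- 'i * w) = complex.Im w.
Proof. by case: w => a b /=; ring. Qed.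

Let Im_Ni (w : R[i]) : complex.Im (- 'i * w) = - complex.Re w.
Proof. by case: w => a b /=; ring. Qed.

Lemma Im_div_top (w : R[i]) (r t s : R) : 0 <= r -> 0 < s -> `|t| <= s ->
  - complex.Im ((w - r%:C) / (t +i* s)) <= cabs w / s - r / (2 * s).
Proof.
move=> r0 s0 ts; have -> : t +i* s = - (- t -i* s)%C.
  by apply/eqP; rewrite eq_complex /= !opprK !eqxx.
rewrite invrN mulrN; set W := (_ / _).
have -> : - complex.Im (- W) = complex.Im W by case: (W) => a b /=; rewrite opprK.
by apply: Im_div_bottom; rewrite ?normrN.
Qed.

Lemma Re_div_right (w : R[i]) (r t s : R) : 0 <= r -> 0 < s -> `|t| <= s ->
  complex.Re ((w - r%:C) / (s +i* t)) <= cabs w / s - r / (2 * s).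
Proof.
move=> r0 s0 ts; have -> : s +i* t = 'i * (t -i* s)%C.
  by apply/eqP; rewrite eq_complex /=; apply/andP; split; apply/eqP; ring.
by rewrite invfM invi mulrCA Re_Ni; exact: Im_div_bottom.
Qed.

Lemma Re_div_left (w : R[i]) (r t s : R) : 0 <= r -> 0 < s -> `|t| <= s ->
  - complex.Re ((w - r%:C) / (- s +i* t)) <= cabs w / s - r / (2 * s).
Proof.
move=> r0 s0 ts; have -> : - s +i* t = 'i * (t +i* s)%C.
  by apply/eqP; rewrite eq_complex /=; apply/andP; split; apply/eqP; ring.
by rewrite invfM invi mulrCA Re_Ni; exact: Im_div_top.
Qed.

(** The quotient (q - r)/(z - c) is o(1/|z - c|) at the centre, so its contour integral vanishes in
    the limit of small squares. The four side estimates then give the inequality, with 4 s where the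
    perimeter is 8 s. At the centre [q] is only continuous, so that difference quotients are
    allowed. *)
Lemma square_boundary_integral_ge_real q c1 c2 s r : 0 < s -> 0 <= r ->
  q (c1 +i* c2) = r%:C ->
  (forall z, ccontinuous q z) ->
  (forall z, z != c1 +i* c2 -> exists l, has_cderiv q z l) ->
  4 * s * r <= square_boundary_integral (fun z => cabs (q z)) c1 c2 s.
Proof.
move=> s0 r0 qc cq dq.
(* The integral of 1/(z - c) is imaginary; the factor [- 'i] makes it visible to [rect_integral],
   which records real parts. *)
pose h z := - 'i * ((q z - r%:C) * (z - c1 +i* c2)^-1).
have dh z : z != c1 +i* c2 -> exists l, has_cderiv h z l.
  move=> zc; have [l ql] := dq z zc.
  exists (0 * ((q z - r%:C) * (z - c1 +i* c2)^-1) + - 'i *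
    ((l - 0) * (z - c1 +i* c2)^-1 + (q z - r%:C) * (- (z - c1 +i* c2)^-2))).
  apply: has_cderivM; first exact: has_cderiv_cst.
  apply: has_cderivM; last exact: has_cderiv_invB.
  by apply: has_cderivB => //; exact: has_cderiv_cst.
have ne x y : x != c1 \/ y != c2 -> (x +i* y)%C != c1 +i* c2.
  by rewrite eq_complex /=; case=> /negPf ->; rewrite ?andbF.
have chx x y : x != c1 -> ccontinuous h (x +i* y).
  by move=> xc; have [|l /has_cderiv_ccontinuous//] := dh (x +i* y); apply: ne; left.
have chy x y : y != c2 -> ccontinuous h (x +i* y).
  by move=> xc; have [|l /has_cderiv_ccontinuous//] := dh (x +i* y); apply: ne; right.
have nei z : cabs (- 'i * z) = cabs z.
  rewrite cabsM cabsN cabsE /=.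
  by rewrite expr0n /= add0r expr1n sqrtr1 mul1r.
have J0 : rect_integral h (c1 - s) (c1 + s) (c2 - s) (c2 + s) = 0.
  apply/eqP; rewrite -normr_le0; apply/ler_addgt0Pl => e e0; rewrite addr0.
  (* A square of half-side [ep] has perimeter 8 ep, and |h| is at most (e / 8) / ep on it. Its
     points are within 2 ep of the centre, whence [d / 3] below. *)
  have e80 : 0 < e / 8 by rewrite divr_gt0.
  have [d d0 Hd] := cq (c1 +i* c2) _ e80.
  pose ep := Num.min s (d / 3).
  have ep0 : 0 < ep by rewrite lt_min s0 divr_gt0.
  have eps : ep <= s by rewrite ge_min lexx.
  have epd : ep <= d / 3 by rewrite ge_min lexx orbT.
  rewrite (rect_integral_shrink ep0 eps dh).
  have hM x y : `|x - c1| <= ep -> `|y - c2| <= ep -> ep <= `|x - c1| \/ ep <= `|y - c2| ->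
      cabs (h (x +i* y)) <= e / 8 / ep.
    move=> xe ye xye; rewrite /h nei cabsM cabsV.
    have zc : ep <= cabs ((x +i* y)%C - c1 +i* c2).
      case: xye => /le_trans; apply.
        exact: (ler_Re_cabs ((x +i* y)%C - c1 +i* c2)).
      exact: (ler_Im_cabs ((x +i* y)%C - c1 +i* c2)).
    apply: ler_pM; rewrite ?cabs_ge0 ?invr_ge0 ?cabs_ge0//.
      rewrite -qc ltW// Hd//; apply: le_lt_trans (cabs_le_ReIm _) _ => /=.
      apply: le_lt_trans (lerD xe ye) _; lra.
    by rewrite lef_pV2 ?posrE// (lt_le_trans ep0).
  have := @rect_integral_bound h (c1 - ep) (c1 + ep) (c2 - ep) (c2 + ep) (e / 8 / ep).
  have -> : c1 + ep - (c1 - ep) = 2 * ep by ring.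
  have -> : c2 + ep - (c2 - ep) = 2 * ep by ring.
  have -> : 2 * (e / 8 / ep) * (2 * ep) + 2 * (e / 8 / ep) * (2 * ep) = e.
    by field; rewrite gt_eqF.
  have n1 : `|c1 - ep - c1| = ep by rewrite (_ : _ - c1 = - ep) ?normrN ?gtr0_norm//; ring.
  have n2 : `|c1 + ep - c1| = ep by rewrite (_ : _ - c1 = ep) ?gtr0_norm//; ring.
  have n3 : `|c2 - ep - c2| = ep by rewrite (_ : _ - c2 = - ep) ?normrN ?gtr0_norm//; ring.
  have n4 : `|c2 + ep - c2| = ep by rewrite (_ : _ - c2 = ep) ?gtr0_norm//; ring.
  apply; [lra|lra| | | |].
  - by move=> x _; split; apply: chy; rewrite -subr_eq0 -normr_gt0 ?n3 ?n4.
  - by move=> x _; split; apply: chx; rewrite -subr_eq0 -normr_gt0 ?n1 ?n2.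
  - move=> x xe; have xe' : `|x - c1| <= ep by rewrite ler_norml; lra.
    by split; apply: hM; rewrite ?n3 ?n4//; right.
  - move=> y ye; have ye' : `|y - c2| <= ep by rewrite ler_norml; lra.
    by split; apply: hM; rewrite ?n1 ?n2//; left.
have rs : r / s = r / (2 * s) + r / (2 * s) by field; rewrite gt_eqF.
have bot x : c1 - s <= x <= c1 + s ->
  complex.Re (h (x +i* (c2 - s))) - complex.Re (h (x +i* (c2 + s))) <=
  (cabs (q (x +i* (c2 - s))) + cabs (q (x +i* (c2 + s)))) / s - r / s.
  move=> xs; have t1 : `|x - c1| <= s by rewrite ler_norml; lra.
  have := Im_div_bottom (q (x +i* (c2 - s))) r0 s0 t1.
  have := Im_div_top (q (x +i* (c2 + s))) r0 s0 t1.
  rewrite /h !Re_Ni (_ : (x +i* (c2 - s))%C - c1 +i* c2 = (x - c1) -i* s); last first.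
    by apply/eqP; rewrite eq_complex /=; apply/andP; split; apply/eqP; ring.
  rewrite (_ : (x +i* (c2 + s))%C - c1 +i* c2 = (x - c1) +i* s); last first.
    by apply/eqP; rewrite eq_complex /=; apply/andP; split; apply/eqP; ring.
  rewrite rs; lra.
have sid y : c2 - s <= y <= c2 + s ->
  - (complex.Im (h ((c1 + s) +i* y)) - complex.Im (h ((c1 - s) +i* y))) <=
  (cabs (q ((c1 - s) +i* y)) + cabs (q ((c1 + s) +i* y))) / s - r / s.
  move=> ys; have t1 : `|y - c2| <= s by rewrite ler_norml; lra.
  have := Re_div_right (q ((c1 + s) +i* y)) r0 s0 t1.
  have := Re_div_left (q ((c1 - s) +i* y)) r0 s0 t1.
  rewrite /h !Im_Ni (_ : ((c1 - s) +i* y)%C - c1 +i* c2 = (- s) +i* (y - c2)); last first.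
    by apply/eqP; rewrite eq_complex /=; apply/andP; split; apply/eqP; ring.
  rewrite (_ : ((c1 + s) +i* y)%C - c1 +i* c2 = s +i* (y - c2)); last first.
    by apply/eqP; rewrite eq_complex /=; apply/andP; split; apply/eqP; ring.
  rewrite rs; lra.
have cqx y a b : cts a b (fun x => cabs (q (x +i* y))).
  by move=> x _; have [] := ccontinuous_horizontal (cq (x +i* y)).
have cqy x a b : cts a b (fun y => cabs (q (x +i* y))).
  by move=> y _; have [] := ccontinuous_vertical (cq (x +i* y)).
have cZ a b u : cts a b u -> cts a b (fun x => u x / s).
  by move=> cu x xab; apply: cvgMr_tmp; exact: cu.
have IZ a b u : cts a b u -> I a b (fun x => u x / s) = I a b u / s.
  by move=> cu; apply: RintegralZr => //; exact: continuous_on_segment_integrable.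
move: J0; rewrite /rect_integral /square_boundary_integral.
set A := I _ _ _; set B := I _ _ _; set A' := I _ _ _; set B' := I _ _ _ => AB.
have ctsA : cts (c1 - s) (c1 + s) (fun x => complex.Re (h (x +i* (c2 - s))) - complex.Re (h (x +i* (c2 + s)))).
  by apply: continuous_on_segmentB; apply: cts_Re_horizontal => x _; apply: chy; neq_lra.
have ctsB : cts (c2 - s) (c2 + s) (fun y => complex.Im (h ((c1 + s) +i* y)) - complex.Im (h ((c1 - s) +i* y))).
  by apply: continuous_on_segmentB; apply: cts_Im_vertical => y _; apply: chx; neq_lra.
have HA : A <= A' / s - r / s * (2 * s).
  rewrite /A' -IZ; last by apply: continuous_on_segmentD.
  have -> : 2 * s = (c1 + s) - (c1 - s) by ring.
  rewrite -segment_integral_cst; last by lra.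
  rewrite -segment_integralB; last 2 first.
  - by apply: cZ; apply: continuous_on_segmentD.
  - exact: continuous_on_segment_cst.
  apply: le_segment_integral => //.
  apply: continuous_on_segmentB; last exact: continuous_on_segment_cst.
  by apply: cZ; apply: continuous_on_segmentD.
have HB : - B <= B' / s - r / s * (2 * s).
  rewrite -sub0r -(mul0r (c2 + s - (c2 - s))) -segment_integral_cst; last by lra.
  rewrite -segment_integralB//; last exact: continuous_on_segment_cst.
  rewrite /B' -IZ; last by apply: continuous_on_segmentD.
  have -> : 2 * s = (c2 + s) - (c2 - s) by ring.
  rewrite -segment_integral_cst; last by lra.
  rewrite -segment_integralB; last 2 first.
  - by apply: cZ; apply: continuous_on_segmentD.
  - exact: continuous_on_segment_cst.
  apply: le_segment_integral => //.
  - by apply: continuous_on_segmentB => //; exact: continuous_on_segment_cst.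
  - apply: continuous_on_segmentB; last exact: continuous_on_segment_cst.
    by apply: cZ; apply: continuous_on_segmentD.
  - by move=> y ys; rewrite sub0r; exact: sid.
have rss : r / s * (2 * s) = 2 * r by field; rewrite gt_eqF.
have : 4 * r <= (A' + B') / s by rewrite mulrDl; lra.
by rewrite ler_pdivlMr// mulrAC.
Qed.

(** A rotation of [q] makes its value at the centre a nonnegative real. This is why the real part of
    contour integrals suffices throughout. *)
Theorem cabs_le_square_boundary q c1 c2 s : 0 < s ->
  (forall z, ccontinuous q z) ->
  (forall z, z != c1 +i* c2 -> exists l, has_cderiv q z l) ->
  4 * s * cabs (q (c1 +i* c2)) <= square_boundary_integral (fun z => cabs (q z)) c1 c2 s.
Proof.
move=> s0 cq dq; set w := q (c1 +i* c2).
have [u u1 uw] : exists2 u : R[i], cabs u = 1 & u * w = (cabs w)%:C.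
  have [->|w0] := eqVneq w 0; first by exists 1; rewrite ?cabs1// mulr0 cabs0.
  exists ((cabs w)%:C / w).
    by rewrite cabsM cabsV cabs_real ger0_norm ?cabs_ge0// divff// cabs_eq0.
  by rewrite divfK.
have -> : (fun z => cabs (q z)) = (fun z => cabs (u * q z)).
  by apply/funext => z; rewrite cabsM u1 mul1r.
apply: square_boundary_integral_ge_real => //; first exact: cabs_ge0.
- move=> z e /(cq z) [d d0 H]; exists d => // v /H.
  by rewrite -mulrBr cabsM u1 mul1r.
- move=> z /dq [l ql]; exists (0 * q z + u * l).
  by apply: has_cderivM => //; exact: has_cderiv_cst.
Qed.

End cauchy_square.

Section entire_functions.
Variable R : realType.
Implicit Types (f g q : R[i] -> R[i]) (z w l c : R[i]).

Definition cholomorphic f := forall z, exists l, has_cderiv f z l.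

Lemma cholomorphic_ccontinuous f z : cholomorphic f -> ccontinuous f z.
Proof. by move=> /(_ z) [l /has_cderiv_ccontinuous]. Qed.

(** The boundary of the square lies in the annulus between radii [s] and [2 * s], a condition on
    moduli that is easier to check. The factor 2 is the perimeter 8 s over the constant 4 s. *)
Lemma cabs_le_square_sup q (c1 c2 s M : R) : 0 < s ->
  (forall z, ccontinuous q z) ->
  (forall z, z != c1 +i* c2 -> exists l, has_cderiv q z l) ->
  (forall z, s <= cabs (z - c1 +i* c2) <= 2 * s -> cabs (q z) <= M) ->
  cabs (q (c1 +i* c2)) <= 2 * M.
Proof.
move=> s0 cq dq qM.
have cqx y a b : continuous_on_segment a b (fun x => cabs (q (x +i* y))).
  by move=> x _; have [] := ccontinuous_horizontal (cq (x +i* y)).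
have cqy x a b : continuous_on_segment a b (fun y => cabs (q (x +i* y))).
  by move=> y _; have [] := ccontinuous_vertical (cq (x +i* y)).
have bd x y : `|x - c1| <= s -> `|y - c2| <= s -> s <= `|x - c1| \/ s <= `|y - c2| ->
    cabs (q (x +i* y)) <= M.
  move=> xe ye xye; apply: qM; apply/andP; split.
    case: xye => /le_trans; apply.
      exact: (ler_Re_cabs ((x +i* y)%C - c1 +i* c2)).
    exact: (ler_Im_cabs ((x +i* y)%C - c1 +i* c2)).
  by apply: le_trans (cabs_le_ReIm _) _; rewrite mulrC mulr_natr mulr2n /=; exact: lerD.
have n1 : `|c1 - s - c1| = s by rewrite (_ : _ - c1 = - s) ?normrN ?gtr0_norm//; ring.
have n2 : `|c1 + s - c1| = s by rewrite (_ : _ - c1 = s) ?gtr0_norm//; ring.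
have n3 : `|c2 - s - c2| = s by rewrite (_ : _ - c2 = - s) ?normrN ?gtr0_norm//; ring.
have n4 : `|c2 + s - c2| = s by rewrite (_ : _ - c2 = s) ?gtr0_norm//; ring.
have := cabs_le_square_boundary s0 cq dq; rewrite /square_boundary_integral.
set A := segment_integral _ _ _; set B := segment_integral _ _ _ => AB.
have HA : A <= 2 * M * (c1 + s - (c1 - s)).
  rewrite -segment_integral_cst; last by lra.
  apply: le_segment_integral; first exact: continuous_on_segmentD.
    exact: continuous_on_segment_cst.
  move=> x xs; have xs' : `|x - c1| <= s by rewrite ler_norml; lra.
  have := bd x (c2 - s) xs'; rewrite n3 => /(_ (lexx _) (or_intror (lexx _))).
  have := bd x (c2 + s) xs'; rewrite n4 => /(_ (lexx _) (or_intror (lexx _))).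
  lra.
have HB : B <= 2 * M * (c2 + s - (c2 - s)).
  rewrite -segment_integral_cst; last by lra.
  apply: le_segment_integral; first exact: continuous_on_segmentD.
    exact: continuous_on_segment_cst.
  move=> y ys; have ys' : `|y - c2| <= s by rewrite ler_norml; lra.
  have := bd (c1 - s) y; rewrite n1 => /(_ (lexx _) ys' (or_introl (lexx _))).
  have := bd (c1 + s) y; rewrite n2 => /(_ (lexx _) ys' (or_introl (lexx _))).
  lra.
have : 4 * s * cabs (q (c1 +i* c2)) <= 4 * s * (2 * M) by lra.
by rewrite ler_pM2l// mulr_gt0.
Qed.

Lemma has_cderiv_near f g z l (d : R) : 0 < d -> (forall w, cabs (w - z) < d -> f w = g w) ->
  has_cderiv f z l -> has_cderiv g z l.
Proof.
move=> d0 fg fl e e0; have [d' d'0 H] := fl e e0.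
exists (Num.min d d'); first by rewrite lt_min d0.
move=> h; rewrite lt_min => /andP[hd /H].
by rewrite !fg// ?subrr ?cabs0// addrAC subrr add0r.
Qed.

(** Cauchy's estimate, from [cabs_le_square_sup] for the difference quotient at [c] extended by [l]:
    it is continuous at [c], differentiable elsewhere, and at most 2 M / s on the annulus. *)
Lemma cabs_cderiv_le f c l (s M : R) : 0 < s -> cholomorphic f -> has_cderiv f c l ->
  (forall z, cabs (z - c) <= 2 * s -> cabs (f z) <= M) -> cabs l <= 4 * M / s.
Proof.
move=> s0 hf fl fM; case: c fl fM => c1 c2 fl fM.
set c := c1 +i* c2.
pose q z := if z == c then l else (f z - f c) / (z - c).
have dq z : z != c -> exists l, has_cderiv q z l.
  move=> zc; have [l' fl'] := hf z.
  exists ((l' - 0) * (z - c)^-1 + (f z - f c) * (- (z - c)^-2)).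
  apply: (@has_cderiv_near (fun z => (f z - f c) / (z - c)) _ _ _ (cabs (z - c))).
  - by rewrite cabs_gt0 subr_eq0.
  - move=> w wz; rewrite /q; case: eqVneq => // wc.
    by move: wz; rewrite wc cabsBC ltxx.
  - apply: has_cderivM; last exact: has_cderiv_invB.
    by apply: has_cderivB => //; exact: has_cderiv_cst.
have qc : q c = l by rewrite /q eqxx.
have cq z : ccontinuous q z.
  have [->|/dq [l' /has_cderiv_ccontinuous//]] := eqVneq z c.
  move=> e e0; have e20 : 0 < e / 2 by rewrite divr_gt0.
  have [d d0 H] := fl _ e20; exists d => // w wd; rewrite qc /q.
  case: eqVneq => [_|wc]; first by rewrite subrr cabs0.
  have wc0 : w - c != 0 by rewrite subr_eq0.
  have := H _ wd; rewrite -/c [c + _]addrC subrK.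
  have -> : f w - f c - l * (w - c) = ((f w - f c) / (w - c) - l) * (w - c).
    by rewrite mulrBl divfK.
  rewrite cabsM ler_pM2r ?cabs_gt0// => /le_lt_trans; apply; lra.
have := @cabs_le_square_sup q c1 c2 s (2 * M / s) s0 cq dq.
rewrite -/c qc mulrA => H; rewrite (_ : 4 * M / s = 2 * (2 * M) / s); last by congr (_ / s); ring.
apply: H => z /andP[z1 z2].
have zc : z != c by rewrite -subr_eq0 -cabs_gt0; exact: lt_le_trans z1.
rewrite /q (negPf zc) cabsM cabsV; apply: ler_pM; rewrite ?cabs_ge0 ?invr_ge0 ?cabs_ge0//.
  apply: le_trans (cabsB _ _) _; have := fM z z2.
  have : cabs (f c) <= M by apply: fM; rewrite subrr cabs0 mulr_ge0 ?ltW.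
  lra.
by rewrite lef_pV2 ?posrE//; exact: lt_le_trans z1.
Qed.

Lemma ccontinuous_bounded f (r : R) : (forall z, ccontinuous f z) ->
  exists2 M, 0 <= M & forall z, cabs z <= r -> cabs (f z) <= M.
Proof.
move=> cf.
have [r0|r0] := ltP r 0.
  exists 0 => // z zr; have := cabs_ge0 z; lra.
pose A : set (R * R) := `[- r, r]%classic `*` `[- r, r]%classic.
have cA : compact A by apply: compact_setX; exact: segment_compact.
have cu : continuous (fun p : R * R => cabs (f (p.1 +i* p.2))).
  move=> p.
  have c1 : {for p, continuous (fun q : R * R => q.1)} by exact: cvg_fst.
  have c2 : {for p, continuous (fun q : R * R => q.2)} by exact: cvg_snd.
  by case: (@ccontinuous_comp R (R * R)%type (fun p => p.1 +i* p.2) f p c1 c2 (cf _)).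
have A0 : A !=set0 by exists (0, 0); split => /=; rewrite in_itv /=; lra.
have [p pA Hp] := compact_EVT_max A0 cA (continuous_subspaceT cu).
exists (cabs (f (p.1 +i* p.2))); first exact: cabs_ge0.
move=> [a b] zr; apply: (Hp (a, b)); rewrite inE; split => /=; rewrite in_itv /= -ler_norml.
  exact: le_trans (ler_Re_cabs (a +i* b)) zr.
exact: le_trans (ler_Im_cabs (a +i* b)) zr.
Qed.

Lemma is_derive_real (u : R -> R) (t m : R) :
  (forall e, 0 < e -> exists2 d, 0 < d & forall h, `|h| < d ->
     `|u (t + h) - u t - m * h| <= e * `|h|) -> is_derive t 1 u m.
Proof.
move=> H.
suff : h^-1 *: ((u \o shift t) (h *: (1 : R)) - u t) @[h --> 0^'] --> m.
  by move=> cu; apply: DeriveDef; [apply/cvg_ex; exists m|exact: cvg_lim].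
apply/cvgrPdist_le => e /H [d d0 Hd].
rewrite near_withinE; apply/nbhs_ballP; exists d => //= h.
rewrite /ball /= sub0r normrN => /Hd; rewrite /GRing.scale /= => hd h0.
have -> : m - h^-1 * (u (h * 1 + t) - u t) = - (h^-1 * (u (t + h) - u t - m * h)).
  by rewrite mulr1 (addrC h) [in RHS]mulrBr (mulrC m) mulKf// opprB.
by rewrite normrN normrM normfV mulrC ler_pdivrMr ?normr_gt0.
Qed.

(** The real mean value theorem is applied to the real and imaginary parts along the segment, at two
    different points, which costs the factor 2. *)
Lemma cabs_mean_value f D z w (B : R) : (forall v, has_cderiv f v (D v)) ->
  (forall t : R, 0 <= t <= 1 -> cabs (D (z + t%:C * (w - z))) <= B) ->
  cabs (f w - f z) <= 2 * B * cabs (w - z).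
Proof.
move=> HD fB.
pose p (t : R) := z + t%:C * (w - z).
have ptE (t h : R) : p (t + h) = p t + h%:C * (w - z).
  by rewrite /p rmorphD /= mulrDl addrA.
have der (t e : R) : 0 < e -> exists2 d, 0 < d & forall h, `|h| < d ->
  cabs (f (p (t + h)) - f (p t) - D (p t) * (w - z) * h%:C) <= e * `|h|.
  move=> e0; have k0 : 0 < cabs (w - z) + 1 by rewrite ltr_wpDl// cabs_ge0.
  have e10 : 0 < e / (cabs (w - z) + 1) by rewrite divr_gt0.
  have [d d0 H] := HD (p t) _ e10.
  exists (d / (cabs (w - z) + 1)); first by rewrite divr_gt0.
  move=> h; rewrite ltr_pdivlMr// => hd.
  have hh : cabs (h%:C * (w - z)) <= `|h| * (cabs (w - z) + 1).
    by rewrite cabsM cabs_real ler_wpM2l// lerDl.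
  have := H _ (le_lt_trans hh hd).
  rewrite -ptE (_ : D (p t) * (h%:C * (w - z)) = D (p t) * (w - z) * h%:C); last by ring.
  move=> /le_trans; apply.
  by rewrite mulrAC ler_pdivrMr// -mulrA ler_pM2l// .
have dR (t : R) : is_derive t 1 (fun t : R => complex.Re (f (p t))) (complex.Re (D (p t) * (w - z))).
  apply: is_derive_real => e /(der t e) [d d0 H]; exists d => // h /H Hh; apply: le_trans Hh.
  have -> : complex.Re (D (p t) * (w - z)) * h = complex.Re (D (p t) * (w - z) * h%:C).
    by rewrite [in RHS]complex_ReM /= mulr0 subr0.
  by rewrite -2!complex_ReB; exact: ler_Re_cabs.
have dI (t : R) : is_derive t 1 (fun t : R => complex.Im (f (p t))) (complex.Im (D (p t) * (w - z))).
  apply: is_derive_real => e /(der t e) [d d0 H]; exists d => // h /H Hh; apply: le_trans Hh.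
  have -> : complex.Im (D (p t) * (w - z)) * h = complex.Im (D (p t) * (w - z) * h%:C).
    by rewrite [in RHS]complex_ImM /= mulr0 add0r.
  by rewrite -2!complex_ImB; exact: ler_Im_cabs.
have cont (u u' : R -> R) : (forall t : R, is_derive t 1 u (u' t)) ->
    {within `[0, 1], continuous u}.
  move=> du; apply: derivable_within_continuous => t _.
  by case: (du t).
have p0 : p 0 = z by rewrite /p mul0r addr0.
have p1 : p 1 = w by rewrite /p mul1r addrC subrK.
have bnd (t : R) : t \in `[0, 1]%R -> cabs (D (p t) * (w - z)) <= B * cabs (w - z).
  rewrite in_itv /= => t01; rewrite cabsM ler_wpM2r ?cabs_ge0//.
  exact: fB t01.
have [t1 t1i E1] := MVT_segment ler01 (fun t _ => dR t) (cont _ _ dR).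
have [t2 t2i E2] := MVT_segment ler01 (fun t _ => dI t) (cont _ _ dI).
apply: le_trans (cabs_le_ReIm _) _.
rewrite complex_ReB complex_ImB; move: E1 E2; rewrite p0 p1 subr0 !mulr1 => -> ->.
have := le_trans (ler_Re_cabs _) (bnd _ t1i).
have := le_trans (ler_Im_cabs _) (bnd _ t2i).
lra.
Qed.

Lemma cabs_segment_le z w (t r : R) : 0 <= t <= 1 -> cabs z <= r -> cabs w <= r ->
  cabs (z + t%:C * (w - z)) <= r.
Proof.
move=> /andP[t0 t1] zr wr.
have -> : z + t%:C * (w - z) = (1 - t)%:C * z + t%:C * w.
  by rewrite rmorphB /= rmorph1; ring.
apply: le_trans (cabsD _ _) _; rewrite !cabsM !cabs_real !ger0_norm ?subr_ge0//.
have : (1 - t) * cabs z <= (1 - t) * r by rewrite ler_wpM2l// subr_ge0.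
have : t * cabs w <= t * r by rewrite ler_wpM2l.
lra.
Qed.

Lemma cholomorphic_lipschitz f (r : R) : cholomorphic f ->
  exists2 L, 0 <= L & forall z w, cabs z <= r -> cabs w <= r ->
    cabs (f w - f z) <= L * cabs (w - z).
Proof.
move=> hf; have cf z := cholomorphic_ccontinuous z hf.
(* Room for the disc of radius [2 * s], with [s = 1], on which [cabs_cderiv_le] needs a bound. *)
have [M M0 fM] := ccontinuous_bounded (r + 2) cf.
exists (2 * (4 * M / 1)); first by rewrite divr1 !mulr_ge0.
have [D HD] := choice (fun z => hf z).
move=> z w zr wr; apply: (cabs_mean_value HD) => // t t01.
apply: cabs_cderiv_le (HD _) _ => // v vz; apply: fM.
rewrite -(subrK (z + t%:C * (w - z)) v) addrC; apply: le_trans (cabsD _ _) _.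
by apply: lerD; [exact: cabs_segment_le|rewrite -[leRHS]mulr1].
Qed.

(** No second derivative is involved: [D w - D z] is the derivative at [z] of f(v + (w - z)) - f(v),
    which is of size |w - z| on a disc, so Cauchy's estimate bounds it. The remainder follows by the
    mean value inequality for f(v) - D(z) v. Uniformity in both points serves to differentiate under
    the integral in [hausdorff_cholomorphic]. *)
Lemma cholomorphic_taylor1 f D (r : R) : (forall z, has_cderiv f z (D z)) ->
  exists2 K, 0 <= K & forall z w, cabs z <= r -> cabs w <= r ->
    cabs (D w - D z) <= K * cabs (w - z) /\
    cabs (f w - f z - D z * (w - z)) <= K * cabs (w - z) ^+ 2.
Proof.
move=> HD; have hf : cholomorphic f by move=> z; exists (D z).
have [L L0 fL] := cholomorphic_lipschitz (r + 2) hf.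
have DL z w : cabs z <= r -> cabs w <= r -> cabs (D w - D z) <= 4 * L * cabs (w - z).
  move=> zr wr.
  have dF v : has_cderiv (fun v => f (v + (w - z)) - f v) v (D (v + (w - z)) * (1 + 0) - D v).
    apply: has_cderivB => //.
    apply: (@has_cderiv_comp _ f (fun v => v + (w - z))) => //.
    by apply: (@has_cderivD _ id) ; [exact: has_cderiv_id|exact: has_cderiv_cst].
  have hF : cholomorphic (fun v => f (v + (w - z)) - f v) by move=> v; eexists; exact: dF.
  have := @cabs_cderiv_le _ z _ 1 (L * cabs (w - z)) ltr01 hF (dF z).
  rewrite addr0 (mulr1 (D _)) [z + _]addrC subrK divr1 mulrA => H; apply: H.
  move=> v; rewrite mulr1 => vz.
  have vr : cabs v <= r + 2.
    rewrite -(subrK z v) addrC; apply: le_trans (cabsD _ _) _.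
    exact: lerD.
  have vr' : cabs (v + (w - z)) <= r + 2.
    rewrite (_ : v + (w - z) = w + (v - z)); last by ring.
    apply: le_trans (cabsD _ _) _; exact: lerD.
  by have := fL _ _ vr vr'; rewrite (addrAC v) subrr add0r.
exists (8 * L); first by rewrite mulr_ge0.
move=> z w zr wr; split.
  apply: le_trans (DL _ _ zr wr) _; rewrite ler_wpM2r ?cabs_ge0//.
  by rewrite ler_wpM2r// ler_nat.
have dG v : has_cderiv (fun v => f v - D z * v) v (D v - (0 * v + D z * 1)).
  apply: has_cderivB => //; apply: has_cderivM; first exact: has_cderiv_cst.
  exact: has_cderiv_id.
have := cabs_mean_value (z := z) (w := w) (B := 4 * L * cabs (w - z)) dG.
rewrite (_ : _ - _ - (f z - D z * z) = f w - f z - D z * (w - z)); last by ring.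
rewrite (_ : 2 * (4 * L * cabs (w - z)) * cabs (w - z) = 8 * L * cabs (w - z) ^+ 2); last by ring.
apply => t t01; rewrite mul0r add0r mulr1.
apply: le_trans (DL _ _ zr (cabs_segment_le t01 zr wr)) _.
rewrite ler_wpM2l ?mulr_ge0// addrAC subrr add0r cabsM cabs_real.
case/andP: t01 => t0 t1; rewrite ger0_norm//.
by rewrite ler_piMl// cabs_ge0.
Qed.

End entire_functions.

(** * Integration over rectangles *)

Section measure_preliminaries.
Variable R : realType.
Local Notation mu := (@lebesgue_measure R).
Local Open Scope ereal_scope.

(** An open set is the union of the countably many rational boxes that it contains. This reconciles
    the Borel sets of the plane with the product sigma-algebra used by Tonelli. *)
Lemma open_measurable_prod (U : set (R * R)) : open U ->
  measurable (U : set (measurableTypeR R * measurableTypeR R)).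
Proof.
move=> oU.
pose box (q : (rat * rat) * (rat * rat)) : set (measurableTypeR R * measurableTypeR R) :=
  `]ratr q.1.1, ratr q.1.2[%classic `*` `]ratr q.2.1, ratr q.2.2[%classic.
have -> : U = \bigcup_q (if `[< box q `<=` U >] then box q else set0).
  apply/seteqP; split=> [[x y] Uxy|z [q _]]; last by case: asboolP => // qU; exact: qU.
  have [e /= e0 eU] : exists2 e : R, (0 < e)%R & ball (x, y) e `<=` U.
    by have /nbhs_ballP [e e0 H] := open_nbhs_nbhs (conj oU Uxy); exists e.
  have [q1 Hq1] := @rat_in_itvoo R (x - e)%R x ltac:(lra).
  have [q2 Hq2] := @rat_in_itvoo R x (x + e)%R ltac:(lra).
  have [q3 Hq3] := @rat_in_itvoo R (y - e)%R y ltac:(lra).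
  have [q4 Hq4] := @rat_in_itvoo R y (y + e)%R ltac:(lra).
  rewrite !in_itv /= in Hq1 Hq2 Hq3 Hq4.
  exists ((q1, q2), (q3, q4)) => //.
  case: asboolP => [_|]; first by split; rewrite /= in_itv /=; lra.
  move=> nbox; exfalso; apply: nbox => -[x' y'] [/= H1 H2]; apply: eU; rewrite !in_itv /= in H1 H2.
  split; rewrite /ball /= ltr_norml; lra.
apply: countable_bigcupT_measurable => [|q]; first exact: countableP.
case: ifP => // _.
by apply: measurableX; exact: measurable_itv.
Qed.

Lemma continuous_measurable_prod (f : R * R -> R) : continuous f ->
  measurable_fun setT (f : measurableTypeR R * measurableTypeR R -> measurableTypeR R).
Proof.
move=> cf; apply: (measurability _ (RGenOInfty.measurableE R)).
move=> /= _ [_ [a ->]] <-; apply: measurableI => //.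
apply: open_measurable_prod; move/continuousP : cf; apply; exact: interval_open.
Qed.

Lemma integral_rect d1 d2 (T1 : measurableType d1) (T2 : measurableType d2)
    (m1 : {sigma_finite_measure set T1 -> \bar R}) (m2 : {sigma_finite_measure set T2 -> \bar R})
    (A : set T1) (B : set T2) (f : T1 * T2 -> \bar R) :
  measurable A -> measurable B -> measurable_fun setT f -> (forall z, 0 <= f z) ->
  \int[m1 \x m2]_(z in A `*` B) f z = \int[m1]_(x in A) \int[m2]_(y in B) f (x, y) /\
  \int[m1 \x m2]_(z in A `*` B) f z = \int[m2]_(y in B) \int[m1]_(x in A) f (x, y).
Proof.
move=> mA mB mf f0.
have mAB : measurable (A `*` B) by exact: measurableX.
have mfAB : measurable_fun setT (f \_ (A `*` B)).
  by apply/(measurable_restrictT _ _).1 => //; exact: measurable_funTS.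
have fAB0 z : 0 <= (f \_ (A `*` B)) z by apply: erestrict_ge0.
have patE x y : (f \_ (A `*` B)) (x, y) =
    ((fun x => ((fun y => f (x, y)) \_ B) y) \_ A) x.
  rewrite /patch; case: (boolP (x \in A)) => xA; case: (boolP (y \in B)) => yB.
  - by rewrite mem_set//; split; apply/set_mem.
  - by rewrite memNset// => -[_ /mem_set]; rewrite (negPf yB).
  - by rewrite memNset// => -[/mem_set]; rewrite (negPf xA).
  - by rewrite memNset// => -[/mem_set]; rewrite (negPf xA).
rewrite integral_mkcond; split.
- transitivity (\int[m1]_x fubini_F m2 (f \_ (A `*` B)) x); first exact: fubini_tonelli1.
  rewrite [RHS]integral_mkcond; apply: eq_integral => x _.
  rewrite /fubini_F [RHS]/patch; case: ifPn => xA.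
    rewrite [RHS]integral_mkcond; apply: eq_integral => y _.
    by rewrite patE /patch xA.
  by rewrite integral0_eq// => y _; rewrite patE /patch (negPf xA).
- transitivity (\int[m2]_y fubini_G m1 (f \_ (A `*` B)) y); first exact: fubini_tonelli2.
  rewrite [RHS]integral_mkcond; apply: eq_integral => y _.
  rewrite /fubini_G [RHS]/patch; case: ifPn => yB.
    rewrite [RHS]integral_mkcond; apply: eq_integral => x _.
    by rewrite patE /patch yB.
  by rewrite integral0_eq// => x _; rewrite patE /patch (negPf yB); case: ifP.
Qed.

Lemma measurable_integral1 d1 d2 (T1 : measurableType d1) (T2 : measurableType d2)
    (m2 : {sigma_finite_measure set T2 -> \bar R}) (B : set T2) (f : T1 * T2 -> \bar R) :
  measurable B -> measurable_fun setT f -> (forall z, 0 <= f z) ->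
  measurable_fun setT (fun x => \int[m2]_(y in B) f (x, y)).
Proof.
move=> mB mf f0.
have mTB : measurable ([set: T1] `*` B) by exact: measurableX.
have mfB : measurable_fun setT (f \_ ([set: T1] `*` B)).
  by apply/(measurable_restrictT _ _).1 => //; exact: measurable_funTS.
have fB0 z : 0 <= (f \_ ([set: T1] `*` B)) z by apply: erestrict_ge0.
rewrite (_ : (fun x => _) = fubini_F m2 (f \_ ([set: T1] `*` B))).
  exact: measurable_fun_fubini_tonelli_F.
apply/funext => x; rewrite /fubini_F [LHS]integral_mkcond; apply: eq_integral => y _.
rewrite /patch; case: (boolP (y \in B)) => yB; first by rewrite mem_set//; split => //; exact/set_mem.
by rewrite memNset// => -[_ /mem_set]; rewrite (negPf yB).
Qed.

Lemma integral_itv_shift (u : R -> R) (a b c : R) : (a <= b)%R -> continuous u ->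
  \int[mu]_(x in `[(a + c)%R, (b + c)%R]) (u x)%:E = \int[mu]_(x in `[a, b]) (u (x + c))%:E.
Proof.
move=> ab cu.
have D1 : derive1 (fun x : R => x + c)%R = cst 1%R.
  by apply/funext => x; rewrite derive1E derive_val addr0.
have Dx x : derivable (fun x : R => x + c)%R x 1 by [].
have ct : continuous (fun x : R => x + c)%R.
  by move=> x; apply: cvgD; [exact: cvg_id|exact: cvg_cst].
rewrite (@integration_by_substitution_increasing R (fun x => x + c)%R)//.
- by apply: eq_integral => x _; rewrite D1 !fctE /= mulr1.
- by move=> x y _ _; rewrite ltrD2r.
- by rewrite D1 => ? _; exact: cvg_cst.
- by rewrite D1; exact: is_cvg_cst.
- by rewrite D1; exact: is_cvg_cst.
- split => //.
  + by apply: cvg_at_right_filter; exact: ct.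
  + by apply: cvg_at_left_filter; exact: ct.
- exact: continuous_subspaceT.
Qed.

Lemma integral_itv_exp (u : R -> R) (a b : R) : (a <= b)%R -> continuous u ->
  \int[mu]_(x in `[a, b]) (u (expR x))%:E = \int[mu]_(r in `[expR a, expR b]) (u r / r)%:E.
Proof.
move=> ab cu.
have D1 : derive1 (@expR R) = expR.
  by apply/funext => x; rewrite derive1E derive_val.
rewrite (@integration_by_substitution_increasing R expR)//.
- apply: eq_integral => x _; rewrite D1 !fctE /= divfK//.
  by rewrite gt_eqF// expR_gt0.
- by move=> x y _ _; rewrite ltr_expR.
- by rewrite D1 => ? _; exact: continuous_expR.
- by rewrite D1; apply/cvg_ex; exists (expR a); apply: cvg_at_right_filter; exact: continuous_expR.
- by rewrite D1; apply/cvg_ex; exists (expR b); apply: cvg_at_left_filter; exact: continuous_expR.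
- split => //.
  + by apply: cvg_at_right_filter; exact: continuous_expR.
  + by apply: cvg_at_left_filter; exact: continuous_expR.
- apply: continuous_in_subspaceT => r; rewrite inE /= in_itv /= => /andP[r1 _].
  apply: cvgM; first exact: cu.
  by apply: cvgV; [rewrite gt_eqF// (lt_le_trans _ r1)// expR_gt0|exact: cvg_id].
Qed.

Lemma integral_itv_split (f : R -> \bar R) (a b c : R) : (a <= b)%R -> (b <= c)%R ->
  measurable_fun setT f -> (forall x, 0 <= f x) ->
  \int[mu]_(x in `[a, c]) f x = \int[mu]_(x in `[a, b]) f x + \int[mu]_(x in `[b, c]) f x.
Proof.
move=> ab bc mf f0.
rewrite -[X in _ = _ + X]integral_itv_obnd_cbnd; last exact: measurable_funTS.
rewrite -ge0_integral_setU//=; last 2 first.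
- exact: measurable_funTS.
- apply/disj_setPS => x [/=]; rewrite !in_itv /= => /andP[_ xb] /andP[bx _].
  by move: xb; rewrite leNgt bx.
by congr (integral _ _ _); rewrite -itv_bndbnd_setU// bnd_simp.
Qed.

(** For summing over concentric squares: pairs of opposite sides at distance [s] from the centre
    sweep the whole square as [s] runs over [0, d]. *)
Lemma integral_itv_fold (u : R -> R) (c d : R) : (0 <= d)%R -> continuous u ->
  (forall x, (0 <= u x)%R) ->
  \int[mu]_(s in `[0%R, d]) (u (c - s) + u (c + s))%:E = \int[mu]_(y in `[(c - d)%R, (c + d)%R]) (u y)%:E.
Proof.
move=> d0 cu u0.
have cuc : continuous (fun s => u (s + c)%R).
  move=> x; apply: (@continuous_comp _ _ _ (fun s => s + c)%R u); last exact: cu.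
  by apply: cvgD; [exact: cvg_id|exact: cvg_cst].
have cuN : continuous (fun s => u (c - s)%R).
  move=> x; apply: (@continuous_comp _ _ _ (fun s => c - s)%R u); last exact: cu.
  by apply: cvgB; [exact: cvg_cst|exact: cvg_id].
have mC v : continuous v -> measurable_fun setT (EFin \o v : measurableTypeR R -> \bar R).
  by move=> cv; apply/measurable_EFinP; exact: continuous_measurable_fun.
have H1 := @integral_itv_shift u (- d) d c ltac:(lra) cu.
rewrite [X in _ = \int[_]_(_ in X) _](_ : _ = `[(- d + c)%R, (d + c)%R]%classic); last first.
  by rewrite addrC (addrC c).
rewrite H1 (@integral_itv_split _ _ 0%R); [|lra|lra|exact: mC|by move=> x; rewrite lee_fin].
have -> : \int[mu]_(x in `[(- d)%R, 0%R]) (u (x + c))%:E = \int[mu]_(s in `[0%R, d]) (u (c - s))%:E.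
  have := @integration_by_substitution_oppr R (fun s => u (s + c)%R) 0 d d0.
  rewrite oppr0 => ->; first by apply: eq_integral => x _ /=; rewrite addrC.
  exact: continuous_subspaceT.
rewrite -ge0_integralD//; last 4 first.
- by move=> x _; rewrite lee_fin.
- by apply: measurable_funTS; exact: mC.
- by move=> x _; rewrite lee_fin.
- by apply: measurable_funTS; exact: mC.
by apply: eq_integral => x _; rewrite (addrC x c) EFinD.
Qed.

Lemma integral_periodic_shift (u : R -> R) (T v : R) : (0 < T)%R -> continuous u ->
  (forall x, (0 <= u x)%R) -> (forall x, u (x + T)%R = u x) ->
  \int[mu]_(x in `[0%R, T]) (u (x + v))%:E = \int[mu]_(x in `[0%R, T]) (u x)%:E.
Proof.
move=> T0 cu u0 uT.
have uTn (n : nat) x : u (x + n%:R * T)%R = u x.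
  elim: n => [|n IH]; first by rewrite mul0r addr0.
  by rewrite -addn1 natrD mulrDl mul1r addrA uT IH.
have uTz (k : int) x : u (x + k%:~R * T)%R = u x.
  case: k => n; first exact: uTn.
  by rewrite NegzE mulrNz mulNr -[LHS](uTn n.+1) subrK.
pose k := Num.floor (v / T); pose w := (v - k%:~R * T)%R.
have w0 : (0 <= w)%R by rewrite subr_ge0 -ler_pdivlMr// Num.Theory.floor_le.
have wT : (w <= T)%R.
  rewrite /w lerBlDr -[X in (_ <= X + _)%R]mul1r -mulrDl addrC -ler_pdivrMr//.
  by apply/ltW; have := Num.Theory.floorD1_gt (v / T); rewrite intrD.
have -> : \int[mu]_(x in `[0%R, T]) (u (x + v))%:E = \int[mu]_(x in `[0%R, T]) (u (x + w))%:E.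
  apply: eq_integral => x _; rewrite -[in RHS](uTz k); congr (EFin (u _)).
  by rewrite -addrA subrK.
have mu' : measurable_fun setT (EFin \o u : measurableTypeR R -> \bar R).
  by apply/measurable_EFinP; exact: continuous_measurable_fun.
have uE x : 0 <= (EFin \o u) x by rewrite /= lee_fin.
rewrite -(@integral_itv_shift u 0 T w)//; last exact: ltW.
rewrite add0r (@integral_itv_split (EFin \o u) w T)//; last by rewrite lerDl.
rewrite (_ : `[T, (T + w)%R]%classic = `[(0 + T)%R, (w + T)%R]%classic); last first.
  by rewrite add0r addrC.
rewrite (@integral_itv_shift u 0 w T)//.
rewrite (@integral_itv_split (EFin \o u) 0 w T)// addeC; congr (_ + _).
by apply: eq_integral => x _; rewrite uT.
Qed.

End measure_preliminaries.

Section lebesgue_square.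
Variable R : realType.
Local Notation mu := (@lebesgue_measure R).
Local Notation rT := (measurableTypeR R).

(* An alias of [mu \x mu] carrying its sigma-finite structure: on the product
   itself the structure declared by the library for subprobabilities is found
   first. *)
Definition lebesgue2 : set (rT * rT)%type -> \bar R := (mu \x mu)%E.

HB.instance Definition _ := Measure.copy lebesgue2 (mu \x mu)%E.

Let lebesgue2_sigma_finite : sigma_finite setT lebesgue2.
Proof.
have /sigma_finiteP[F [TF ndF Foo]] := sigma_finiteT mu.
exists (fun n => F n `*` F n).
  rewrite -setXTT TF predeqE => -[x y]; split.
    move=> [/= [n _ Fnx] [k _ Gky]]; exists (maxn n k) => //; split.
    - by move: x Fnx; exact/subsetPset/ndF/leq_maxl.
    - by move: y Gky; exact/subsetPset/ndF/leq_maxr.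
  by move=> [n _ []/= ? ?]; split; exists n.
move=> k; have [? ?] := Foo k.
split; first exact: measurableX.
by rewrite /lebesgue2 product_measure1E// lte_mul_pinfty// ge0_fin_numE.
Qed.

HB.instance Definition _ := Measure_isSigmaFinite.Build _ _ _ lebesgue2
  lebesgue2_sigma_finite.

Lemma integral_lebesgue2 (A B : set rT) (f : rT * rT -> \bar R) :
  measurable A -> measurable B -> measurable_fun setT f -> (forall z, (0 <= f z)%E) ->
  (\int[lebesgue2]_(z in A `*` B) f z = \int[mu]_(x in A) \int[mu]_(y in B) f (x, y))%E.
Proof. by move=> mA mB mf f0; case: (integral_rect mu mu mA mB mf f0). Qed.

End lebesgue_square.

(** * Sub-mean value inequalities *)

Section submean_square.
Variable R : realType.
Local Notation mu := (@lebesgue_measure R).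
Implicit Types (g : R[i] -> R[i]).

Lemma segment_integralE (a b : R) (u : R -> R) : continuous_on_segment a b u ->
  ((segment_integral a b u)%:E = \int[mu]_(x in `[a, b]) (u x)%:E)%E.
Proof.
move=> cu; rewrite /segment_integral /Rintegral fineK//.
by apply: integrable_fin_num => //; exact: continuous_on_segment_integrable.
Qed.

Lemma continuous_cabs_comp (T : topologicalType) g (u v : T -> R) : (forall z, ccontinuous g z) ->
  continuous u -> continuous v -> continuous (fun t => cabs (g (u t +i* v t))).
Proof.
move=> cg cu cv t.
by case: (@ccontinuous_comp R T (fun t => u t +i* v t) g t (cu t) (cv t) (cg _)).
Qed.

Lemma measurable_cabs_comp g (u v : R * R -> R) : (forall z, ccontinuous g z) ->
  continuous u -> continuous v ->
  measurable_fun setT ((fun t => cabs (g (u t +i* v t))) :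
    measurableTypeR R * measurableTypeR R -> measurableTypeR R).
Proof.
move=> cg cu cv; apply: continuous_measurable_prod.
exact: (@continuous_cabs_comp (R * R)%type).
Qed.

(** The boundary inequality is integrated over half-sides between d / 2 and d, each side being first
    lengthened to 2 d so that the domain is a product. The horizontal and the vertical sides sweep
    the square once each, whence the factor 2 on the right. *)
Lemma submean_square g (c1 c2 d : R) : cholomorphic g -> 0 < d ->
  ((d ^+ 2 * cabs (g (c1 +i* c2)))%:E <=
   2%:E * \int[mu \x mu]_(z in `[(c1 - d)%R, (c1 + d)%R] `*` `[(c2 - d)%R, (c2 + d)%R])
     (cabs (g (z.1 +i* z.2)))%:E)%E.
Proof.
move=> hg d0; have cg z := cholomorphic_ccontinuous z hg.
set a := cabs _; have a0 : 0 <= a by exact: cabs_ge0.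
have c1s : continuous (@fst R R) by move=> ?; exact: cvg_fst.
have c2s : continuous (@snd R R) by move=> ?; exact: cvg_snd.
have ccst (k : R) : continuous (fun _ : R * R => k) by move=> ?; exact: cvg_cst.
have cp (k : R) (f : R * R -> R) : continuous f -> continuous (fun z => k + f z).
  by move=> cf z; apply: cvgD; [exact: cvg_cst|exact: cf].
have cm (k : R) (f : R * R -> R) : continuous f -> continuous (fun z => k - f z).
  by move=> cf z; apply: cvgB; [exact: cvg_cst|exact: cf].
have cx y : continuous (fun x => cabs (g (x +i* y))).
  by apply: (@continuous_cabs_comp R) => // x; [exact: cvg_id|exact: cvg_cst].
have cy x : continuous (fun y => cabs (g (x +i* y))).
  by apply: (@continuous_cabs_comp R) => // y; [exact: cvg_cst|exact: cvg_id].
pose X := `[c1 - d, c1 + d]%classic; pose Y := `[c2 - d, c2 + d]%classic.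
pose S := `[0, d]%classic.
pose FA (z : measurableTypeR R * measurableTypeR R) : \bar R := (cabs (g (z.2 +i* (c2 - z.1))) + cabs (g (z.2 +i* (c2 + z.1))))%:E.
pose FB (z : measurableTypeR R * measurableTypeR R) : \bar R := (cabs (g ((c1 - z.1) +i* z.2)) + cabs (g ((c1 + z.1) +i* z.2)))%:E.
have mFA : measurable_fun setT FA.
  apply/measurable_EFinP; apply: measurable_funD; apply: measurable_cabs_comp => //.
  - exact: cm.
  - exact: cp.
have mFB : measurable_fun setT FB.
  apply/measurable_EFinP; apply: measurable_funD; apply: measurable_cabs_comp => //.
  - exact: cm.
  - exact: cp.
have FA0 z : (0 <= FA z)%E by rewrite lee_fin addr_ge0 ?cabs_ge0.
have FB0 z : (0 <= FB z)%E by rewrite lee_fin addr_ge0 ?cabs_ge0.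
pose U (z : measurableTypeR R * measurableTypeR R) : \bar R := (cabs (g (z.1 +i* z.2)))%:E.
have mU : measurable_fun setT U.
  by apply/measurable_EFinP; exact: measurable_cabs_comp.
have U0 z : (0 <= U z)%E by rewrite lee_fin cabs_ge0.
have mX : measurable (X : set (measurableTypeR R)) by exact: measurable_itv.
have mY : measurable (Y : set (measurableTypeR R)) by exact: measurable_itv.
have mS : measurable (S : set (measurableTypeR R)) by exact: measurable_itv.
pose IA s := (\int[mu]_(x in X) FA (s, x))%E.
pose IB s := (\int[mu]_(y in Y) FB (s, y))%E.
have IA0 s : (0 <= IA s)%E by exact: integral_ge0.
have IB0 s : (0 <= IB s)%E by exact: integral_ge0.
have mIA : measurable_fun setT IA by exact: measurable_integral1.
have mIB : measurable_fun setT IB by exact: measurable_integral1.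
have EA : (\int[mu]_(s in S) IA s = \int[mu \x mu]_(z in X `*` Y) U z)%E.
  have [<- ->] := integral_rect mu mu mS mX mFA FA0.
  have [-> _] := integral_rect mu mu mX mY mU U0.
  apply: eq_integral => x _; rewrite /FA /U /=.
  apply: (@integral_itv_fold R (fun y => cabs (g (x +i* y)))) => //; first exact: ltW.
  by move=> y; exact: cabs_ge0.
have EB : (\int[mu]_(s in S) IB s = \int[mu \x mu]_(z in X `*` Y) U z)%E.
  have [<- ->] := integral_rect mu mu mS mY mFB FB0.
  have [_ ->] := integral_rect mu mu mX mY mU U0.
  apply: eq_integral => y _; rewrite /FB /U /=.
  apply: (@integral_itv_fold R (fun x => cabs (g (x +i* y)))) => //; first exact: ltW.
  by move=> x; exact: cabs_ge0.
have pt s : d / 2 <= s <= d -> ((2 * d * a)%:E <= IA s + IB s)%E.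
  move=> /andP[s1 s2]; have s0 : 0 < s by apply: lt_le_trans s1; rewrite divr_gt0.
  have := cabs_le_square_boundary s0 cg (fun z _ => hg z).
  move=> /(_ c1 c2); rewrite -/a -lee_fin => H.
  apply: (@le_trans _ _ (4 * s * a)%:E).
    by rewrite lee_fin ler_wpM2r//; lra.
  apply: le_trans H _; rewrite /square_boundary_integral EFinD.
  rewrite !segment_integralE; last 2 first.
  - by apply: continuous_on_segmentD => x _; [exact: cy|exact: cy].
  - by apply: continuous_on_segmentD => x _; [exact: cx|exact: cx].
  apply: leeD.
    apply: ge0_subset_integral => //=.
    - by apply: measurable_funTS; exact: (measurableT_comp mFA (pair1_measurable s)).
    - by move=> x _; exact: (FA0 (s, x)).
    - by move=> x; rewrite /X /Y /S /= !in_itv /= => ?; lra.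
  apply: ge0_subset_integral => //=.
  - by apply: measurable_funTS; exact: (measurableT_comp mFB (pair1_measurable s)).
  - by move=> x _; exact: (FB0 (s, x)).
  - by move=> x; rewrite /X /Y /S /= !in_itv /= => ?; lra.
pose IAB s := (IA s + IB s)%E.
have mIAB : measurable_fun setT IAB by exact: emeasurable_funD.
have IAB0 s : (0 <= IAB s)%E by exact: adde_ge0.
apply: (@le_trans _ _ (\int[mu]_(s in `[(d / 2)%R, d]) (2 * d * a)%:E)%E).
  rewrite integral_cst//= lebesgue_measure_itv /= lte_fin.
  rewrite ifT; last by lra.
  rewrite -EFinB -EFinM lee_fin.
  by suff -> : d ^+ 2 * a = 2 * d * a * (d - d / 2) by []; field.
apply: (@le_trans _ _ (\int[mu]_(s in `[(d / 2)%R, d]) IAB s)%E).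
  apply: ge0_le_integral => //.
  - by move=> s _; rewrite lee_fin !mulr_ge0// ltW.
  - exact: measurable_funTS.
apply: (@le_trans _ _ (\int[mu]_(s in S) IAB s)%E).
  apply: ge0_subset_integral => //=.
  - exact: measurable_funTS.
  - by move=> x; rewrite /X /Y /S /= !in_itv /= => ?; lra.
rewrite ge0_integralD//; [|exact: measurable_funTS|exact: measurable_funTS].
by rewrite EA EB [2%:E](_ : _ = 1 + 1)%E ?ge0_muleDl ?mul1e.
Qed.

End submean_square.

Section submean_power.
Context {R : realType} {disp : measure_display} {T : measurableType disp}.
Variables (m : {measure set T -> \bar R}) (B : T -> R -> set T) (D : nat).
Implicit Types (phi : T -> R) (w : T) (C c k r M : R).

Hypothesis measurable_B : forall w r, measurable (B w r).
Hypothesis mem_B : forall w r, 0 < r -> B w r w.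
Hypothesis nested_B : forall w w' r, 0 < r -> B w (r / 2) w' -> B w' (r / 2) `<=` B w r.

(** Abstract balls [B] and dimension [D], because this is used for boxes of the plane ([D = 2]) and
    for intervals ([D = 1]). Only balls inside a given one are concerned, as the radial means
    satisfy their inequality away from the origin only. *)
Definition submean_on phi C w0 r0 := forall w r, 0 < r -> r <= r0 -> B w r `<=` B w0 r0 ->
  ((r ^+ D * phi w)%:E <= C%:E * \int[m]_(z in B w r) (phi z)%:E)%E.

Let measurable_fun_powR phi k : measurable_fun setT phi ->
  measurable_fun setT (fun z => (phi z `^ k)%:E).
Proof. by move=> mphi; apply/measurable_EFinP; exact: (measurableT_comp (@measurable_powR R k)). Qed.

(* Fefferman-Stein: with A the supremum of r^(D/k) phi(w) over the admissible
   balls, phi <= phi^k (A r^(-D/k))^(1-k) reduces the claim to A <= K A^(1-k) I. *)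
Lemma submean_pow_lt1 C k : 0 < C -> 0 < k -> k < 1 -> exists2 K, 0 < K &
  forall phi w0 r0 M, 0 < r0 -> measurable_fun setT phi -> (forall z, 0 <= phi z) ->
    (forall z, B w0 r0 z -> phi z <= M) -> submean_on phi C w0 r0 ->
    ((r0 ^+ D * phi w0 `^ k)%:E <= K%:E * \int[m]_(z in B w0 r0) (phi z `^ k)%:E)%E.
Proof.
move=> C0 k0 k1; pose E : R := D%:R / k.
have k10 : 0 < 1 - k by rewrite subr_gt0.
have powE (x : R) : 0 < x -> (x `^ E) `^ k = x ^+ D.
  by move=> x0; rewrite -powRrM /E divfK ?gt_eqF// powR_mulrn// ltW.
exists (2 `^ E * C); first by rewrite mulr_gt0// powR_gt0.
move=> phi w0 r0 M r00 mphi phi0 phiM sub.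
set I := (\int[m]_(z in B w0 r0) (phi z `^ k)%:E)%E.
have I0 : (0 <= I)%E by apply: integral_ge0 => z _; rewrite lee_fin powR_ge0.
have [->|Ify] := eqVneq I +oo%E.
  by rewrite gt0_muley ?leey// lte_fin mulr_gt0// powR_gt0.
have {Ify} IE : I = (fine I)%:E by rewrite fineK// ge0_fin_numE// lt_neqAle Ify leey.
set i := fine I in IE; have i0 : 0 <= i by rewrite -lee_fin -IE.
rewrite IE.
pose adm w r := [/\ 0 < r, r <= r0 & B w r `<=` B w0 r0].
pose S := [set x : R | exists w r, adm w r /\ x = r `^ E * phi w].
have adm0 : adm w0 r0 by split.
have E0 : 0 <= E by rewrite divr_ge0// ltW.
have S0 : S !=set0 by exists (r0 `^ E * phi w0), w0, r0.
(* The bound [M] enters here: [A] has to be finite for [A ^ (1 - k)] to be cancelled at the end. *)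
have Sub : has_ubound S.
  exists (r0 `^ E * M) => _ [w [r [[r0' rr0 Brr0] ->]]].
  apply: ler_pM; rewrite ?powR_ge0//; last by apply: phiM; apply: Brr0; exact: mem_B.
  by apply: ge0_ler_powR => //; rewrite nnegrE ltW.
pose A := sup S.
have SA w r : adm w r -> r `^ E * phi w <= A by move=> wr; apply: ub_le_sup => //; exists w, r.
have A0 : 0 <= A by apply: le_trans (SA _ _ adm0); rewrite mulr_ge0 ?powR_ge0.
have key w r : adm w r -> r `^ E * phi w <= 2 `^ E * C * (A `^ (1 - k) * i).
  (* With half the radius, the ball of radius [h] around each point of [B w h] is still admissible,
     so [A] controls [phi] on all of [B w h]. The price is the factor 2^E. *)
  move=> [rp rr0 Brr0]; pose h := r / 2.
  have h0 : 0 < h by rewrite divr_gt0.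
  have BhB : B w h `<=` B w r by apply: nested_B => //; apply: mem_B.
  have Bh0 : B w h `<=` B w0 r0 by exact: subset_trans Brr0.
  pose t := h `^ E; have t0 : 0 < t by rewrite powR_gt0.
  pose P := (A / t) `^ (1 - k); have P0 : 0 <= P by exact: powR_ge0.
  have pt z : B w h z -> phi z <= P * phi z `^ k.
    move=> wz; have [->|pz] := eqVneq (phi z) 0; first by rewrite mulr_ge0// powR_ge0.
    have pz0 : 0 < phi z by rewrite lt_neqAle eq_sym pz phi0.
    rewrite -[leLHS](@powRr1 _ (phi z)) ?phi0// -[X in _ `^ X](subrK k) powRD; last by rewrite pz implybT.
    rewrite ler_wpM2r ?powR_ge0//; apply: ge0_ler_powR.
    - exact: ltW.
    - by rewrite nnegrE.
    - by rewrite nnegrE divr_ge0// ltW.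
    rewrite ler_pdivlMr// mulrC; apply: SA; split => //.
      by apply: le_trans rr0; rewrite /h ler_pdivrMr// ler_peMr ?ltW// ltr1n.
    by apply: subset_trans Brr0; exact: nested_B.
  have : ((h ^+ D * phi w)%:E <= (C * (P * i))%:E)%E.
    apply: le_trans (sub _ _ h0 _ Bh0) _.
      by apply: le_trans rr0; rewrite /h ler_pdivrMr// ler_peMr ?ltW// ltr1n.
    have EI : (P%:E * I = \int[m]_(z in B w0 r0) (P%:E * (phi z `^ k)%:E))%E.
      apply/esym/ge0_integralZl_EFin => //.
      - by move=> z _; rewrite lee_fin powR_ge0.
      - by apply: measurable_funTS; exact: measurable_fun_powR.
    rewrite EFinM lee_pmul2l ?lte_fin// EFinM -IE EI.
    apply: (@le_trans _ _ (\int[m]_(z in B w h) (P%:E * (phi z `^ k)%:E))%E).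
      apply: ge0_le_integral => //.
      - by move=> z _; rewrite lee_fin.
      - by apply/measurable_EFinP; exact: measurable_funTS.
      - apply: measurable_funTS; apply: measurable_funeM; exact: measurable_fun_powR.
    apply: ge0_subset_integral => //.
    - apply: measurable_funTS; apply: measurable_funeM; exact: measurable_fun_powR.
    - by move=> z _; rewrite -EFinM lee_fin mulr_ge0// powR_ge0.
  rewrite lee_fin -(powE h h0) -/t => H.
  have -> : r `^ E = 2 `^ E * t.
    by rewrite /t -powRM ?ltW// /h mulrC divfK.
  rewrite -!mulrA ler_pM2l ?powR_gt0//.
  have -> : C * (A `^ (1 - k) * i) = t `^ (1 - k) * (C * (P * i)).
    have -> : A `^ (1 - k) = t `^ (1 - k) * P.
      by rewrite /P -powRM ?divr_ge0 ?(ltW t0)// mulrC divfK ?gt_eqF.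
    ring.
  have -> : t * phi w = t `^ (1 - k) * (t `^ k * phi w).
    by rewrite mulrA -powRD ?subrK ?powRr1 ?(ltW t0)// gt_eqF ?implybT.
  by rewrite ler_pM2l// powR_gt0.
have AK : A <= 2 `^ E * C * (A `^ (1 - k) * i).
  by apply: ge_sup => // _ [w [r [wr ->]]]; exact: key.
rewrite -EFinM lee_fin -(powE _ r00) -powRM ?powR_ge0//.
have [Az|Anz] := eqVneq A 0.
  have -> : r0 `^ E * phi w0 = 0.
    by apply/eqP; rewrite eq_le mulr_ge0 ?powR_ge0// andbT -[leRHS]Az; exact: SA.
  by rewrite powR0 ?gt_eqF// !mulr_ge0 ?powR_ge0// ltW.
have Ap : 0 < A by rewrite lt_neqAle eq_sym Anz.
apply: (@le_trans _ _ (A `^ k)).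
  apply: ge0_ler_powR; rewrite ?nnegrE ?(ltW k0)// ?mulr_ge0 ?powR_ge0//; exact: SA.
rewrite -(@ler_pM2l _ (A `^ (1 - k))) ?powR_gt0// -powRD; last by rewrite Anz implybT.
by rewrite subrK powRr1// mulrCA.
Qed.

(** In place of Jensen's inequality: phi <= l + l^(1-k) phi^k, with the level [l] proportional to
    phi(w0) and chosen so that the constant term absorbs exactly half of the left-hand side. *)
Lemma submean_pow_ge1 C c k : 0 < C -> 0 < c -> 1 <= k ->
  (forall w r, 0 < r -> (m (B w r) <= (c * r ^+ D)%:E)%E) -> exists2 K, 0 < K &
  forall phi w0 r0, 0 < r0 -> measurable_fun setT phi -> (forall z, 0 <= phi z) ->
    submean_on phi C w0 r0 ->
    ((r0 ^+ D * phi w0 `^ k)%:E <= K%:E * \int[m]_(z in B w0 r0) (phi z `^ k)%:E)%E.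
Proof.
move=> C0 c0 k1 mB.
have Cc0 : 0 < 2 * C * c by rewrite !mulr_gt0.
exists (2 * C * (2 * C * c) `^ (k - 1)); first by rewrite !mulr_gt0// powR_gt0.
move=> phi w0 r0 r00 mphi phi0 sub.
set I := (\int[m]_(z in B w0 r0) (phi z `^ k)%:E)%E.
have I0 : (0 <= I)%E by apply: integral_ge0 => z _; rewrite lee_fin powR_ge0.
have [->|Ify] := eqVneq I +oo%E.
  by rewrite gt0_muley ?leey// lte_fin !mulr_gt0// powR_gt0.
have {Ify} IE : I = (fine I)%:E by rewrite fineK// ge0_fin_numE// lt_neqAle Ify leey.
set i := fine I in IE; have i0 : 0 <= i by rewrite -lee_fin -IE.
have k0 : 0 < k by exact: lt_le_trans k1.
rewrite IE -EFinM lee_fin.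
have [->|pz] := eqVneq (phi w0) 0.
  by rewrite powR0 ?gt_eqF// mulr0 !mulr_ge0 ?powR_ge0// ltW.
have pz0 : 0 < phi w0 by rewrite lt_neqAle eq_sym pz phi0.
pose l := phi w0 / (2 * C * c).
have l0 : 0 < l by rewrite divr_gt0.
have pt z : phi z <= l + l `^ (1 - k) * phi z `^ k.
  have [zl|lz] := leP (phi z) l; first by rewrite -[leLHS]addr0 lerD// mulr_ge0// powR_ge0.
  rewrite -[leLHS]add0r lerD ?(ltW l0)//.
  have z0 : 0 < phi z by exact: lt_trans lz.
  rewrite -[leLHS](@powRr1 _ (phi z)) ?phi0// -[X in _ `^ X](subrK k) powRD; last by rewrite (gt_eqF z0) implybT.
  rewrite ler_wpM2r ?powR_ge0//.
  rewrite -opprB !powRN lef_pV2 ?posrE ?powR_gt0//.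
  by apply: ge0_ler_powR; rewrite ?nnegrE ?subr_ge0// ltW.
have mk : measurable_fun setT (fun z => (phi z `^ k)%:E) by exact: measurable_fun_powR.
have H := sub w0 r0 r00 (lexx _) (@subset_refl _ _).
have : ((r0 ^+ D * phi w0)%:E <= (C * (l * (c * r0 ^+ D) + l `^ (1 - k) * i))%:E)%E.
  apply: le_trans H _; rewrite EFinM lee_pmul2l ?lte_fin//.
  apply: (@le_trans _ _ (\int[m]_(z in B w0 r0) (l%:E + (l `^ (1 - k))%:E * (phi z `^ k)%:E))%E).
    apply: ge0_le_integral => //.
    - by move=> z _; rewrite lee_fin.
    - by apply/measurable_EFinP; exact: measurable_funTS.
    - apply: emeasurable_funD => //.
      by apply: measurable_funTS; apply: measurable_funeM.
    - by move=> z _; rewrite -EFinM -EFinD lee_fin; exact: pt.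
  rewrite ge0_integralD//; last 3 first.
  - by move=> z _; rewrite lee_fin ltW.
  - by move=> z _; rewrite -EFinM lee_fin mulr_ge0// powR_ge0.
  - by apply: measurable_funTS; apply: measurable_funeM.
  have EI : (\int[m]_(z in B w0 r0) ((l `^ (1 - k))%:E * (phi z `^ k)%:E) = (l `^ (1 - k))%:E * I)%E.
    apply: ge0_integralZl_EFin => //.
    - by move=> z _; rewrite lee_fin powR_ge0.
    - exact: measurable_funTS.
    - exact: powR_ge0.
  rewrite integral_cst// EI IE EFinD; apply: leeD; last by rewrite (EFinM (l `^ _)).
  rewrite (EFinM l); apply: lee_wpmul2l; [by rewrite lee_fin ltW|exact: mB].
rewrite lee_fin => {}H.
have e1 : C * (l * (c * r0 ^+ D)) = r0 ^+ D * phi w0 / 2.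
  by rewrite /l; field; rewrite !gt_eqF.
have {}H : r0 ^+ D * phi w0 <= 2 * C * (l `^ (1 - k) * i).
  by move: H; rewrite mulrDr e1 => H; lra.
have -> : phi w0 `^ k = phi w0 * phi w0 `^ (k - 1).
  by rewrite -[X in X * _](@powRr1 _ (phi w0)) ?phi0// -powRD ?pz ?implybT// addrC subrK.
have -> : (2 * C * c) `^ (k - 1) = l `^ (1 - k) * phi w0 `^ (k - 1).
  have -> : phi w0 = (2 * C * c) * l by rewrite /l mulrC divfK// gt_eqF.
  rewrite (powRM _ (ltW Cc0) (ltW l0)) mulrCA -powRD; last by rewrite (gt_eqF l0) implybT.
  by rewrite addrA subrK subrr powRr0 mulr1.
rewrite mulrA.
apply: (@le_trans _ _ (2 * C * (l `^ (1 - k) * i) * phi w0 `^ (k - 1))).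
  by rewrite ler_wpM2r// powR_ge0.
rewrite le_eqVlt; apply/orP; left; apply/eqP; ring.
Qed.

End submean_power.

(** * Sub-mean value inequalities in polar coordinates *)

Section polar_submean.
Variable R : realType.
Local Notation mu := (@lebesgue_measure R).
Implicit Types (f : R[i] -> R[i]).

Lemma polarM (r r' t t' : R) : polar (r * r') (t + t') = polar r t * polar r' t'.
Proof.
apply/eqP; rewrite eq_complex /= cosD sinD.
by apply/andP; split; apply/eqP; ring.
Qed.

Lemma cabs_polar (r t : R) : cabs (polar r t) = `|r|.
Proof.
by rewrite cabsE /= !exprMn -mulrDr cos2Dsin2 mulr1 sqrtr_sqr.
Qed.

(** The complex exponential: rectangles of the w-plane become polar boxes, and composition with it
    preserves holomorphy. *)
Definition cexp (w : R[i]) : R[i] := polar (expR (complex.Re w)) (complex.Im w).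

Lemma cexpD (w h : R[i]) : cexp (w + h) = cexp w * cexp h.
Proof. by rewrite /cexp complex_ReD complex_ImD expRD polarM. Qed.

Lemma is_derive_realP (u : R -> R) (t m : R) : is_derive t (1 : R) u m ->
  forall e, 0 < e -> exists2 d, 0 < d & forall h, `|h| < d ->
     `|u (t + h) - u t - m * h| <= e * `|h|.
Proof.
move=> [du um] e e0.
have : h^-1 *: ((u \o shift t) (h *: (1 : R)) - u t) @[h --> 0^'] --> m by rewrite -um.
move/cvgrPdist_le => /(_ e e0); rewrite near_withinE => /nbhs_ballP [d /= d0 H].
exists d => // h hd; have [->|h0] := eqVneq h 0.
  by rewrite addr0 subrr mulr0 subrr normr0 mulr0.
have := H h; rewrite /ball /= sub0r normrN => /(_ hd h0).
rewrite /GRing.scale /= => {}H.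
have -> : u (t + h) - u t - m * h = - (h * (m - h^-1 * (u (h * 1 + t) - u t))).
  by rewrite mulr1 (addrC h t) mulrBr mulVKf// opprB (mulrC m).
by rewrite normrN normrM mulrC ler_wpM2r.
Qed.

Lemma has_cderiv_cexp (w : R[i]) : has_cderiv cexp w (cexp w).
Proof.
suff H0 : forall e : R, 0 < e -> exists2 d : R, 0 < d &
    forall h, cabs h < d -> cabs (cexp h - 1 - h) <= e * cabs h.
  move=> e e0; have k0 : 0 < cabs (cexp w) + 1 by rewrite ltr_wpDl// cabs_ge0.
  have [d d0 H] := H0 (e / (cabs (cexp w) + 1)) (divr_gt0 e0 k0).
  exists d => // h hd; rewrite cexpD.
  have -> : cexp w * cexp h - cexp w - cexp w * h = cexp w * (cexp h - 1 - h) by ring.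
  rewrite cabsM; apply: (@le_trans _ _ ((cabs (cexp w) + 1) * (e / (cabs (cexp w) + 1) * cabs h))).
    by apply: ler_pM; rewrite ?cabs_ge0 ?lerDl//; exact: H.
  by rewrite mulrA mulrCA divff ?gt_eqF// mulr1.
(* Budget: two terms 3 e / 14, coming from expR a <= 3, and one e / 14 make e / 2; the cross term
   |b| * 2 |a| uses the other half through |h| < e / 4. *)
move=> e e0; have e1 : 0 < e / 14 by rewrite divr_gt0.
have [d1 d10 H1] := is_derive_realP (is_derive_expR (0 : R)) e1.
have [d4 d40 H4] := is_derive_realP (is_derive_expR (0 : R)) ltr01.
have [d2 d20 H2] := is_derive_realP (is_derive_cos (0 : R)) e1.
have [d3 d30 H3] := is_derive_realP (is_derive_sin (0 : R)) e1.
exists (Num.min (Num.min d1 d2) (Num.min (Num.min d3 d4) (Num.min 1 (e / 4)))).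
  by rewrite !lt_min d10 d20 d30 d40 ltr01 divr_gt0.
move=> h; rewrite !lt_min => /andP[/andP[hd1 hd2] /andP[/andP[hd3 hd4] /andP[h1 he]]].
have hR := ler_Re_cabs h; have hI := ler_Im_cabs h.
have {}H1 := H1 _ (le_lt_trans hR hd1).
have {}H2 := H2 _ (le_lt_trans hI hd2).
have {}H3 := H3 _ (le_lt_trans hI hd3).
have {}H4 := H4 _ (le_lt_trans hR hd4).
rewrite !add0r ?expR0 ?cos0 ?sin0 ?oppr0 ?mul0r ?mul1r ?subr0 ?addr0 in H1 H2 H3 H4.
set a := complex.Re h in hR H1 H4 *; set b := complex.Im h in hI H2 H3 *.
have E0 := expR_ge0 a.
have E3 : expR a <= 3.
  have : `|a| <= 1 by lra.
  by move: H4; rewrite !ler_norml => /andP[? ?] /andP[? ?]; have := ler_norm a; have := ler_norm (- a); rewrite normrN; lra.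
have Em : `|expR a - 1| <= 2 * `|a|.
  have -> : expR a - 1 = (expR a - 1 - a) + a by ring.
  apply: le_trans (ler_normD _ _) _; lra.
have Re1 : complex.Re (cexp h - 1 - h) = expR a * (cos b - 1) + (expR a - 1 - a).
  by rewrite !complex_ReB /= -/a -/b; ring.
have Im1 : complex.Im (cexp h - 1 - h) = expR a * (sin b - b) + b * (expR a - 1).
  by rewrite !complex_ImB /= -/a -/b; ring.
apply: le_trans (cabs_le_ReIm _) _; rewrite Re1 Im1.
have B1 : `|expR a * (cos b - 1)| <= 3 * (e / 14 * `|b|).
  by rewrite normrM (ger0_norm E0); apply: ler_pM.
have B2 : `|expR a * (sin b - b)| <= 3 * (e / 14 * `|b|).
  by rewrite normrM (ger0_norm E0); apply: ler_pM.
have B3 : `|b * (expR a - 1)| <= `|b| * (2 * `|a|).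
  by rewrite normrM; apply: ler_pM.
have B4 : `|b| * (2 * `|a|) <= cabs h * (2 * (e / 4)).
  by apply: ler_pM; rewrite ?mulr_ge0//; lra.
have := ler_normD (expR a * (cos b - 1)) (expR a - 1 - a).
have := ler_normD (expR a * (sin b - b)) (b * (expR a - 1)).
have : e / 14 * `|b| <= e / 14 * cabs h by rewrite ler_pM2l.
have : e / 14 * `|a| <= e / 14 * cabs h by rewrite ler_pM2l.
lra.
Qed.

Lemma cholomorphic_cexp f : cholomorphic f -> cholomorphic (fun w => f (cexp w)).
Proof.
move=> hf w; have [l fl] := hf (cexp w); exists (l * cexp w).
exact: has_cderiv_comp (has_cderiv_cexp w) fl.
Qed.

Definition rect_ball (w : measurableTypeR R * measurableTypeR R) (r : R) :
    set (measurableTypeR R * measurableTypeR R) :=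
  `[w.1 - r, w.1 + r]%classic `*` `[w.2 - r, w.2 + r]%classic.

Lemma measurable_rect_ball w r : measurable (rect_ball w r).
Proof. by apply: measurableX; exact: measurable_itv. Qed.

Lemma mem_rect_ball w r : 0 < r -> rect_ball w r w.
Proof. by move=> r0; split; rewrite /= in_itv /=; lra. Qed.

Lemma nested_rect_ball w w' r : 0 < r -> rect_ball w (r / 2) w' ->
  rect_ball w' (r / 2) `<=` rect_ball w r.
Proof.
move=> r0 [/= H1 H2] z [/= H3 H4]; rewrite !in_itv /= in H1 H2 H3 H4.
by split; rewrite /= in_itv /=; lra.
Qed.

Lemma continuous_ge0_powR (T : topologicalType) (u : T -> R) (k : R) : 0 < k ->
  (forall t, 0 <= u t) -> continuous u -> continuous (fun t => u t `^ k).
Proof.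
move=> k0 u0 cu t.
have [ut|ut] := eqVneq (u t) 0.
  apply/cvgrPdist_lt => e e0 /=; rewrite ut powR0 ?gt_eqF//.
  have d0 : 0 < e `^ k^-1 by rewrite powR_gt0.
  have /cvgrPdist_lt /(_ _ d0) H := cu t; rewrite ut in H.
  near=> s; rewrite sub0r normrN ger0_norm ?powR_ge0//.
  have : `|0 - u s| < e `^ k^-1 by near: s; exact: H.
  rewrite sub0r normrN ger0_norm// => us.
  have := gt0_ltr_powR k0 _ _ us; rewrite -powRrM mulVf ?gt_eqF// powRr1 ?(ltW e0)//.
  by apply; rewrite nnegrE // ltW.
have ut0 : 0 < u t by rewrite lt_neqAle eq_sym ut u0.
apply: (@continuous_comp _ _ _ u (fun x => x `^ k)); first exact: cu.
apply/differentiable_continuous/derivable1_diffP/derivable_powR.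
by rewrite in_itv /= ut0.
Unshelve. all: by end_near. Qed.

Lemma continuous_polar (T : topologicalType) (u v : T -> R) :
  continuous u -> continuous v ->
  continuous (fun t => complex.Re (polar (u t) (v t))) /\
  continuous (fun t => complex.Im (polar (u t) (v t))).
Proof.
move=> cu cv; split=> t /=; apply: cvgM; try exact: cu.
  by apply: (@continuous_comp _ _ _ v cos); [exact: cv|exact: continuous_cos].
by apply: (@continuous_comp _ _ _ v sin); [exact: cv|exact: continuous_sin].
Qed.

Lemma continuous_cabs_polar (T : topologicalType) f (u v : T -> R) :
  (forall z, ccontinuous f z) -> continuous u -> continuous v ->
  continuous (fun t => cabs (f (polar (u t) (v t)))).
Proof.
move=> cf cu cv t; have [cR cI] := continuous_polar cu cv.
by case: (@ccontinuous_comp R T (fun t => polar (u t) (v t)) f t (cR t) (cI t) (cf _)).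
Qed.

Lemma continuous_cabs_polar_powR (T : topologicalType) f (u v : T -> R) (k : R) : 0 < k ->
  (forall z, ccontinuous f z) -> continuous u -> continuous v ->
  continuous (fun t => cabs (f (polar (u t) (v t))) `^ k).
Proof.
move=> k0 cf cu cv; apply: continuous_ge0_powR => // [t|]; first exact: cabs_ge0.
exact: continuous_cabs_polar.
Qed.

(** [submean_square] for f composed with [cexp], raised to the power [k] by one of the two lemmas on
    powers. For k < 1 the local bound is the maximum of |f| on the disc of radius exp(x + d). *)
Lemma log_submean (k : R) : 0 < k -> exists2 K, 0 < K &
  forall f x y d, cholomorphic f -> 0 < d ->
  ((d ^+ 2 * cabs (f (polar (expR x) y)) `^ k)%:E <=
   K%:E * \int[mu \x mu]_(z in rect_ball (x, y) d)
     (cabs (f (polar (expR z.1) z.2)) `^ k)%:E)%E.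
Proof.
move=> k0.
pose phi f (z : measurableTypeR R * measurableTypeR R) : R := cabs (f (cexp (z.1 +i* z.2))).
have mphi f : cholomorphic f -> measurable_fun setT (phi f).
  move=> hf; apply: (@measurable_cabs_comp R (fun w => f (cexp w)) fst snd).
  - by move=> z; exact: cholomorphic_ccontinuous (cholomorphic_cexp hf).
  - by move=> ?; exact: cvg_fst.
  - by move=> ?; exact: cvg_snd.
have phi0 f z : 0 <= phi f z by exact: cabs_ge0.
have sub f w0 r0 : cholomorphic f -> submean_on (mu \x mu)%E rect_ball 2 (phi f) 2 w0 r0.
  move=> hf [x y] r rp _ _; exact: submean_square (cholomorphic_cexp hf) rp.
have [k1|k1] := ltP k 1.
  have [K K0 HK] := @submean_pow_lt1 R _ _ (mu \x mu)%E rect_ball 2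
    measurable_rect_ball mem_rect_ball nested_rect_ball 2 k (ltr0Sn R 1) k0 k1.
  exists K => // f x y d hf d0.
  have [M M0 fM] := ccontinuous_bounded (expR (x + d)) (fun z => cholomorphic_ccontinuous z hf).
  apply: (HK (phi f) (x, y) d M d0 (mphi f hf) (phi0 f)); last exact: sub.
  move=> z [/= z1 _]; apply: fM; rewrite cabs_polar ger0_norm ?expR_ge0// ler_expR.
  by move: z1; rewrite in_itv /= => /andP[].
have mB w r : 0 < r -> ((mu \x mu)%E (rect_ball w r) <= (4 * r ^+ 2)%:E)%E.
  move=> r0; rewrite /rect_ball product_measure1E; [|exact: measurable_itv|exact: measurable_itv].
  rewrite /= !lebesgue_measure_itv /= !lte_fin !ifT; [|lra|lra].
  by rewrite -!EFinB -EFinM lee_fin; lra.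
have [K K0 HK] := @submean_pow_ge1 R _ _ (mu \x mu)%E rect_ball 2
    measurable_rect_ball 2 4 k (ltr0Sn R 1) (ltr0Sn R 3) k1 mB.
exists K => // f x y d hf d0.
apply: (HK (phi f) (x, y) d d0 (mphi f hf) (phi0 f)); exact: sub.
Qed.

End polar_submean.

Section polar_submean_ineq.
Variable R : realType.
Local Notation mu := (@lebesgue_measure R).
Implicit Types (f : R[i] -> R[i]).

Lemma measurable_cabs_polar_powR f (k : R) : 0 < k -> (forall z, ccontinuous f z) ->
  measurable_fun setT ((fun p => (cabs (f (polar p.1 p.2)) `^ k)%:E) :
    measurableTypeR R * measurableTypeR R -> \bar R).
Proof.
move=> k0 cf; apply/measurable_EFinP; apply: continuous_measurable_prod.
apply: (@continuous_cabs_polar_powR R (R * R)%type) => // ?; [exact: cvg_fst|exact: cvg_snd].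
Qed.

(** [log_submean] transported by r = exp(x), whose density 1/r is at most 2/s on the box. The
    condition d <= s / 2 keeps the box away from the origin, where logarithmic coordinates
    degenerate. *)
Lemma polar_submean (k : R) : 0 < k -> exists2 K, 0 < K &
  forall f s t d, cholomorphic f -> 0 < d -> d <= s / 2 ->
  ((d ^+ 2 * cabs (f (polar s t)) `^ k)%:E <=
   (K * s)%:E * \int[mu \x mu]_(z in `[(s - d)%R, (s + d)%R] `*` `[(t - d / s)%R, (t + d / s)%R])
     (cabs (f (polar z.1 z.2)) `^ k)%:E)%E.
Proof.
move=> k0; have [K K0 HK] := log_submean k0.
exists (8 * K); first by rewrite mulr_gt0.
move=> f s t d hf d0 ds.
have cf z := cholomorphic_ccontinuous z hf.
have s0 : 0 < s by lra.
(* Half of d / s: as e <= 1/4, one has 1 - e <= exp(-e) and exp(e) <= 1 + 2 e, so the logarithmic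
   interval maps into [s - d, s + d]. *)
pose e := d / (2 * s).
have e0 : 0 < e by rewrite divr_gt0// mulr_gt0.
have es : e * s = d / 2 by rewrite /e; field; rewrite gt_eqF.
have e4 : e <= 1 / 4 by rewrite /e ler_pdivrMr ?mulr_gt0//; lra.
have expln : expR (ln s) = s by rewrite lnK.
have := HK f (ln s) t e hf e0; rewrite expln.
pose G (z : measurableTypeR R * measurableTypeR R) : \bar R := (cabs (f (polar z.1 z.2)) `^ k)%:E.
have mG : measurable_fun setT G by exact: measurable_cabs_polar_powR.
have G0 z : (0 <= G z)%E by rewrite lee_fin powR_ge0.
pose F (z : measurableTypeR R * measurableTypeR R) : \bar R := (cabs (f (polar (expR z.1) z.2)) `^ k)%:E.
have mF : measurable_fun setT F.
  apply/measurable_EFinP; apply: continuous_measurable_prod.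
  apply: (@continuous_cabs_polar_powR R (R * R)%type) => // z; last exact: cvg_snd.
  by apply: (@continuous_comp _ _ _ fst expR); [exact: cvg_fst|exact: continuous_expR].
have F0 z : (0 <= F z)%E by rewrite lee_fin powR_ge0.
have mI (a b : R) : measurable (`[a, b]%classic : set (measurableTypeR R)) by exact: measurable_itv.
have [_ IF] := integral_rect mu mu (mI (ln s - e) (ln s + e)) (mI (t - e) (t + e)) mF F0.
 rewrite /rect_ball /= -/F IF => H.
pose J y := (\int[mu]_(x in `[(s - d)%R, (s + d)%R]) G (x, y))%E.
have J0 y : (0 <= J y)%E by apply: integral_ge0 => x _; exact: G0.
have mJ : measurable_fun setT J.
  pose Gs (z : measurableTypeR R * measurableTypeR R) := G (z.2, z.1).
  have mGs : measurable_fun setT Gs by exact: measurableT_comp mG (@measurable_swap _ _ _ _).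
  have Gs0 z : (0 <= Gs z)%E by exact: G0.
  exact: measurable_integral1 (mI _ _) mGs Gs0.
have inner y : (\int[mu]_(x in `[(ln s - e)%R, (ln s + e)%R]) F (x, y) <= (2 / s)%:E * J y)%E.
  have cu : continuous (fun r : R => cabs (f (polar r y)) `^ k).
    by apply: (@continuous_cabs_polar_powR R R) => // ?; [exact: cvg_id|exact: cvg_cst].
  set u := fun r : R => cabs (f (polar r y)) `^ k in cu.
  have u0 r : 0 <= u r by exact: powR_ge0.
  have cw : continuous (fun r => u r * r) by move=> r; apply: cvgM; [exact: cu|exact: cvg_id].
  have cwe : continuous (fun x => u (expR x) * expR x).
    by move=> x; apply: (@continuous_comp _ _ _ expR (fun r => u r * r)); [exact: continuous_expR|exact: cw].
  have cue : continuous (fun x => u (expR x)).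
    by move=> x; apply: (@continuous_comp _ _ _ expR u); [exact: continuous_expR|exact: cu].
  have mE (v : R -> R) : continuous v -> measurable_fun setT (EFin \o v : measurableTypeR R -> \bar R).
    by move=> cv; apply/measurable_EFinP; exact: continuous_measurable_fun.
  have em : 1 - e <= expR (- e) by exact: expR_ge1Dx.
  have ep : expR e <= 1 + 2 * e.
    rewrite -[e in expR e]opprK expRN -[leRHS]invrK lef_pV2 ?posrE ?expR_gt0 ?invr_gt0//; last by lra.
    apply: le_trans em; rewrite -[leLHS]mul1r ler_pdivrMr; last by lra.
    nra.
  have s1 : s - d <= s * expR (- e).
    have : s * (1 - e) <= s * expR (- e) by rewrite ler_pM2l.
    lra.
  have s2 : s * expR e <= s + d.
    have : s * expR e <= s * (1 + 2 * e) by rewrite ler_pM2l.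
    lra.
  have s20 : (0 <= (2 / s)%:E)%E by rewrite lee_fin divr_ge0// ltW.
  apply: (@le_trans _ _ (\int[mu]_(x in `[(ln s - e)%R, (ln s + e)%R]) ((2 / s)%:E * (u (expR x) * expR x)%:E))%E).
    apply: ge0_le_integral => //.
    - by apply: measurable_funTS; exact: mE.
    - by apply: measurable_funTS; apply: measurable_funeM; exact: mE.
    - move=> x /=; rewrite in_itv /= => /andP[x1 x2]; rewrite -EFinM lee_fin.
      rewrite (_ : 2 / s * _ = u (expR x) * (2 * expR x / s)); last by ring.
      rewrite -[leLHS]mulr1; apply: ler_wpM2l; first exact: u0.
      rewrite ler_pdivlMr// mul1r.
      have : s * expR (- e) <= expR x by rewrite -[X in X * _]expln -expRD ler_expR.
      lra.
  rewrite ge0_integralZl_EFin; [|by []| | | by rewrite divr_ge0// ltW]; last 2 first.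
  - by move=> x _; rewrite lee_fin mulr_ge0// expR_ge0.
  - by apply: measurable_funTS; exact: mE.
  apply: lee_wpmul2l => //.
  rewrite (@integral_itv_exp R (fun r => u r * r)) //; last by lra.
  rewrite !expRD expln.
  apply: (@le_trans _ _ (\int[mu]_(r in `[(s * expR (- e))%R, (s * expR e)%R]) (u r)%:E)%E).
    rewrite le_eqVlt; apply/orP; left; apply/eqP; apply: eq_integral => r.
    rewrite inE /= in_itv /= => /andP[r1 _]; rewrite mulfK// gt_eqF//.
    by apply: lt_le_trans r1; rewrite mulr_gt0// expR_gt0.
  apply: ge0_subset_integral => //.
  - by apply: measurable_funTS; exact: mE.
  - by move=> x _; rewrite lee_fin.
  - by move=> x /=; rewrite !in_itv /= => /andP[? ?]; apply/andP; split; lra.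
have Hb : (\int[mu]_(y in `[(t - e)%R, (t + e)%R]) \int[mu]_(x in `[(ln s - e)%R, (ln s + e)%R]) F (x, y)
   <= (2 / s)%:E * \int[mu]_(y in `[(t - d / s)%R, (t + d / s)%R]) J y)%E.
  have es2 : e <= d / s.
    have e2 : e * 2 = d / s by rewrite /e; field; rewrite gt_eqF.
    by rewrite -e2; lra.
  apply: (@le_trans _ _ (\int[mu]_(y in `[(t - e)%R, (t + e)%R]) ((2 / s)%:E * J y))%E).
    apply: ge0_le_integral; [exact: mI| | | |by move=> y _; exact: inner].
    - by move=> y _; apply: integral_ge0 => x _; exact: F0.
    - apply: measurable_funTS.
      pose Fs (z : measurableTypeR R * measurableTypeR R) := F (z.2, z.1).
      have mFs : measurable_fun setT Fs by exact: measurableT_comp mF (@measurable_swap _ _ _ _).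
      have Fs0 z : (0 <= Fs z)%E by exact: F0.
      exact: measurable_integral1 (mI _ _) mFs Fs0.
    - by apply: measurable_funTS; exact: measurable_funeM mJ.
  rewrite ge0_integralZl_EFin; [|by []|by []|exact: measurable_funTS| by rewrite divr_ge0// ltW].
  apply: lee_wpmul2l; first by rewrite lee_fin divr_ge0// ltW.
  apply: ge0_subset_integral => //; first exact: measurable_funTS.
  by move=> x /=; rewrite !in_itv /= => /andP[? ?]; apply/andP; split; lra.
have [_ JE] := integral_rect mu mu (mI (s - d) (s + d)) (mI (t - d / s) (t + d / s)) mG G0.
rewrite -/G JE -/J.
have {}H := le_trans H (lee_wpmul2l _ Hb).
have {H} : ((e ^+ 2 * cabs (f (polar s t)) `^ k)%:E <= K%:E * ((2 / s)%:E * \int[mu]_(y in `[(t - d / s)%R, (t + d / s)%R]) J y))%E.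
  by apply: H; rewrite lee_fin ltW.
move=> /(lee_wpmul2l (_ : (0 <= (4 * s ^+ 2)%:E)%E)) H.
have := H _; rewrite muleA muleA -!EFinM.
have -> : 4 * s ^+ 2 * (e ^+ 2 * cabs (f (polar s t)) `^ k) = d ^+ 2 * cabs (f (polar s t)) `^ k.
  by rewrite /e; field; rewrite gt_eqF.
have -> : 4 * s ^+ 2 * K * (2 / s) = 8 * K * s by field; rewrite gt_eqF.
by apply; rewrite lee_fin mulr_ge0 ?sqr_ge0.
Qed.

End polar_submean_ineq.

(** * Radial domination *)

Section radial_maximal.
Variable R : realType.
Local Notation mu := (@lebesgue_measure R).
Local Notation rT := (measurableTypeR R).
Implicit Types (f : R[i] -> R[i]).

(** The argument is taken within [pi] of a prescribed angle, so that in [near_box] the offset from a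
    given direction is bounded. *)
Lemma polar_arg (z : R[i]) (t : R) : exists2 s : R, t - pi <= s <= t + pi &
  z = polar (cabs z) s.
Proof.
suff H (w : R[i]) : exists2 s : R, - pi <= s <= pi & w = polar (cabs w) s.
  have [s s1 E] := H (z * polar 1 (- t)).
  exists (s + t); first by lra.
  have := congr1 (fun w => w * polar 1 t) E.
  rewrite -mulrA -!polarM mulr1 mulr1 addNr cabsM cabs_polar normr1 mulr1.
  by rewrite (_ : polar 1 0 = 1) ?mulr1// /polar cos0 sin0 mulr1 mulr0.
have [->|w0] := eqVneq w 0.
  by exists 0; rewrite ?cabs0 /polar ?mul0r//; have := pi_ge0 R; lra.
have c0 : 0 < cabs w by rewrite cabs_gt0.
pose a := complex.Re w / cabs w; pose b := complex.Im w / cabs w.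
have ab1 : a ^+ 2 + b ^+ 2 = 1.
  rewrite /a /b !expr_div_n -mulrDl -[X in _ / X]sqr_sqrtr ?sqr_ge0//.
  have -> : cabs w ^+ 2 = complex.Re w ^+ 2 + complex.Im w ^+ 2.
    by rewrite cabsE sqr_sqrtr// addr_ge0// sqr_ge0.
  rewrite sqr_sqrtr ?addr_ge0 ?sqr_ge0// divff//.
  by rewrite -[X in X != 0]sqr_sqrtr ?addr_ge0 ?sqr_ge0// -cabsE expf_neq0// gt_eqF.
have a1 : -1 <= a <= 1.
  have : a ^+ 2 <= 1 by rewrite -ab1 lerDl sqr_ge0.
  by move=> a2; apply/andP; split; nra.
have sa : sin (acos a) = `|b|.
  rewrite sin_acos// -sqrtr_sqr; congr Num.sqrt; lra.
have wE (s : R) : cos s = a -> sin s = b -> w = polar (cabs w) s.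
  move=> ca sb; apply/eqP; rewrite eq_complex /= ca sb /a /b !(mulrC (cabs w)).
  by rewrite !divfK ?(gt_eqF c0)// !eqxx.
have A0 := acos_ge0 a1; have Ap := acos_lepi a1.
have [b0|b0] := leP 0 b.
  exists (acos a); first by lra.
  by apply: wE; [rewrite acosK|rewrite sa ger0_norm].
exists (- acos a); first by lra.
by apply: wE; [rewrite cosN acosK|rewrite sinN sa ltr0_norm// opprK].
Qed.

(** 2 pi times the k-th power of M_k. It is a real number, since the integrand is bounded when f is
    continuous. *)
Definition nint (k : R) f (s : R) : R :=
  fine (\int[mu]_(t in `[0%R, (2 * pi)%R]) (cabs (f (polar s t)) `^ k)%:E)%E.

Section fixed_exponent.
Variables (k : R) (k0 : 0 < k).

Let twopi : 0 < 2 * pi :> R. Proof. by rewrite mulr_gt0// pi_gt0. Qed.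

Lemma cabs_powR_bounded f (r : R) : (forall z, ccontinuous f z) ->
  exists2 M, 0 <= M & forall s t, `|s| <= r -> cabs (f (polar s t)) `^ k <= M.
Proof.
move=> cf; have [M M0 fM] := ccontinuous_bounded r cf.
exists (M `^ k); first exact: powR_ge0.
move=> s t sr; apply: ge0_ler_powR; rewrite ?nnegrE ?(ltW k0) ?cabs_ge0//.
by apply: fM; rewrite cabs_polar.
Qed.

Lemma measurable_polar_angle f (s v : R) : (forall z, ccontinuous f z) ->
  measurable_fun setT ((fun t => (cabs (f (polar s (v + t))) `^ k)%:E) : rT -> \bar R).
Proof.
move=> cf; apply/measurable_EFinP; apply: continuous_measurable_fun.
apply: (@continuous_cabs_polar_powR R R) => // t; first exact: cvg_cst.
by apply: cvgD; [exact: cvg_cst|exact: cvg_id].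
Qed.

Lemma integral_angle_bound f (s M : R) : (forall z, ccontinuous f z) ->
  (forall t, cabs (f (polar s t)) `^ k <= M) ->
  (\int[mu]_(t in `[0%R, (2 * pi)%R]) (cabs (f (polar s t)) `^ k)%:E <= (2 * pi * M)%:E)%E.
Proof.
move=> cf fM.
apply: (@le_trans _ _ (\int[mu]_(t in `[0%R, (2 * pi)%R]) M%:E)%E).
  apply: ge0_le_integral => //.
  - by move=> t _; rewrite lee_fin powR_ge0.
  - apply: measurable_funTS; have := measurable_polar_angle s 0 cf.
    by under eq_fun do rewrite add0r.
  - by move=> t _; rewrite lee_fin.
rewrite integral_cst//= lebesgue_measure_itv /= lte_fin twopi.
by rewrite -EFinB -EFinM lee_fin subr0 mulrC.
Qed.

Lemma nintE f (s : R) : (forall z, ccontinuous f z) ->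
  ((nint k f s)%:E = \int[mu]_(t in `[0%R, (2 * pi)%R]) (cabs (f (polar s t)) `^ k)%:E)%E.
Proof.
move=> cf; rewrite /nint fineK//.
have [M M0 HM] := cabs_powR_bounded `|s| cf.
rewrite ge0_fin_numE; last by apply: integral_ge0 => t _; rewrite lee_fin powR_ge0.
apply: le_lt_trans (integral_angle_bound cf (fun t => HM s t (lexx _))) _.
by rewrite ltry.
Qed.

Lemma nint_ge0 f s : 0 <= nint k f s.
Proof. by apply: fine_ge0; apply: integral_ge0 => t _; rewrite lee_fin powR_ge0. Qed.

Lemma nint_bounded f (r : R) : (forall z, ccontinuous f z) ->
  exists2 M, 0 <= M & forall s, `|s| <= r -> nint k f s <= M.
Proof.
move=> cf; have [M M0 HM] := cabs_powR_bounded r cf.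
exists (2 * pi * M); first by rewrite mulr_ge0// ltW.
move=> s sr; rewrite -lee_fin nintE//; apply: integral_angle_bound => // t; exact: HM.
Qed.

Lemma measurable_nint f : (forall z, ccontinuous f z) -> measurable_fun setT (nint k f : rT -> R).
Proof.
move=> cf; have mI : measurable (`[0, 2 * pi]%classic : set rT) by exact: measurable_itv.
pose G (z : rT * rT) : \bar R := (cabs (f (polar z.1 z.2)) `^ k)%:E.
have mG : measurable_fun setT G by exact: measurable_cabs_polar_powR.
have G0 z : (0 <= G z)%E by rewrite lee_fin powR_ge0.
have H := measurable_integral1 mu mI mG G0.
apply/measurable_EFinP; apply: eq_measurable_fun H => s _.
by rewrite /= nintE.
Qed.

Lemma nint_shift f (s v : R) : (forall z, ccontinuous f z) ->
  (\int[mu]_(t in `[0%R, (2 * pi)%R]) (cabs (f (polar s (v + t))) `^ k)%:E = (nint k f s)%:E)%E.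
Proof.
move=> cf; apply: etrans _ (esym (nintE s cf)).
apply: etrans _ (@integral_periodic_shift R (fun t => cabs (f (polar s t)) `^ k) (2 * pi) v twopi _ _ _).
- by apply: eq_integral => t _; rewrite addrC.
- apply: (@continuous_cabs_polar_powR R R) => // t; [exact: cvg_cst|exact: cvg_id].
- by move=> t; exact: powR_ge0.
- move=> t; congr (cabs (f _) `^ k).
  by rewrite /polar mulr_natl cosD2pi sinD2pi.
Qed.

(** Angles are measured from a reference direction [th], in which the inequality will be integrated
    while the window of [v] stays fixed. *)
Lemma polar_submean_shift : exists2 K, 0 < K &
  forall f s t th d, cholomorphic f -> 0 < d -> d <= s / 2 ->
  ((d ^+ 2 * cabs (f (polar s t)) `^ k)%:E <=
   (K * s)%:E * \int[mu]_(r in `[(s - d)%R, (s + d)%R])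
     \int[mu]_(v in `[(t - th - d / s)%R, (t - th + d / s)%R])
     (cabs (f (polar r (v + th))) `^ k)%:E)%E.
Proof.
have [K K0 HK] := polar_submean k0.
exists K => // f s t th d hf d0 ds; have cf z := cholomorphic_ccontinuous z hf.
have s0 : 0 < s by lra.
apply: le_trans (HK f s t d hf d0 ds) _.
have mI (a b : R) : measurable (`[a, b]%classic : set rT) by exact: measurable_itv.
have G0 (z : rT * rT) : (0 <= (cabs (f (polar z.1 z.2)) `^ k)%:E)%E by rewrite lee_fin powR_ge0.
have [-> _] := integral_rect mu mu (mI (s - d) (s + d)) (mI (t - d / s) (t + d / s))
  (measurable_cabs_polar_powR k0 cf) G0.
have d1 : 0 < d / s by rewrite divr_gt0.
have E (r : R) : (\int[mu]_(v in `[(t - d / s)%R, (t + d / s)%R]) (cabs (f (polar r v)) `^ k)%:E =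
    \int[mu]_(v in `[(t - th - d / s)%R, (t - th + d / s)%R]) (cabs (f (polar r (v + th))) `^ k)%:E)%E.
  have cu : continuous (fun v => cabs (f (polar r v)) `^ k).
    by apply: (@continuous_cabs_polar_powR R R) => // ?; [exact: cvg_cst|exact: cvg_id].
  apply: etrans _ (@integral_itv_shift R (fun v => cabs (f (polar r v)) `^ k) (t - th - d / s) (t - th + d / s) th _ cu); last by lra.
  have -> : t - th - d / s + th = t - d / s by ring.
  by have -> : t - th + d / s + th = t + d / s by ring.
apply: lee_wpmul2l; first by rewrite lee_fin mulr_ge0// ltW.
rewrite le_eqVlt; apply/orP; left; apply/eqP.
by apply: eq_integral => r _; exact: E.
Qed.

Lemma measurable_polar_add f : (forall z, ccontinuous f z) ->
  measurable_fun setT ((fun p : (rT * rT) * rT => (cabs (f (polar p.1.1 (p.1.2 + p.2))) `^ k)%:E)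
    : _ -> \bar R).
Proof.
move=> cf.
have mm : measurable_fun setT (fun p : (rT * rT) * rT => (p.1.1, (p.1.2 + p.2)%R) : rT * rT).
  apply/measurable_fun_pairP; split => /=.
    exact: measurableT_comp measurable_fst measurable_fst.
  apply: measurable_funD => //.
  exact: measurableT_comp measurable_snd measurable_fst.
exact: (measurableT_comp (measurable_cabs_polar_powR k0 cf) mm).
Qed.

(** Integration of the planar inequality over all angles: by periodicity each offset [v] of the
    window contributes the same [nint], and the width 2 d / s of the window cancels the factor [s],
    which leaves a one-dimensional inequality. *)
Lemma nint_submean : exists2 K, 0 < K & forall f s d, cholomorphic f -> 0 < d -> d <= s / 2 ->
  ((d * nint k f s)%:E <= K%:E * \int[mu]_(t in `[(s - d)%R, (s + d)%R]) (nint k f t)%:E)%E.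
Proof.
have [K K0 HK] := polar_submean_shift.
exists (2 * K); first by rewrite mulr_gt0.
move=> f s d hf d0 ds; have cf z := cholomorphic_ccontinuous z hf.
have s0 : 0 < s by lra.
have mI (a b : R) : measurable (`[a, b]%classic : set rT) by exact: measurable_itv.
pose S := `[s - d, s + d]%classic : set rT.
pose V := `[- (d / s), d / s]%classic : set rT.
pose T := `[0, 2 * pi]%classic : set rT.
pose Psi (p : (rT * rT) * rT) : \bar R := (cabs (f (polar p.1.1 (p.1.2 + p.2))) `^ k)%:E.
have mPsi : measurable_fun setT Psi by exact: measurable_polar_add.
have Psi0 p : (0 <= Psi p)%E by rewrite lee_fin powR_ge0.
have mSV : measurable (S `*` V) by apply: measurableX; exact: mI.
have mT : measurable T by exact: mI.
pose J t := (\int[@lebesgue2 R]_(z in S `*` V) Psi (z, t))%E.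
have J0 t : (0 <= J t)%E by exact: integral_ge0.
have mJ : measurable_fun setT J.
  pose Ps (p : rT * (rT * rT)) := Psi (p.2, p.1).
  have mPs : measurable_fun setT Ps by exact: measurableT_comp mPsi (@measurable_swap _ _ _ _).
  have Ps0 p : (0 <= Ps p)%E by exact: Psi0.
  exact: (measurable_integral1 (@lebesgue2 R) mSV mPs Ps0).
have pt t : ((d ^+ 2 * cabs (f (polar s t)) `^ k)%:E <= (K * s)%:E * J t)%E.
  apply: le_trans (HK f s t t d hf d0 ds) _.
  rewrite subrr sub0r add0r.
  have mPt : measurable_fun setT (fun z => Psi (z, t)).
    exact: (measurableT_comp mPsi (pair2_measurable t)).
  by rewrite /J (integral_lebesgue2 (mI (s - d) (s + d)) (mI (- (d / s)) (d / s)) mPt (fun z => Psi0 (z, t))).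
have Ks : 0 <= K * s by rewrite mulr_ge0// ltW.
have : ((d ^+ 2 * nint k f s)%:E <= (K * s)%:E * \int[mu]_(t in T) J t)%E.
  rewrite EFinM (nintE s cf) -ge0_integralZl_EFin//; last 3 first.
  - by move=> t _; rewrite lee_fin powR_ge0.
  - apply: measurable_funTS; have := measurable_polar_angle s 0 cf.
    by under eq_fun do rewrite add0r.
  - exact: sqr_ge0.
  rewrite -ge0_integralZl_EFin//; last exact: measurable_funTS.
  apply: ge0_le_integral => //.
  - by move=> t _; rewrite -EFinM lee_fin mulr_ge0 ?sqr_ge0 ?powR_ge0.
  - apply: measurable_funTS; apply: measurable_funeM.
    have := measurable_polar_angle s 0 cf.
    by under eq_fun do rewrite add0r.
  - by apply: measurable_funTS; exact: measurable_funeM mJ.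
  - by move=> t _; rewrite -EFinM; exact: pt.
have [EJ1 EJ2] := integral_rect (@lebesgue2 R) mu mSV mT mPsi Psi0.
have EJ : (\int[mu]_(t in T) J t = \int[@lebesgue2 R]_(x in S `*` V) \int[mu]_(y in T) Psi (x, y))%E.
  exact: etrans (esym EJ2) EJ1.
rewrite EJ.
pose N (z : rT * rT) : \bar R := (nint k f z.1)%:E.
have mN : measurable_fun setT N.
  by apply/measurable_EFinP; exact: measurableT_comp (measurable_nint cf) _.
have N0 z : (0 <= N z)%E by rewrite lee_fin nint_ge0.
have -> : (\int[@lebesgue2 R]_(x in S `*` V) \int[mu]_(y in T) Psi (x, y) = \int[@lebesgue2 R]_(z in S `*` V) N z)%E.
  by apply: eq_integral => z _; rewrite /Psi /= nint_shift.
rewrite (integral_lebesgue2 (mI (s - d) (s + d)) (mI (- (d / s)) (d / s)) mN N0).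
have -> : (\int[mu]_(x in `[(s - d)%R, (s + d)%R]) \int[mu]_(y in `[(- (d / s))%R, (d / s)%R]) N (x, y) =
   \int[mu]_(x in `[(s - d)%R, (s + d)%R]) ((2 * (d / s))%:E * (nint k f x)%:E))%E.
  apply: eq_integral => x _; rewrite /N /= integral_cst//= lebesgue_measure_itv /= lte_fin.
  have d1 : 0 < d / s by rewrite divr_gt0.
  rewrite ifT; last by lra.
  by rewrite -EFinB muleC; congr (_%:E * _)%E; ring.
rewrite ge0_integralZl_EFin; last 4 first.
- exact: mI.
- by move=> x _; rewrite lee_fin nint_ge0.
- by apply/measurable_EFinP; apply: measurable_funTS; exact: measurable_nint.
- by rewrite mulr_ge0// divr_ge0// ltW.
set X := (\int[mu]_(x in _) _)%E => H.
rewrite -(@lee_pmul2l _ d%:E) ?lte_fin// -EFinM mulrA -expr2; apply: le_trans H _.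
rewrite !muleA -!EFinM (_ : K * s * (2 * (d / s)) = d * (2 * K))//.
by field; rewrite gt_eqF.
Qed.

End fixed_exponent.
End radial_maximal.

Section radial_domination.
Variable R : realType.
Local Notation mu := (@lebesgue_measure R).
Local Notation rT := (measurableTypeR R).
Implicit Types (f : R[i] -> R[i]).

Definition gauss_ker (a r t : R) : R := expR (a * (r ^+ 2 - t ^+ 2)).

Lemma gauss_ker_ge0 (a r t : R) : 0 <= gauss_ker a r t.
Proof. exact: expR_ge0. Qed.

Lemma continuous_gauss_ker (a r : R) : continuous (gauss_ker a r).
Proof.
have H : continuous (expR \o (fun t => a * (r ^+ 2 - t ^+ 2))); last exact: H.
move=> t; apply: continuous_comp; last exact: continuous_expR.
by apply: cvgM; [exact: cvg_cst|apply: cvgB; [exact: cvg_cst|exact: exprn_continuous]].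
Qed.

(** Adding [c] to the square enlarges a large radius [r] by about c / (2 r), the size of the boxes,
    while the kernel stays at least exp(- a c). *)
Definition outer_radius (c r : R) : R := Num.sqrt (r ^+ 2 + c).

(** Any value above (33/8) (29/2)^2, about 867, would do: see [near_box]. *)
Definition window_const : R := 30 ^+ 2.

Lemma window_const_gt0 : 0 < window_const.
Proof. by rewrite /window_const exprn_gt0. Qed.

(* The angular window has width of order [1 / t ^ 2] at radius [t]. *)
Let win : set (rT * rT) := [set p | `|p.2| * p.1 ^+ 2 <= window_const].

Let measurable_win : measurable win.
Proof.
pose g (p : rT * rT) : rT := `|p.2| * p.1 ^+ 2.
have mg : measurable_fun setT g.
  apply: (@continuous_measurable_prod R (fun p => `|p.2| * p.1 ^+ 2)) => p.
  apply: cvgM; first by apply: cvg_norm; exact: cvg_snd.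
  by apply: (@continuous_comp _ _ _ fst (fun x : R => x ^+ 2)); [exact: cvg_fst|exact: exprn_continuous].
have -> : win = g @^-1` `]-oo, window_const].
  by apply/seteqP; split => p; rewrite /win /g /= in_itv.
by rewrite -[X in measurable X]setTI; apply: mg => //; exact: measurable_itv.
Qed.

Variables (k : R) (k0 : 0 < k).

Definition window_integral f (p : rT * rT) : \bar R :=
  (\int[mu]_v (\1_win (p.1, v) * cabs (f (polar p.1 (v + p.2))) `^ k)%:E)%E.

(** The cube is the area density [t] times [t ^ 2], the inverse of the area of a box of radial size
    1/t and angular size 1/t^2. Starting at 3/2 keeps away from the origin, where such boxes lose
    their meaning. *)
Definition local_majorant f (a r th : R) : \bar R :=
  (\int[mu]_(t in `[(3 / 2)%R, outer_radius (15 ^+ 2) r])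
     ((gauss_ker a r t * t ^+ 3)%:E * window_integral f (t, th)))%E.

Let measurable_window_integrand f : (forall z, ccontinuous f z) ->
  measurable_fun setT ((fun p : (rT * rT) * rT =>
    (\1_win (p.1.1, p.2) * cabs (f (polar p.1.1 (p.2 + p.1.2))) `^ k)%:E) : _ -> \bar R).
Proof.
move=> cf; apply/measurable_EFinP; apply: measurable_funM.
  have mi : measurable_fun setT (\1_win : rT * rT -> R) by exact: measurable_indic.
  have mp : measurable_fun setT (fun p : (rT * rT) * rT => (p.1.1, p.2) : rT * rT).
    apply/measurable_fun_pairP; split => /=; last exact: measurable_snd.
    exact: measurableT_comp measurable_fst measurable_fst.
  exact: (measurableT_comp mi mp).
have := measurable_polar_add k0 cf => /measurable_EFinP.
by apply: eq_measurable_fun => p _ /=; rewrite addrC.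
Qed.

Let window_integrand_ge0 f (p : (rT * rT) * rT) :
  (0 <= (\1_win (p.1.1, p.2) * cabs (f (polar p.1.1 (p.2 + p.1.2))) `^ k)%:E)%E.
Proof. by rewrite lee_fin mulr_ge0// ?powR_ge0// indicE; case: (_ \in _). Qed.

Lemma measurable_window_integral f : (forall z, ccontinuous f z) ->
  measurable_fun setT (window_integral f).
Proof.
move=> cf; exact: (measurable_integral1 mu measurableT (measurable_window_integrand cf)
  (window_integrand_ge0 f)).
Qed.

Lemma window_integral_ge0 f p : (0 <= window_integral f p)%E.
Proof. by apply: integral_ge0 => v _; exact: (window_integrand_ge0 f (p, v)). Qed.

Let measurable_gauss_ker3 (a r : R) : measurable_fun setT
  ((fun t => gauss_ker a r t * t ^+ 3) : rT -> R).
Proof.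
apply: continuous_measurable_fun => t.
by apply: cvgM; [exact: continuous_gauss_ker|exact: exprn_continuous].
Qed.

Let measurable_gauss_ker1 (a r : R) : measurable_fun setT
  ((fun t => gauss_ker a r t * t) : rT -> R).
Proof.
apply: continuous_measurable_fun => t.
by apply: cvgM; [exact: continuous_gauss_ker|exact: cvg_id].
Qed.

(** By Tonelli and periodicity every offset contributes a full [nint], and the window has length 2
    [window_const] / t^2. This division by t^2 brings the cube of [local_majorant] back to t. *)
Lemma window_integral_angle f (t : R) : (forall z, ccontinuous f z) -> 0 < t ->
  (\int[mu]_(th in `[0%R, (2 * pi)%R]) window_integral f (t, th) =
   (2 * window_const / t ^+ 2 * nint k f t)%:E)%E.
Proof.
move=> cf t0.
pose X (p : rT * rT) : \bar R := (\1_win (t, p.2) * cabs (f (polar t (p.2 + p.1))) `^ k)%:E.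
have mX : measurable_fun setT X.
  pose emb (p : rT * rT) : (rT * rT) * rT := ((t, p.1), p.2).
  have me : measurable_fun setT emb.
    apply/measurable_fun_pairP; split => /=; last exact: measurable_snd.
    by apply/measurable_fun_pairP; split => /=; [exact: measurable_cst|exact: measurable_fst].
  exact: (measurableT_comp (measurable_window_integrand cf) me).
have X0 p : (0 <= X p)%E by exact: (window_integrand_ge0 f ((t, p.1), p.2)).
have mI (a b : R) : measurable (`[a, b]%classic : set rT) by exact: measurable_itv.
pose Wt := `[- (window_const / t ^+ 2), window_const / t ^+ 2]%classic : set rT.
have mWt : measurable Wt by exact: mI.
have [E1 E2] := integral_rect mu mu (mI 0 (2 * pi)) measurableT mX X0.
apply: etrans (etrans (esym E1) E2) _.
have -> : (\int[mu]_v \int[mu]_(th in `[0%R, (2 * pi)%R]) X (th, v) =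
   \int[mu]_v ((nint k f t)%:E * (\1_Wt v)%:E))%E.
  apply: eq_integral => v _; rewrite /X /=.
  under eq_integral do rewrite EFinM.
  rewrite ge0_integralZl_EFin; last 4 first.
  - exact: mI.
  - by move=> th _; rewrite lee_fin powR_ge0.
  - by apply: measurable_funTS; exact: measurable_polar_angle.
  - by rewrite indicE; case: (_ \in _).
  rewrite (nint_shift k0 t v cf) muleC; congr (_ * _%:E)%E.
  rewrite !indicE; congr ((_ : bool)%:R); apply/idP/idP; rewrite !inE /win /Wt /= in_itv /=.
    by rewrite -ler_norml ler_pdivlMr// exprn_gt0.
  by rewrite -ler_norml ler_pdivlMr// exprn_gt0.
rewrite ge0_integralZl_EFin; last 4 first.
- exact: measurableT.
- by move=> v _; rewrite lee_fin indicE; case: (_ \in _).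
- by apply/measurable_EFinP; exact: measurable_indic.
- exact: nint_ge0.
have -> : (\int[mu]_v (\1_Wt v)%:E =
    mu Wt)%E.
  by rewrite integral_indic ?setIT.
rewrite /Wt lebesgue_measure_itv /= lte_fin.
have t1 : 0 < window_const / t ^+ 2 by rewrite divr_gt0 ?window_const_gt0// exprn_gt0.
rewrite ifT; last by lra.
by rewrite -EFinB -EFinM; congr (_%:E); ring.
Qed.

Lemma local_majorant_angle f (a r : R) : (forall z, ccontinuous f z) ->
  (\int[mu]_(th in `[0%R, (2 * pi)%R]) local_majorant f a r th =
   (2 * window_const)%:E * \int[mu]_(t in `[(3 / 2)%R, outer_radius (15 ^+ 2) r]) (gauss_ker a r t * t * nint k f t)%:E)%E.
Proof.
move=> cf.
have mI (b c : R) : measurable (`[b, c]%classic : set rT) by exact: measurable_itv.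
pose X (p : rT * rT) : \bar R := ((gauss_ker a r p.1 * p.1 ^+ 3)%:E * window_integral f p)%E.
have X0 t th : 3 / 2 <= t -> (0 <= X (t, th))%E.
  move=> t1; apply: mule_ge0; last exact: window_integral_ge0.
  by rewrite lee_fin mulr_ge0 ?gauss_ker_ge0// exprn_ge0//=; lra.
have mX : measurable_fun setT X.
  apply: emeasurable_funM; last exact: measurable_window_integral.
  by apply/measurable_EFinP; exact: (measurableT_comp (measurable_gauss_ker3 a r) measurable_fst).
pose I := `[3 / 2, outer_radius (15 ^+ 2) r]%classic : set rT.
(* The cube may make [X] negative when [p.1 < 0]; the restriction is nonnegative everywhere, as
   [integral_rect] requires. *)
pose Y (p : rT * rT) : \bar R := (X \_ (I `*` setT)) p.
have mIT : measurable (I `*` [set: rT]) by apply: measurableX; [exact: mI|exact: measurableT].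
have mY : measurable_fun setT Y.
  by apply/(measurable_restrictT _ _).1 => //; exact: measurable_funTS.
have Y0 p : (0 <= Y p)%E.
  apply: erestrict_ge0 => -[t th] [/= tI _]; apply: X0.
  by move: tI; rewrite /I /= in_itv /= => /andP[].
have YX t th : I t -> Y (t, th) = X (t, th).
  by move=> tI; rewrite /Y patchT// inE.
have [E1 E2] := integral_rect mu mu (mI (3 / 2) (outer_radius (15 ^+ 2) r)) (mI 0 (2 * pi)) mY Y0.
transitivity (\int[mu]_(th in `[0%R, (2 * pi)%R]) \int[mu]_(t in I) Y (t, th))%E.
  apply: eq_integral => th _; apply: eq_integral => t; rewrite inE => tI.
  by rewrite YX.
apply: etrans (etrans (esym E2) E1) _.
rewrite -ge0_integralZl_EFin; last 4 first.
- exact: mI.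
- move=> t /=; rewrite in_itv /= => /andP[t1 _].
  by rewrite lee_fin !mulr_ge0 ?gauss_ker_ge0 ?nint_ge0//; lra.
- apply/measurable_EFinP; apply: measurable_funTS; apply: measurable_funM; last exact: measurable_nint.
  exact: measurable_gauss_ker1.
- by rewrite mulr_ge0// ltW// window_const_gt0.
apply: eq_integral => t; rewrite inE => tI; have := tI; rewrite /= in_itv /= => /andP[t1 t2].
have t0 : 0 < t by lra.
transitivity (\int[mu]_(th in `[0%R, (2 * pi)%R]) ((gauss_ker a r t * t ^+ 3)%:E * window_integral f (t, th)))%E.
  by apply: eq_integral => th _; rewrite YX.
rewrite ge0_integralZl_EFin; last 4 first.
- exact: mI.
- by move=> th _; exact: window_integral_ge0.
- apply: measurable_funTS.
  exact: (measurableT_comp (measurable_window_integral cf) (pair1_measurable t)).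
- by rewrite mulr_ge0 ?gauss_ker_ge0// exprn_ge0// ltW.
rewrite window_integral_angle// -!EFinM; congr (_%:E).
by field; rewrite gt_eqF.
Qed.

(** One box at a time: the sub-mean inequality, then enlargement of the box to the whole domain of
    the majorant, [m0] being a lower bound of the weight on the box. The box may be centred on the
    ray ([far_box]) or in another direction ([near_box]). *)
Lemma local_majorant_ge_rect : exists2 K, 0 < K & forall f a r s t th d m0,
  cholomorphic f -> 0 < d -> d <= s / 2 -> 3 / 2 <= s - d -> (s + d) ^+ 2 <= r ^+ 2 + (15 ^+ 2) ->
  0 <= m0 ->
  (forall u v, s - d <= u <= s + d -> t - th - d / s <= v <= t - th + d / s ->
     `|v| * u ^+ 2 <= window_const /\ m0 <= gauss_ker a r u * u ^+ 3) ->
  ((m0 * (d ^+ 2 * cabs (f (polar s t)) `^ k))%:E <= (K * s)%:E * local_majorant f a r th)%E.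
Proof.
have [K K0 HK] := polar_submean_shift k0.
exists K => // f a r s t th d m0 hf d0 ds sd1 sd2 m00 Hu.
have cf z := cholomorphic_ccontinuous z hf.
have s0 : 0 < s by lra.
have mI (b c : R) : measurable (`[b, c]%classic : set rT) by exact: measurable_itv.
have Ks : 0 <= K * s by rewrite mulr_ge0// ltW.
pose V := `[t - th - d / s, t - th + d / s]%classic : set rT.
pose W u := (\int[mu]_(v in V) (cabs (f (polar u (v + th))) `^ k)%:E)%E.
have mPhi : measurable_fun setT (fun p : rT * rT => (cabs (f (polar p.1 (p.2 + th))) `^ k)%:E).
  pose emb (p : rT * rT) : (rT * rT) * rT := ((p.1, th), p.2).
  have me : measurable_fun setT emb.
    apply/measurable_fun_pairP; split => /=; last exact: measurable_snd.
    by apply/measurable_fun_pairP; split => /=; [exact: measurable_fst|exact: measurable_cst].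
  have := measurableT_comp (measurable_polar_add k0 cf) me.
  by apply: eq_measurable_fun => p _ /=; rewrite addrC.
have mW : measurable_fun setT W.
  have Phi0 (p : rT * rT) : (0 <= (cabs (f (polar p.1 (p.2 + th))) `^ k)%:E)%E by rewrite lee_fin powR_ge0.
  exact: (measurable_integral1 mu (mI (t - th - d / s) (t - th + d / s)) mPhi Phi0).
have W0 u : (0 <= W u)%E by apply: integral_ge0 => v _; rewrite lee_fin powR_ge0.
pose S := `[s - d, s + d]%classic : set rT.
have mS : measurable S by exact: mI.
rewrite EFinM; apply: le_trans (lee_wpmul2l _ (HK f s t th d hf d0 ds)) _; first by rewrite lee_fin.
rewrite muleCA; apply: lee_wpmul2l; first by rewrite lee_fin.
rewrite -/V -/W -ge0_integralZl_EFin; last 4 first.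
- exact: mS.
- by move=> u _; exact: W0.
- exact: measurable_funTS.
- exact: m00.
have mwin u : measurable_fun setT (fun v : rT => (\1_win (u, v) * cabs (f (polar u (v + th))) `^ k)%:E).
  exact: (measurableT_comp (measurable_window_integrand cf) (pair1_measurable (u, th))).
have WE u : s - d <= u <= s + d -> (W u <= window_integral f (u, th))%E.
  move=> us; rewrite /W integral_mkcond; apply: ge0_le_integral => //.
  - by move=> v _; apply: erestrict_ge0 => // ? _; rewrite lee_fin powR_ge0.
  - apply/(measurable_restrictT _ _).1; first exact: mI.
    exact: measurable_funTS (measurableT_comp mPhi (pair1_measurable u)).
  - move=> v _; rewrite /patch; case: ifPn => [|_]; last exact: (window_integrand_ge0 f ((u, th), v)).
    rewrite inE /V /= in_itv /= => vV; have [H1 _] := Hu u v us vV.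
    by rewrite indicE mem_set ?mul1r.
have mT : measurable_fun setT (fun u : rT => ((gauss_ker a r u * u ^+ 3)%:E * window_integral f (u, th))%E).
  apply: emeasurable_funM; first by apply/measurable_EFinP; exact: measurable_gauss_ker3.
  exact: (measurableT_comp (measurable_window_integral cf) (pair2_measurable th)).
apply: (@le_trans _ _ (\int[mu]_(u in S) ((gauss_ker a r u * u ^+ 3)%:E * window_integral f (u, th)))%E).
  apply: ge0_le_integral.
  - exact: mS.
  - by move=> u _; apply: mule_ge0; [by rewrite lee_fin|exact: W0].
  - by apply: measurable_funTS; exact: measurable_funeM mW.
  - exact: measurable_funTS.
  - move=> u; rewrite /S /= in_itv /= => us; apply: lee_pmul; [by rewrite lee_fin|exact: W0| |exact: WE].
    have dv : t - th - d / s <= t - th <= t - th + d / s.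
      have : 0 < d / s by rewrite divr_gt0.
      by lra.
    by rewrite lee_fin; have [_] := Hu u _ us dv.
apply: ge0_subset_integral => //.
- exact: measurable_funTS.
- move=> u /=; rewrite in_itv /= => /andP[u1 _]; apply: mule_ge0; last exact: window_integral_ge0.
  by rewrite lee_fin mulr_ge0 ?gauss_ker_ge0// exprn_ge0//=; lra.
- move=> u; rewrite /S /= !in_itv /= => /andP[u1 u2]; apply/andP; split; first by lra.
  rewrite /outer_radius -[leLHS]ger0_norm -?sqrtr_sqr; last by lra.
  apply: ler_wsqrtr; apply: le_trans sd2; apply: lerXn2r; rewrite ?nnegrE; lra.
Qed.

Lemma local_majorant_ge0 f a r th : (0 <= local_majorant f a r th)%E.
Proof.
apply: integral_ge0 => t /=; rewrite in_itv /= => /andP[t1 _].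
apply: mule_ge0; last exact: window_integral_ge0.
by rewrite lee_fin mulr_ge0 ?gauss_ker_ge0// exprn_ge0//=; lra.
Qed.

End radial_domination.

Section radial_domination_bound.
Variable R : realType.
Implicit Types (f : R[i] -> R[i]).
Variables (k : R) (k0 : 0 < k).
Local Notation local_majorant := (local_majorant k).

Let cancel_factor (c b x : R) (D : \bar R) : 0 < c ->
  ((c * x)%:E <= b%:E * D)%E -> (x%:E <= (b / c)%:E * D)%E.
Proof.
move=> c0 H; have ci : (0 <= (c^-1)%:E)%E by rewrite lee_fin invr_ge0 ltW.
have := lee_wpmul2l ci H; rewrite muleA -!EFinM mulrA mulVf ?gt_eqF// mul1r.
by rewrite mulrC.
Qed.

(** With d = 1/(2 s) the square of the radius changes by a bounded amount over the box, and the
    angular half-width d / s is 1/(2 s^2). *)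
Let far_box (s d : R) : 2 <= s -> d * s = 1 / 2 ->
  [/\ 0 < d, d <= s / 2, 3 / 2 <= s - d, (s + d) ^+ 2 <= s ^+ 2 + 2 &
  forall u v, s - d <= u <= s + d -> - (d / s) <= v <= d / s ->
    [/\ `|v| * u ^+ 2 <= window_const R, s / 2 <= u & u ^+ 2 <= s ^+ 2 + 2]].
Proof.
move=> s2 ds; have s0 : 0 < s by lra.
have d0 : 0 < d by rewrite -(pmulr_lgt0 _ s0) ds; lra.
have d4 : d <= 1 / 4 by nra.
have sd2 : (s + d) ^+ 2 <= s ^+ 2 + 2 by nra.
split=> //; [lra|lra|move=> u v us vs].
have u0 : 0 <= u by lra.
have u54 : u <= 5 / 4 * s by lra.
split; [|lra|].
  have vd : `|v| <= d / s by rewrite ler_norml.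
  apply: (@le_trans _ _ (d / s * (5 / 4 * s) ^+ 2)).
    by apply: ler_pM => //; [exact: sqr_ge0|apply: lerXn2r; rewrite ?nnegrE; lra].
  have -> : d / s * (5 / 4 * s) ^+ 2 = 25 / 16 * (d * s) by field; rewrite gt_eqF.
  by rewrite ds /window_const; lra.
by apply: le_trans sd2; apply: lerXn2r; rewrite ?nnegrE; lra.
Qed.

(** At bounded radii the window contains every direction: the offset is at most pi + 1/8 <= 33/8 and
    the radius at most 29/2. This is what determines [window_const]. *)
Let near_box (s t th : R) : 4 <= s -> s <= 14 -> th - pi <= t <= th + pi ->
  [/\ 2^-1 <= s / 2, 3 / 2 <= s - 2^-1, (s + 2^-1) ^+ 2 <= 15 ^+ 2 &
  forall u v, s - 2^-1 <= u <= s + 2^-1 -> t - th - 2^-1 / s <= v <= t - th + 2^-1 / s ->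
    [/\ `|v| * u ^+ 2 <= window_const R, 1 <= u & u ^+ 2 <= 15 ^+ 2]].
Proof.
move=> s4 s14 tth; have pi4 : pi <= 4 :> R by have := pihalf_lt2 R; lra.
split; [lra|lra|by apply: lerXn2r; rewrite ?nnegrE; lra|move=> u v us vs].
have u0 : 0 <= u by lra.
have u2 : u ^+ 2 <= (29 / 2) ^+ 2 by apply: lerXn2r; rewrite ?nnegrE; lra.
have ds : 2^-1 / s <= 1 / 8 by rewrite ler_pdivrMr; lra.
split; [|lra|lra].
have vd : `|v| <= 33 / 8 by rewrite ler_norml; lra.
apply: (@le_trans _ _ (33 / 8 * (29 / 2) ^+ 2)); first by apply: ler_pM => //; rewrite sqr_ge0.
by rewrite /window_const; lra.
Qed.

(** For s >= 2 the box is centred at the point itself. For s < 2 the value is bounded by the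
    supremum over an annulus around the point, contained in 4 <= |z| <= 14. Boxes of half-size 1/2
    around the points of that annulus stay below radius 15, hence inside [outer_radius (15 ^+ 2) r]
    for every [r]. *)
Lemma local_majorant_ge (a : R) : 0 <= a -> exists2 C, 0 < C & forall f r s th,
  cholomorphic f -> 0 <= s -> s <= r ->
  ((cabs (f (polar s th)) `^ k)%:E <= C%:E * local_majorant f a r th)%E.
Proof.
move=> a0; have [K K0 HK] := local_majorant_ge_rect k0.
(* 32: the weight (s / 2)^3 times d^2 = 1/(4 s^2) is s / 32. Next, 56 = 4 * 14: d^2 = 1/4 and the
   radius is at most 14. *)
pose C1 := 32 * expR (2 * a) * K.
pose C2 := 56 * expR (15 ^+ 2 * a) * K.
have C10 : 0 < C1 by rewrite !mulr_gt0// expR_gt0.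
have C20 : 0 < C2 by rewrite !mulr_gt0// expR_gt0.
have k20 : 0 < 2 `^ k :> R by rewrite powR_gt0.
exists (C1 + 2 `^ k * C2); first by rewrite addr_gt0// mulr_gt0.
move=> f r s th hf s0 sr.
have cf z := cholomorphic_ccontinuous z hf.
set D := local_majorant f a r th; have D0 : (0 <= D)%E by exact: local_majorant_ge0.
have mono C : 0 <= C -> C <= C1 + 2 `^ k * C2 -> (C%:E * D <= (C1 + 2 `^ k * C2)%:E * D)%E.
  by move=> C0 CC; apply: lee_wpmul2r => //; rewrite lee_fin.
have [s2|s2] := leP 2 s.
  apply: (@le_trans _ _ (C1%:E * D)%E); last first.
    by apply: mono; [exact: ltW|rewrite lerDl ltW// mulr_gt0].
  have s00 : 0 < s by apply: lt_le_trans s2.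
  have [d dE] : exists d, d = (2 * s)^-1 by exists (2 * s)^-1.
  have ds : d * s = 1 / 2 by rewrite dE; field; rewrite gt_eqF.
  have [d0 d2 sd sd2 box] := far_box s2 ds.
  have ss : s ^+ 2 <= r ^+ 2 by apply: lerXn2r; rewrite ?nnegrE ?(le_trans s0).
  have m00 : 0 < expR (- (2 * a)) * (s / 2) ^+ 3 by rewrite mulr_gt0 ?expR_gt0// exprn_gt0// divr_gt0.
  have sdr : (s + d) ^+ 2 <= r ^+ 2 + 15 ^+ 2 by apply: le_trans sd2 (lerD ss _); rewrite -natrX ler_nat.
  have := HK f a r s th th d (expR (- (2 * a)) * (s / 2) ^+ 3) hf d0 d2 sd sdr (ltW m00).
  rewrite subrr sub0r add0r mulrA => H.
  have {H} H := cancel_factor (mulr_gt0 m00 (exprn_gt0 2 d0)) (H _).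
  apply: le_trans (H _) _; last first.
    rewrite le_eqVlt; apply/orP; left; apply/eqP; congr (_%:E * _)%E.
    by rewrite dE /C1 expRN; field; rewrite !gt_eqF ?expR_gt0.
  move=> u v us vs; have [wv su u2] := box u v us vs; split=> //.
  apply: ler_pM; rewrite ?expR_ge0 ?exprn_ge0 ?divr_ge0//.
    rewrite /gauss_ker ler_expR -subr_ge0.
    rewrite (_ : _ - _ = a * (r ^+ 2 - u ^+ 2 + 2)); last by ring.
    by apply: mulr_ge0 => //; rewrite addrAC subr_ge0 (le_trans u2)// lerD2r.
  have su0 : 0 <= s / 2 by rewrite divr_ge0.
  by apply: lerXn2r; rewrite ?nnegrE ?(le_trans su0).
have annulus z : 4 <= cabs z <= 14 -> ((cabs (f z) `^ k)%:E <= C2%:E * D)%E.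
  move=> /andP[z4 z14]; have [t tth ->] := polar_arg z th.
  move: (cabs z) z4 z14 => s' z4 z14; have [H1 H2 sd2 box] := near_box z4 z14 tth.
  have m00 : 0 < expR (- (15 ^+ 2 * a)) by exact: expR_gt0.
  have r20 := sqr_ge0 r.
  have h4 : 0 < (2^-1 : R) ^+ 2 by apply: exprn_gt0; rewrite invr_gt0.
  have sdr : (s' + 2^-1) ^+ 2 <= r ^+ 2 + 15 ^+ 2 by apply: le_trans sd2 _; rewrite lerDr.
  have side u v : s' - 2^-1 <= u <= s' + 2^-1 ->
      t - th - 2^-1 / s' <= v <= t - th + 2^-1 / s' ->
      `|v| * u ^+ 2 <= window_const R /\ expR (- (15 ^+ 2 * a)) <= gauss_ker a r u * u ^+ 3.
    move=> us vs; have [wv u1 u2] := box u v us vs; split=> //.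
    rewrite -[leLHS]mulr1; apply: ler_pM; rewrite ?expR_ge0//; last by rewrite exprn_ege1.
    rewrite /gauss_ker ler_expR -subr_ge0.
    rewrite (_ : _ - _ = a * (r ^+ 2 - u ^+ 2 + 15 ^+ 2)); last by ring.
    by apply: mulr_ge0 => //; rewrite addrAC subr_ge0 (le_trans u2)// lerDr.
  have h2 : 0 < 2^-1 :> R by rewrite invr_gt0.
  have := HK f a r s' t th 2^-1 (expR (- (15 ^+ 2 * a))) hf h2 H1 H2 sdr (ltW m00) side.
  rewrite mulrA => H; have {}H := cancel_factor (mulr_gt0 m00 h4) H.
  apply: le_trans H _; apply: lee_wpmul2r => //; rewrite lee_fin /C2 expRN.
  have -> : K * s' / ((expR (15 ^+ 2 * a))^-1 * (2^-1) ^+ 2) = 4 * s' * expR (15 ^+ 2 * a) * K.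
    by field; rewrite gt_eqF ?expR_gt0.
  by rewrite ler_pM2r// ler_pM2r ?expR_gt0//; lra.
have [Dy|Dy] := eqVneq D +oo%E.
  by rewrite Dy gt0_muley ?leey// lte_fin addr_gt0// mulr_gt0.
have DE : D = (fine D)%:E by rewrite fineK// ge0_fin_numE// lt_neqAle Dy leey.
set x := fine D in DE; have x0 : 0 <= x by rewrite -lee_fin -DE.
apply: (@le_trans _ _ ((2 `^ k * C2)%:E * D)%E); last first.
  by apply: mono; [rewrite ltW// mulr_gt0|rewrite lerDr ltW].
rewrite DE -EFinM lee_fin.
have Cx : 0 <= C2 * x by rewrite mulr_ge0// ltW.
have fM : cabs (f (polar s th)) <= 2 * (C2 * x) `^ k^-1.
  (* As |polar s th| < 2, the annulus between radii 6 and 12 around this point lies in 4 <= |z| <=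
     14. *)
  rewrite /polar; apply: (@cabs_le_square_sup R f _ _ 6) => //.
  move=> z; rewrite -/(polar s th) => /andP[z6 z12].
  have pc : cabs (polar s th) = s by rewrite cabs_polar ger0_norm.
  have z14 : 4 <= cabs z <= 14.
    apply/andP; split.
      have := cabsB z (polar s th); lra.
    have := cabsD (z - polar s th) (polar s th); rewrite subrK; lra.
  have := annulus z z14; rewrite DE -EFinM lee_fin => fz.
  have := @ge0_ler_powR R k^-1 _ _ _ _ _ fz; rewrite -powRrM mulfV ?gt_eqF// powRr1 ?cabs_ge0//.
  by apply; rewrite ?invr_ge0 ?(ltW k0)// nnegrE// powR_ge0.
rewrite -mulrA.
have -> : 2 `^ k * (C2 * x) = (2 * (C2 * x) `^ k^-1) `^ k.
  by rewrite powRM ?powR_ge0// -powRrM mulVf ?gt_eqF// powRr1.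
by apply: ge0_ler_powR; rewrite ?nnegrE ?(ltW k0) ?cabs_ge0 ?mulr_ge0 ?powR_ge0.
Qed.

End radial_domination_bound.

(** * Gaussian means of radial functions *)

Section radial_profiles.
Variable R : realType.
Local Notation mu := (@lebesgue_measure R).
Local Notation rT := (measurableTypeR R).

Lemma continuous_gauss_kerM (a r : R) : continuous (fun t => gauss_ker a r t * t).
Proof. by move=> t; apply: cvgM; [exact: continuous_gauss_ker|exact: cvg_id]. Qed.

Lemma continuous_expR_comp (g : R -> R) : continuous g -> continuous (fun t => expR (g t)).
Proof.
move=> cg t; have H : {for t, continuous (expR \o g)}; last exact: H.
by apply: continuous_comp; [exact: cg|exact: continuous_expR].
Qed.

Lemma is_derive_gauss (b t : R) : is_derive t 1 (fun s => expR (b * s ^+ 2)) (2 * b * (expR (b * t ^+ 2) * t)).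
Proof.
have H : is_derive t 1 (fun s : R => b * s ^+ 2) (2 * b * t).
  rewrite (_ : (fun s : R => _) = (b \*: (@GRing.exp R ^~ 2))); last by apply/funext.
  by apply: is_derive_eq; rewrite /GRing.scale /=; ring.
have := @is_derive1_comp R expR (fun s => b * s ^+ 2) t _ _ (is_derive_expR _) H.
by move=> H1; apply: is_derive_eq H1 _; ring.
Qed.

Lemma integral_gauss_le (b c : R) : 0 < b -> 0 <= c ->
  (\int[mu]_(t in `[0%R, c]) (expR (b * t ^+ 2) * t)%:E <= (expR (b * c ^+ 2) / (2 * b))%:E)%E.
Proof.
move=> b0; rewrite le_eqVlt => /orP[/eqP <-|c0].
  rewrite set_itv1 integral_set1 lee_fin divr_ge0 ?expR_ge0//; lra.
pose F (s : R) := (2 * b)^-1 * expR (b * s ^+ 2).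
have dF (x : R) : is_derive x 1 F (expR (b * x ^+ 2) * x).
  have H := is_derive_gauss b x.
  rewrite (_ : F = ((2 * b)^-1 \*: (fun s => expR (b * s ^+ 2)))); last by apply/funext.
  by apply: is_derive_eq; rewrite /GRing.scale /=; field; rewrite gt_eqF.
have cF : continuous F.
  move=> x; apply: differentiable_continuous; apply/derivable1_diffP.
  by have := dF x; case.
have cf : continuous (fun t : R => expR (b * t ^+ 2) * t).
  move=> t; apply: cvgM; last exact: cvg_id.
  apply: (@continuous_expR_comp (fun t => b * t ^+ 2)) => {}t.
  by apply: cvgM; [exact: cvg_cst|exact: exprn_continuous].
rewrite (@continuous_FTC2 R _ F)//.
- rewrite /F expr0n/= mulr0 expR0 mulr1 -EFinB lee_fin mulrC lerBlDr lerDl invr_ge0; lra.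
- exact: continuous_subspaceT.
- split; first by move=> x _; have := dF x; case.
    exact: cvg_at_right_filter (cF 0).
  exact: cvg_at_left_filter (cF c).
- by move=> x _; rewrite derive1E; have := dF x; case.
Qed.

Lemma integral_gauss_tail (b a : R) : 0 < b -> 0 <= a ->
  (\int[mu]_(t in `[a, +oo[) (expR (- b * t ^+ 2) * t)%:E = (expR (- b * a ^+ 2) / (2 * b))%:E)%E.
Proof.
move=> b0 a0.
pose F (s : R) := - (2 * b)^-1 * expR (- b * s ^+ 2).
have dF (x : R) : is_derive x 1 F (expR (- b * x ^+ 2) * x).
  have H := is_derive_gauss (- b) x.
  rewrite (_ : F = (- (2 * b)^-1 \*: (fun s => expR (- b * s ^+ 2)))); last by apply/funext.
  by apply: is_derive_eq; rewrite /GRing.scale /=; field; rewrite gt_eqF.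
have cF : continuous F.
  move=> x; apply: differentiable_continuous; apply/derivable1_diffP.
  by have := dF x; case.
have cf : continuous (fun t : R => expR (- b * t ^+ 2) * t).
  move=> t; apply: cvgM; last exact: cvg_id.
  apply: (@continuous_expR_comp (fun t => - b * t ^+ 2)) => {}t.
  by apply: cvgM; [exact: cvg_cst|exact: exprn_continuous].
rewrite (@ge0_continuous_FTC2y R _ F a 0).
- by rewrite -EFinB; congr (_%:E); rewrite /F sub0r mulNr opprK mulrC.
- by move=> x ax; rewrite mulr_ge0 ?expR_ge0//; lra.
- exact: continuous_subspaceT.
- have -> : F = (fun s => - (2 * b)^-1 * ((expR \o -%R) (b * s ^+ 2))).
    by apply/funext => s; rewrite /F /= !mulNr.
  rewrite -[X in _ --> X](mulr0 (- (2 * b)^-1)); apply: cvgM; first exact: cvg_cst.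
  have sq : (fun s : R => b * s ^+ 2) s @[s --> +oo] --> +oo.
    apply/cvgryPge => A; near=> s.
    have s1 : 1 <= s by near: s; apply: nbhs_pinfty_ge; rewrite num_real.
    have sA : `|A| / b <= s by near: s; apply: nbhs_pinfty_ge; rewrite num_real.
    have : `|A| <= b * s by rewrite mulrC -ler_pdivrMr.
    have : s <= s ^+ 2 by rewrite expr2 ler_peMl//; lra.
    have := ler_norm A => ? ? ?; have : b * s <= b * s ^+ 2 by rewrite ler_pM2l.
    lra.
  exact: (cvg_comp _ _ sq (@cvgr_expR R)).
- by move=> x _; have := dF x; case.
- exact: cvg_at_right_filter (cF a).
- by move=> x _; rewrite derive1E; have := dF x; case.
Unshelve. all: by end_near.
Qed.

(** An explicit primitive in t^2. What matters is that the bound is uniform in [r]. *)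
Lemma integral_gauss_ker_le (b c e r : R) : 0 < b -> 0 <= c -> 0 <= e ->
  (\int[mu]_(t in `[e, outer_radius c r]) (expR (- (b * (r ^+ 2 - t ^+ 2))) * t)%:E <= (expR (b * c) / (2 * b))%:E)%E.
Proof.
move=> b0 c0 e0.
have mG : measurable_fun setT ((fun t => (expR (- (b * (r ^+ 2 - t ^+ 2))) * t)%:E) : rT -> \bar R).
  apply/measurable_EFinP; apply: continuous_measurable_fun => t.
  apply: cvgM; last exact: cvg_id.
  apply: (@continuous_expR_comp (fun t => - (b * (r ^+ 2 - t ^+ 2)))) => {}t.
  apply: cvgN; apply: cvgM; [exact: cvg_cst|].
  by apply: cvgB; [exact: cvg_cst|exact: exprn_continuous].
apply: (@le_trans _ _ (\int[mu]_(t in `[0%R, outer_radius c r]) (expR (- (b * (r ^+ 2 - t ^+ 2))) * t)%:E)%E).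
  apply: ge0_subset_integral.
  - exact: measurable_itv.
  - exact: measurable_itv.
  - exact: measurable_funTS.
  - by move=> t; rewrite /= in_itv /= => /andP[t0 _]; rewrite lee_fin mulr_ge0 ?expR_ge0.
  - by apply: subset_itv; rewrite ?bnd_simp.
rewrite (_ : (\int[mu]_(t in _) _)%E = (\int[mu]_(t in `[0%R, outer_radius c r]) ((expR (- (b * r ^+ 2)))%:E * (expR (b * t ^+ 2) * t)%:E))%E); last first.
  by apply: eq_integral => t _; rewrite -EFinM mulrA -expRD; congr (expR _ * _)%:E; ring.
rewrite ge0_integralZl_EFin ?expR_ge0//; last 2 first.
- by move=> t; rewrite /= in_itv /= => /andP[t0 _]; rewrite lee_fin mulr_ge0 ?expR_ge0.
- apply/measurable_EFinP; apply: measurable_funTS; apply: continuous_measurable_fun => t.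
  apply: cvgM; last exact: cvg_id.
  apply: (@continuous_expR_comp (fun t => b * t ^+ 2)) => {}t.
  by apply: cvgM; [exact: cvg_cst|exact: exprn_continuous].
have := integral_gauss_le b0 (sqrtr_ge0 (r ^+ 2 + c)).
rewrite -/(outer_radius c r) => H.
have E0 : (0 <= (expR (- (b * r ^+ 2)))%:E)%E by rewrite lee_fin expR_ge0.
apply: le_trans (lee_wpmul2l E0 H) _.
rewrite -EFinM mulrA -expRD lee_fin ler_pM2r ?invr_gt0 ?mulr_gt0// ler_expR.
by rewrite /outer_radius sqr_sqrtr ?addr_ge0 ?sqr_ge0//; lra.
Qed.

(** What the angular means for p finite ([nint]) and p infinite ([nsup]) have in common; everything
    radial is deduced from it. *)
Record radial_submean (K : R) (n : R -> R) : Prop := RadialSubmean {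
  rsub_measurable : measurable_fun setT (n : rT -> R);
  rsub_ge0 : forall s, 0 <= n s;
  rsub_bounded : forall r, exists M, forall s, `|s| <= r -> n s <= M;
  rsub_mean : forall s d, 0 < d -> d <= s / 2 ->
    ((d * n s)%:E <= K%:E * \int[mu]_(t in `[(s - d)%R, (s + d)%R]) (n t)%:E)%E }.

(** The range is slightly larger than in [local_majorant], to hold the intervals of a further
    sub-mean inequality: for s >= 3/2 and d = 1/(2 s), s - d > 1 and (s + d)^2 <= s^2 + 2, while
    15^2 + 2 < 16^2. *)
Definition gauss_mean (b Q : R) (n : R -> R) (r : R) : \bar R :=
  (\int[mu]_(t in `[1%R, outer_radius (16 ^+ 2) r]) (gauss_ker b r t * t * n t `^ Q)%:E)%E.

Lemma gauss_mean_ge0 b Q n r : (0 <= gauss_mean b Q n r)%E.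
Proof.
apply: integral_ge0 => t /=; rewrite in_itv /= => /andP[t1 _].
by rewrite lee_fin !mulr_ge0 ?gauss_ker_ge0 ?powR_ge0//; lra.
Qed.

Lemma radial_submean_powR (K Q : R) : 0 < K -> 0 < Q -> exists2 C, 0 < C &
  forall n s d, radial_submean K n -> 0 < d -> d <= s / 4 ->
  ((d * n s `^ Q)%:E <= C%:E * \int[mu]_(t in `[(s - d)%R, (s + d)%R]) (n t `^ Q)%:E)%E.
Proof.
move=> K0 Q0.
pose B (w r : R) : set rT := `[(w - r)%R, (w + r)%R]%classic.
have mB w r : measurable (B w r) by exact: measurable_itv.
have memB w r : 0 < r -> B w r w by move=> r0; rewrite /B /= in_itv /=; lra.
have nestB w w' r : 0 < r -> B w (r / 2) w' -> B w' (r / 2) `<=` B w r.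
  move=> r0; rewrite /B /= in_itv /= => /andP[w1 w2] x /=; rewrite !in_itv /= => /andP[x1 x2].
  apply/andP; split; lra.
(* Here [s / 4] replaces [s / 2]: an interval of half-length r <= s / 4 inside [s - d, s + d] is
   centred at w >= 3 s / 4 + r, hence r <= w / 2. *)
have sub n s d : radial_submean K n -> d <= s / 4 -> submean_on mu B 1 n K s d.
  move=> [_ _ _ hn] ds w r r0 rd Bsub; rewrite expr1; apply: hn => //.
  have : B s d (w - r) by apply: Bsub; rewrite /B /= in_itv /=; lra.
  rewrite /B /= in_itv /=; lra.
have [Q1|Q1] := ltP Q 1.
  have [C C0 H] := @submean_pow_lt1 R _ rT mu B 1 mB memB nestB K Q K0 Q0 Q1.
  exists C => // n s d gn d0 ds; have [mn n0 bn _] := gn.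
  have [M hM] := bn (s + d).
  have := H n s d M d0 mn n0 _ (sub n s d gn ds); rewrite expr1; apply.
  by move=> z; rewrite /B /= in_itv /= => /andP[z1 z2]; apply: hM; rewrite ger0_norm//; lra.
have mB2 w (r : R) : 0 < r -> (mu (B w r) <= (2 * r ^+ 1)%:E)%E.
  move=> r0; rewrite /B lebesgue_measure_itv /= lte_fin ifT; last by lra.
  by rewrite -EFinB lee_fin expr1; lra.
have [C C0 H] := @submean_pow_ge1 R _ rT mu B 1 mB K 2 Q K0 (ltr0Sn R 1) Q1 mB2.
exists C => // n s d gn d0 ds; have [mn n0 bn _] := gn.
by have := H n s d d0 mn n0 (sub n s d gn ds); rewrite expr1.
Qed.

(** Pointwise bound of a radial function by its Gaussian mean, with the expected decay. On the
    interval of half-length 1/(2 s) around [s] one has t >= s / 2 and t^2 <= s^2 + 2, so the kernel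
    at t is at least exp(- 2 b) times its value at s. *)
Lemma radial_submean_gauss (K Q b : R) : 0 < K -> 0 < Q -> 0 <= b -> exists2 C, 0 < C &
  forall n r s, radial_submean K n -> 3 / 2 <= s -> s ^+ 2 <= r ^+ 2 + 15 ^+ 2 ->
  ((n s `^ Q)%:E <= (C * expR (- (b * (r ^+ 2 - s ^+ 2))))%:E * gauss_mean b Q n r)%E.
Proof.
move=> K0 Q0 b0; have [C C0 HC] := radial_submean_powR K0 Q0.
exists (4 * expR (2 * b) * C); first by rewrite !mulr_gt0 ?expR_gt0.
move=> n r s gn s1 sr; have [mn n0 _ _] := gn.
have s0 : 0 < s by lra.
have [d dE] : exists d, d = (2 * s)^-1 by exists (2 * s)^-1.
have d0 : 0 < d by rewrite dE invr_gt0 mulr_gt0.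
have ds : d * s = 1 / 2 by rewrite dE; field; rewrite gt_eqF.
have d3 : d <= 1 / 3 by nra.
have d1 : d ^+ 2 <= 1 by nra.
have E : (s + d) ^+ 2 = s ^+ 2 + 1 + d ^+ 2.
  have H : (s + d) ^+ 2 = s ^+ 2 + 2 * (d * s) + d ^+ 2 by ring.
  by rewrite H ds mulrCA mul1r mulfV// pnatr_eq0.
have Ele : (s + d) ^+ 2 <= 2 + s ^+ 2 by rewrite E; lra.
have := HC n s d gn d0 ltac:(lra); rewrite /gauss_mean.
have mnQ : measurable_fun setT ((fun t => (n t `^ Q)%:E) : rT -> \bar R).
  by apply/measurable_EFinP; exact: (measurableT_comp (@measurable_powR R Q)).
pose G t := gauss_ker b r t * t * n t `^ Q.
have mG : measurable_fun setT ((fun t => (G t)%:E) : rT -> \bar R).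
  apply/measurable_EFinP; apply: measurable_funM; last exact/measurable_EFinP.
  by apply: continuous_measurable_fun; exact: continuous_gauss_kerM.
have G0 t : 0 <= t -> 0 <= G t by move=> t0; rewrite !mulr_ge0 ?gauss_ker_ge0 ?powR_ge0.
set c := 2 / s * expR (2 * b) * expR (- (b * (r ^+ 2 - s ^+ 2))).
have c0 : 0 <= c by rewrite !mulr_ge0 ?expR_ge0// ?invr_ge0; lra.
have I1 : (\int[mu]_(t in `[(s - d)%R, (s + d)%R]) (n t `^ Q)%:E <=
    c%:E * \int[mu]_(t in `[1%R, outer_radius (16 ^+ 2) r]) (G t)%:E)%E.
  apply: (@le_trans _ _ (c%:E * \int[mu]_(t in `[(s - d)%R, (s + d)%R]) (G t)%:E)%E).
    rewrite -ge0_integralZl_EFin//; last 2 first.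
    - by move=> t; rewrite /= in_itv /= => /andP[t1 _]; rewrite lee_fin G0//; lra.
    - exact: measurable_funTS.
    apply: ge0_le_integral.
    - exact: measurable_itv.
    - by move=> t _; rewrite lee_fin powR_ge0.
    - exact: measurable_funTS.
    - by apply: measurable_funTS; apply: emeasurable_funM => //; exact: measurable_cst.
    move=> t; rewrite /= in_itv /= => /andP[t1 t2].
    rewrite -EFinM lee_fin /G mulrA ler_peMl ?powR_ge0//.
    have -> : c * (gauss_ker b r t * t) = 2 * t / s * expR (b * (2 + s ^+ 2 - t ^+ 2)).
      rewrite /c /gauss_ker.
      have -> : b * (2 + s ^+ 2 - t ^+ 2) = 2 * b + - (b * (r ^+ 2 - s ^+ 2)) + b * (r ^+ 2 - t ^+ 2) by ring.
      by rewrite !expRD; ring.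
    rewrite -[leLHS]mulr1; apply: ler_pM => //.
      by rewrite ler_pdivlMr//; lra.
    rewrite -[leLHS]expR0 ler_expR mulr_ge0//.
    have : t ^+ 2 <= (s + d) ^+ 2 by apply: lerXn2r => //; rewrite nnegrE; lra.
    by move=> t3; rewrite subr_ge0; exact: le_trans t3 Ele.
  apply: lee_wpmul2l; first by rewrite lee_fin.
  apply: ge0_subset_integral.
  - exact: measurable_itv.
  - exact: measurable_itv.
  - exact: measurable_funTS.
  - by move=> t; rewrite /= in_itv /= => /andP[t1 _]; rewrite lee_fin G0//; lra.
  - apply: subset_itv; rewrite bnd_simp; first by lra.
    rewrite /outer_radius -(ger0_norm (_ : 0 <= s + d)); last by lra.
    rewrite -sqrtr_sqr ler_wsqrtr//; apply: le_trans Ele _; lra.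
move=> H; have {}H := le_trans H (lee_wpmul2l (ltac:(by rewrite lee_fin ltW) : (0 <= C%:E)%E) I1).
have di : (0 <= (d^-1)%:E)%E by rewrite lee_fin invr_ge0 ltW.
have := lee_wpmul2l di H; rewrite -EFinM mulrA mulVf ?gt_eqF// mul1r !muleA -!EFinM.
rewrite (_ : d^-1 * C * c = 4 * expR (2 * b) * C * expR (- (b * (r ^+ 2 - s ^+ 2))))//.
by rewrite dE /c; field; rewrite gt_eqF.
Qed.

End radial_profiles.

(** * Integral means *)

Section radial_majorant.
Variable R : realType.
Local Notation mu := (@lebesgue_measure R).
Local Notation rT := (measurableTypeR R).
Implicit Types (f h : R[i] -> R[i]).

(** From a mean of n to a mean of n^Q, where Jensen's inequality would be limited to Q >= 1. The
    pointwise bound gives n(t) <= m exp(- 2 a (r^2 - t^2)) with a = b/(2 Q), so the kernel of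
    exponent [a] leaves exp(- a (r^2 - t^2)), whose integral is bounded uniformly in [r]. *)
Lemma gauss_mean_of_integral (K Q b C1 : R) : 0 < K -> 0 < Q -> 0 < b -> 0 < C1 ->
  exists2 C, 0 < C & forall n r x, radial_submean K n -> 0 <= x ->
  (x%:E <= C1%:E * \int[mu]_(t in `[(3 / 2)%R, outer_radius (15 ^+ 2) r])
     (gauss_ker (b / (2 * Q)) r t * t * n t)%:E)%E ->
  ((x `^ Q)%:E <= C%:E * gauss_mean b Q n r)%E.
Proof.
move=> K0 Q0 b0 C10.
have [C C0 HC] := radial_submean_gauss K0 Q0 (ltW b0).
pose a := b / (2 * Q); have a0 : 0 < a by rewrite divr_gt0// mulr_gt0.
pose c2 := expR (a * 15 ^+ 2) / (2 * a).
have c20 : 0 < c2 by rewrite divr_gt0 ?expR_gt0// mulr_gt0.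
have Cc0 : 0 < C1 * c2 by rewrite mulr_gt0.
exists ((C1 * c2) `^ Q * C); first by rewrite mulr_gt0// powR_gt0.
move=> n r x gn x0 Hx; have [mn n0 _ _] := gn.
have A0 := gauss_mean_ge0 b Q n r.
set A := gauss_mean b Q n r in A0 *.
have [->|Ay] := eqVneq A +oo%E.
  by rewrite gt0_muley ?leey// lte_fin mulr_gt0// powR_gt0.
have AE : A = (fine A)%:E by rewrite fineK// ge0_fin_numE// lt_neqAle Ay leey.
set y := fine A in AE; have y0 : 0 <= y by rewrite -lee_fin -AE.
have Cy : 0 <= C * y by rewrite mulr_ge0// ltW.
pose m := (C * y) `^ Q^-1; have m0 : 0 <= m by exact: powR_ge0.
suff xm : x <= C1 * c2 * m.
  rewrite AE -EFinM lee_fin -mulrA.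
  have -> : (C1 * c2) `^ Q * (C * y) = (C1 * c2 * m) `^ Q.
    rewrite [RHS]powRM// ?(ltW Cc0)//.
    by rewrite /m -powRrM mulVf ?gt_eqF// powRr1.
  by apply: ge0_ler_powR; rewrite ?nnegrE ?(ltW Q0)// mulr_ge0// ltW.
rewrite -lee_fin; apply: le_trans Hx _; rewrite -mulrA EFinM.
apply: lee_wpmul2l; first by rewrite lee_fin ltW.
pose g (t : R) := expR (- (a * (r ^+ 2 - t ^+ 2))) * t.
have mg : measurable_fun setT ((fun t => (g t)%:E) : rT -> \bar R).
  apply/measurable_EFinP; apply: continuous_measurable_fun => t.
  apply: cvgM; last exact: cvg_id.
  apply: (@continuous_expR_comp R (fun t => - (a * (r ^+ 2 - t ^+ 2)))) => {}t.
  apply: cvgN; apply: cvgM; [exact: cvg_cst|].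
  by apply: cvgB; [exact: cvg_cst|exact: exprn_continuous].
have g0 t : 0 <= t -> 0 <= g t by move=> t0; rewrite mulr_ge0// expR_ge0.
have I1 : (\int[mu]_(t in `[(3 / 2)%R, outer_radius (15 ^+ 2) r]) (g t)%:E <= c2%:E)%E.
  by apply: (@integral_gauss_ker_le R a (15 ^+ 2) (3 / 2) r a0); rewrite ?exprn_ge0//; lra.
apply: (@le_trans _ _ (m%:E * \int[mu]_(t in `[(3 / 2)%R, outer_radius (15 ^+ 2) r]) (g t)%:E)%E); last first.
  by rewrite (mulrC c2) EFinM; apply: lee_wpmul2l; rewrite ?lee_fin.
rewrite -ge0_integralZl_EFin//; last 2 first.
- by move=> t; rewrite /= in_itv /= => /andP[t1 _]; rewrite lee_fin g0//; lra.
- exact: measurable_funTS.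
apply: ge0_le_integral.
- exact: measurable_itv.
- move=> t; rewrite /= in_itv /= => /andP[t1 _]; rewrite lee_fin.
  by rewrite !mulr_ge0 ?gauss_ker_ge0//; lra.
- apply/measurable_EFinP; apply: measurable_funM; last exact: measurable_funTS.
  by apply: measurable_funTS; apply: continuous_measurable_fun; exact: continuous_gauss_kerM.
- by apply: measurable_funTS; apply: emeasurable_funM => //; exact: measurable_cst.
move=> t; rewrite /= in_itv /= => /andP[t1 t2]; rewrite -EFinM lee_fin.
have t0 : 0 <= t by lra.
have tr : t ^+ 2 <= r ^+ 2 + 15 ^+ 2.
  have := t2; rewrite /outer_radius -{1}(ger0_norm t0) -sqrtr_sqr ler_sqrt//.
  by rewrite addr_ge0 ?sqr_ge0 ?exprn_ge0.
have := HC n r t gn t1 tr; rewrite -/A AE -EFinM lee_fin => Hn.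
have nt : n t <= m * expR (- (2 * a * (r ^+ 2 - t ^+ 2))).
  have Qi : 0 <= Q^-1 by rewrite invr_ge0 ltW.
  have := ge0_ler_powR Qi (powR_ge0 _ _ : _ \in Num.nneg) _ Hn.
  rewrite -powRrM mulfV ?gt_eqF// powRr1// => /(_ _)/le_trans; apply.
    by rewrite nnegrE !mulr_ge0 ?expR_ge0// ltW.
  rewrite mulrAC powRM ?expR_ge0//.
  rewrite -/m -expRM ler_wpM2l// ler_expR /a.
  by rewrite le_eqVlt; apply/orP; left; apply/eqP; field; rewrite gt_eqF.
rewrite mulrAC (mulrC (gauss_ker _ _ _)) (mulrA m).
rewrite /g; apply: ler_wpM2r => //.
apply: le_trans (ler_wpM2r (gauss_ker_ge0 _ _ _) nt) _.
rewrite /gauss_ker -(mulrA m) -expRD ler_wpM2l// ler_expR -/a.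
by rewrite le_eqVlt; apply/orP; left; apply/eqP; ring.
Qed.

End radial_majorant.

(** All that the norm estimates retain of the Hausdorff operator. The 2 comes from bounding real and
    imaginary parts separately. *)
Definition radially_dominated (R : realType) (h f : R[i] -> R[i]) := forall r th M, 0 <= r ->
  (forall s, 0 <= s -> s <= r -> cabs (f (polar s th)) <= M) -> cabs (h (polar r th)) <= 2 * M.

Section finite_exponent.
Variable R : realType.
Local Notation mu := (@lebesgue_measure R).
Local Notation rT := (measurableTypeR R).
Implicit Types (f h : R[i] -> R[i]).
Variables (k : R) (k0 : 0 < k).

Lemma nint_radial_submean : exists2 K, 0 < K & forall f, cholomorphic f -> radial_submean K (nint k f).
Proof.
have [K K0 HK] := @nint_submean R k k0.
exists K => // f hf; have cf z := cholomorphic_ccontinuous z hf; split.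
- exact: measurable_nint.
- by move=> s; exact: nint_ge0.
- by move=> r; have [M _ HM] := nint_bounded k0 r cf; exists M.
- by move=> s d; exact: HK.
Qed.

Lemma measurable_local_majorant f a r : (forall z, ccontinuous f z) ->
  measurable_fun setT (local_majorant k f a r : rT -> \bar R).
Proof.
move=> cf; pose I := `[3 / 2, outer_radius (15 ^+ 2) r]%classic : set rT.
have mI : measurable I by exact: measurable_itv.
(* The absolute value changes nothing on the domain of integration and makes the integrand
   nonnegative everywhere. *)
pose X (p : rT * rT) : \bar R := ((gauss_ker a r p.2 * `|p.2| ^+ 3)%:E * window_integral k f (p.2, p.1))%E.
have mX : measurable_fun setT X.
  apply: emeasurable_funM; last first.
    exact: measurableT_comp (measurable_window_integral k0 cf) (@measurable_swap _ _ _ _).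
  have mg : measurable_fun setT ((fun t => gauss_ker a r t * `|t| ^+ 3) : rT -> R).
    apply: continuous_measurable_fun => t; apply: cvgM; first exact: continuous_gauss_ker.
    apply: (@continuous_comp _ _ _ (fun x : R => `|x|) (fun x : R => x ^+ 3)); first exact: norm_continuous.
    exact: exprn_continuous.
  by apply/measurable_EFinP; exact: (measurableT_comp mg measurable_snd).
have X0 p : (0 <= X p)%E.
  by rewrite mule_ge0 ?window_integral_ge0// lee_fin mulr_ge0 ?gauss_ker_ge0// exprn_ge0.
apply: eq_measurable_fun (measurable_integral1 mu mI mX X0) => th _.
apply: eq_integral => t; rewrite inE /I /= in_itv /= => /andP[t1 _].
by rewrite /X /= ger0_norm//; lra.
Qed.

(** For a fixed direction, [local_majorant_ge] bounds |f|^k at all radii up to [r] by the same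
    quantity, which therefore bounds |h|^k at [r]. Integrating in the direction turns the majorant
    into a mean of [nint]. *)
Lemma nint_dominated (a : R) : 0 <= a -> exists2 C, 0 < C & forall f h r,
  cholomorphic f -> (forall z, ccontinuous h z) -> radially_dominated h f -> 0 <= r ->
  ((nint k h r)%:E <= C%:E * \int[mu]_(t in `[(3 / 2)%R, outer_radius (15 ^+ 2) r])
     (gauss_ker a r t * t * nint k f t)%:E)%E.
Proof.
move=> a0; have [C C0 HC] := local_majorant_ge k0 a0.
pose C1 := 2 `^ k * C.
have C10 : 0 < C1 by rewrite mulr_gt0// powR_gt0.
exists (C1 * (2 * window_const R)); first by rewrite !mulr_gt0// window_const_gt0.
move=> f h r hf ch hd r0; have cf z := cholomorphic_ccontinuous z hf.
rewrite EFinM -muleA -(local_majorant_angle k0 a r cf) (nintE k0 r ch).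
have mD := measurable_local_majorant a r cf.
rewrite -ge0_integralZl_EFin; last 4 first.
- exact: measurable_itv.
- by move=> th _; exact: local_majorant_ge0.
- exact: measurable_funTS.
- exact: ltW.
apply: ge0_le_integral.
- exact: measurable_itv.
- by move=> th _; rewrite lee_fin powR_ge0.
- apply: measurable_funTS; have := @measurable_polar_angle R k k0 h r 0 ch.
  by apply: eq_measurable_fun => t _; rewrite add0r.
- by apply: measurable_funTS; apply: emeasurable_funM => //; exact: measurable_cst.
move=> th _.
have D0 := @local_majorant_ge0 R k f a r th.
set D := local_majorant k f a r th in D0 *.
have [->|Dy] := eqVneq D +oo%E; first by rewrite gt0_muley ?leey// lte_fin.
have DE : D = (fine D)%:E by rewrite fineK// ge0_fin_numE// lt_neqAle Dy leey.
set x := fine D in DE; have x0 : 0 <= x by rewrite -lee_fin -DE.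
have Cx : 0 <= C * x by rewrite mulr_ge0// ltW.
have fM s : 0 <= s -> s <= r -> cabs (f (polar s th)) <= (C * x) `^ k^-1.
  move=> s0 sr; have := HC f r s th hf s0 sr; rewrite -/D DE -EFinM lee_fin => fz.
  have := @ge0_ler_powR R k^-1 _ _ _ _ _ fz; rewrite -powRrM mulfV ?gt_eqF// powRr1 ?cabs_ge0//.
  by apply; rewrite ?invr_ge0 ?(ltW k0)// nnegrE// powR_ge0.
rewrite DE -EFinM lee_fin /C1 -mulrA.
have -> : 2 `^ k * (C * x) = (2 * (C * x) `^ k^-1) `^ k.
  by rewrite powRM ?powR_ge0// -powRrM mulVf ?gt_eqF// powRr1.
apply: ge0_ler_powR; rewrite ?nnegrE ?(ltW k0) ?cabs_ge0 ?mulr_ge0 ?powR_ge0//.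
exact: hd.
Qed.

Lemma nint_powR_dominated (Q b : R) : 0 < Q -> 0 < b -> exists2 C, 0 < C & forall f h r,
  cholomorphic f -> (forall z, ccontinuous h z) -> radially_dominated h f -> 0 <= r ->
  ((nint k h r `^ Q)%:E <= C%:E * gauss_mean b Q (nint k f) r)%E.
Proof.
move=> Q0 b0; have [K K0 HK] := nint_radial_submean.
have a0 : 0 <= b / (2 * Q) by rewrite ltW// divr_gt0// mulr_gt0.
have [C1 C10 HC1] := nint_dominated a0.
have [C C0 HC] := gauss_mean_of_integral K0 Q0 b0 C10.
exists C => // f h r hf ch hd r0; apply: HC; [exact: HK|exact: nint_ge0|exact: HC1].
Qed.

End finite_exponent.

Section infinite_exponent.
Variable R : realType.
Local Notation mu := (@lebesgue_measure R).
Local Notation rT := (measurableTypeR R).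
Implicit Types (f h : R[i] -> R[i]).

Definition nsup f (s : R) : R := sup (range (fun t : R => cabs (f (polar s t)))).

Lemma nsup_ub f s t : (forall z, ccontinuous f z) -> cabs (f (polar s t)) <= nsup f s.
Proof.
move=> cf; have [M _ HM] := ccontinuous_bounded `|s| cf.
apply: ub_le_sup; last by exists t.
by exists M => _ [u _ <-]; apply: HM; rewrite cabs_polar.
Qed.

Lemma nsup_le f s M : (forall t, cabs (f (polar s t)) <= M) -> nsup f s <= M.
Proof. by move=> H; apply: ge_sup => [|_ [u _ <-]//]; exists (cabs (f (polar s 0))), 0. Qed.

Lemma nsup_ge0 f s : (forall z, ccontinuous f z) -> 0 <= nsup f s.
Proof. by move=> cf; apply: le_trans (nsup_ub s 0 cf); exact: cabs_ge0. Qed.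

Lemma nsup_lipschitz f r : cholomorphic f -> exists2 L, 0 <= L &
  forall s s', `|s| <= r -> `|s'| <= r -> `|nsup f s - nsup f s'| <= L * `|s - s'|.
Proof.
move=> hf; have cf z := cholomorphic_ccontinuous z hf.
have [L L0 HL] := cholomorphic_lipschitz r hf.
exists L => // s s' sr sr'.
have H u v : `|u| <= r -> `|v| <= r -> nsup f u <= nsup f v + L * `|u - v|.
  move=> ur vr; apply: nsup_le => t.
  have E : polar u t - polar v t = polar (u - v) t.
    by apply/eqP; rewrite eq_complex /=; apply/andP; split; apply/eqP; ring.
  have := HL (polar v t) (polar u t); rewrite !cabs_polar => /(_ vr ur); rewrite E cabs_polar => H1.
  have := cabsD (f (polar u t) - f (polar v t)) (f (polar v t)); rewrite subrK.
  by have := nsup_ub v t cf; lra.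
rewrite ler_norml; apply/andP; split.
  by have := H _ _ sr' sr; rewrite distrC; lra.
by have := H _ _ sr sr'; lra.
Qed.

Lemma continuous_nsup f : cholomorphic f -> continuous (nsup f).
Proof.
move=> hf s; have [L L0 HL] := nsup_lipschitz (`|s| + 1) hf.
apply/cvgrPdist_le => e e0.
have eL : 0 < e / (L + 1) by rewrite divr_gt0//; lra.
near=> s'.
have d1 : `|s - s'| <= 1.
  by near: s'; apply/nbhs_ballP; exists 1 => //= x /ltW.
have d2 : `|s - s'| <= e / (L + 1).
  by near: s'; apply/nbhs_ballP; exists (e / (L + 1)) => //= x /ltW.
apply: le_trans (HL s s' _ _) _; first by lra.
  have := ler_normD (s' - s) s; rewrite subrK distrC; lra.
have : (L + 1) * `|s - s'| <= e by rewrite mulrC -ler_pdivlMr//; lra.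
have := normr_ge0 (s - s'); nra.
Unshelve. all: by end_near.
Qed.

(** The planar inequality with k = 1, in which |f| is replaced by its supremum on each circle before
    integrating in the angle; the result no longer depends on [t], so the supremum can be taken on
    the left. *)
Lemma nsup_radial_submean : exists2 K, 0 < K & forall f, cholomorphic f -> radial_submean K (nsup f).
Proof.
have [K K0 HK] := @polar_submean_shift R 1 ltr01.
exists (2 * K); first by rewrite mulr_gt0.
move=> f hf; have cf z := cholomorphic_ccontinuous z hf.
have mn : measurable_fun setT (nsup f : rT -> R).
  by apply: continuous_measurable_fun; exact: continuous_nsup.
have n0 s := nsup_ge0 s cf.
split=> // [r|s d d0 ds].
  have [M _ HM] := ccontinuous_bounded r cf; exists M => s sr.
  by apply: nsup_le => t; apply: HM; rewrite cabs_polar.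
have s0 : 0 < s by lra.
set I := (\int[mu]_(t in _) _)%E.
have I0 : (0 <= I)%E by apply: integral_ge0 => t _; rewrite lee_fin.
have K20 : 0 < 2 * K by rewrite mulr_gt0.
have [->|Iy] := eqVneq I +oo%E; first by rewrite gt0_muley ?leey// lte_fin.
have IE : I = (fine I)%:E by rewrite fineK// ge0_fin_numE// lt_neqAle Iy leey.
rewrite IE -EFinM lee_fin [leLHS]mulrC -ler_pdivlMr//; apply: nsup_le => t.
rewrite ler_pdivlMr// [leLHS]mulrC -(ler_pM2l d0) -lee_fin (mulrA d d) -(expr2 d).
have := HK f s t 0 d hf d0 ds; rewrite powRr1 ?cabs_ge0// => /le_trans; apply.
have mI (a b : R) : measurable (`[a, b]%classic : set rT) by exact: measurable_itv.
have ds0 : 0 < d / s by rewrite divr_gt0.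
apply: (@le_trans _ _ ((K * s)%:E * ((2 * d / s)%:E * I))%E); last first.
  by rewrite IE -!EFinM lee_fin le_eqVlt; apply/orP; left; apply/eqP; field; rewrite gt_eqF.
apply: lee_wpmul2l; first by rewrite lee_fin mulr_ge0// ltW.
rewrite -ge0_integralZl_EFin//; last 3 first.
- by move=> u _; rewrite lee_fin.
- by apply: measurable_funTS; exact/measurable_EFinP.
- by rewrite divr_ge0 ?mulr_ge0// ltW.
pose G (p : rT * rT) : \bar R := (cabs (f (polar p.1 (p.2 + 0))) `^ 1)%:E.
have mG : measurable_fun setT G.
  apply: eq_measurable_fun (measurable_cabs_polar_powR ltr01 cf) => p _.
  by rewrite /G addr0.
apply: ge0_le_integral => //.
- by move=> u _; apply: integral_ge0 => v _; rewrite lee_fin powR_ge0.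
- apply: measurable_funTS.
  by apply: (measurable_integral1 mu (mI (t - 0 - d / s) (t - 0 + d / s)) mG) => p; rewrite lee_fin powR_ge0.
- apply: measurable_funTS; apply: emeasurable_funM; first exact: measurable_cst.
  exact/measurable_EFinP.
move=> u _.
apply: (@le_trans _ _ (\int[mu]_(v in `[(t - 0 - d / s)%R, (t - 0 + d / s)%R]) (nsup f u)%:E)%E).
  apply: ge0_le_integral => //.
  - by move=> v _; rewrite lee_fin powR_ge0.
  - by apply: measurable_funTS; exact: (measurableT_comp mG (pair1_measurable u)).
  - by move=> v _; rewrite lee_fin powRr1 ?cabs_ge0//; exact: nsup_ub.
rewrite integral_cst//= lebesgue_measure_itv /= lte_fin ifT; last by lra.
rewrite -EFinB -!EFinM lee_fin mulrC ler_wpM2r// le_eqVlt; apply/orP; left; apply/eqP; ring.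
Qed.

Lemma nsup_powR_dominated (Q b : R) : 0 < Q -> 0 < b -> exists2 C, 0 < C & forall f h r,
  cholomorphic f -> (forall z, ccontinuous h z) -> radially_dominated h f -> 0 <= r ->
  ((nsup h r `^ Q)%:E <= C%:E * gauss_mean b Q (nsup f) r)%E.
Proof.
move=> Q0 b0; have [K K0 HK] := nsup_radial_submean.
have [C C0 HC] := radial_submean_gauss K0 Q0 (ltW b0).
pose C1 := C * expR (b * 15 ^+ 2).
have C10 : 0 < C1 by rewrite mulr_gt0// expR_gt0.
exists (4 `^ Q * C1); first by rewrite mulr_gt0// powR_gt0.
move=> f h r hf ch hd r0; have cf z := cholomorphic_ccontinuous z hf.
have A0 := gauss_mean_ge0 b Q (nsup f) r.
set A := gauss_mean b Q (nsup f) r in A0 *.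
have [->|Ay] := eqVneq A +oo%E.
  by rewrite gt0_muley ?leey// lte_fin mulr_gt0// powR_gt0.
have AE : A = (fine A)%:E by rewrite fineK// ge0_fin_numE// lt_neqAle Ay leey.
set y := fine A in AE; have y0 : 0 <= y by rewrite -lee_fin -AE.
have Cy : 0 <= C1 * y by rewrite mulr_ge0// ltW.
pose m := (C1 * y) `^ Q^-1; have m0 : 0 <= m by exact: powR_ge0.
have nm s : 3 / 2 <= s -> s ^+ 2 <= r ^+ 2 + 15 ^+ 2 -> nsup f s <= m.
  move=> s1 sr; have := HC (nsup f) r s (HK f hf) s1 sr; rewrite -/A AE -EFinM lee_fin => H.
  have {}H : nsup f s `^ Q <= C1 * y.
    apply: le_trans H _; rewrite ler_wpM2r// /C1 ler_pM2l// ler_expR -mulrN ler_pM2l//; lra.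
  have := @ge0_ler_powR R Q^-1 _ _ _ _ _ H; rewrite -powRrM mulfV ?gt_eqF// powRr1 ?nsup_ge0//.
  by apply; rewrite ?invr_ge0 ?(ltW Q0)// nnegrE// powR_ge0.
have fm s th : 0 <= s -> s <= r -> cabs (f (polar s th)) <= 2 * m.
  move=> s0 sr; have [s2|s2] := leP 2 s.
    apply: le_trans (nsup_ub s th cf) _; apply: (@le_trans _ _ m); last by lra.
    apply: nm; first by lra.
    by apply: (@le_trans _ _ (r ^+ 2)); [apply: lerXn2r|rewrite lerDl exprn_ge0].
  rewrite /polar; apply: (@cabs_le_square_sup R f _ _ 6) => //.
  move=> z; rewrite -/(polar s th) => /andP[z6 z12].
  have pc : cabs (polar s th) = s by rewrite cabs_polar ger0_norm.
  have z4 : 4 <= cabs z by have := cabsB z (polar s th); lra.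
  have z14 : cabs z <= 14.
    have := cabsD (z - polar s th) (polar s th); rewrite subrK; lra.
  have [t _ zE] := polar_arg z 0.
  rewrite zE; apply: le_trans (nsup_ub _ _ cf) _; apply: nm; first by lra.
  have := sqr_ge0 r; nra.
have hm : nsup h r <= 4 * m.
  apply: nsup_le => t; have -> : 4 * m = 2 * (2 * m) by ring.
  by apply: hd => // s s0 sr; exact: fm.
rewrite AE -EFinM lee_fin -mulrA.
have -> : 4 `^ Q * (C1 * y) = (4 * m) `^ Q.
  by rewrite [RHS]powRM// /m -powRrM mulVf ?gt_eqF// powRr1.
by apply: ge0_ler_powR; rewrite ?nnegrE ?(ltW Q0) ?nsup_ge0 ?mulr_ge0.
Qed.

End infinite_exponent.

(** * From circular means to mixed norms *)

Section norms.
Variable R : realType.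
Local Notation mu := (@lebesgue_measure R).
Local Notation rT := (measurableTypeR R).
Implicit Types (f h : R[i] -> R[i]) (p q : \bar R).

(** Real-valued form of [Mp], which is finite for continuous f; powers and measurability are then
    handled in [R]. *)
Definition rmean p f (r : R) : R :=
  if p is EFin k then ((2 * pi)^-1 * nint k f r) `^ k^-1 else nsup f r.

Let twopi : 0 < 2 * pi :> R. Proof. by rewrite mulr_gt0// pi_gt0. Qed.

Lemma rmean_ge0 p f r : (0 < p)%E -> (forall z, ccontinuous f z) -> 0 <= rmean p f r.
Proof. by case: p => [k| |] // p0 cf; [exact: powR_ge0|exact: nsup_ge0]. Qed.

Lemma measurable_rmean p f : (0 < p)%E -> cholomorphic f -> measurable_fun setT (rmean p f : rT -> R).
Proof.
move=> p0 hf; have cf z := cholomorphic_ccontinuous z hf.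
case: p p0 => [k| |] //; rewrite ?lte_fin => k0; last first.
  by apply: continuous_measurable_fun; exact: continuous_nsup.
apply: (measurableT_comp (@measurable_powR R k^-1)).
by apply: measurable_funM; [exact: measurable_cst|exact: measurable_nint].
Qed.

Lemma Mp_rmean p f (r : R) : (0 < p)%E -> (forall z, ccontinuous f z) -> 0 <= r ->
  Mp p f r = (rmean p f r)%:E.
Proof.
move=> p0 cf r0; case: p p0 => [k| |] //; rewrite ?lte_fin => k0 /=.
  by rewrite -(nintE k0 r cf) -EFinM poweR_EFin.
rewrite /nsup -ereal_sup_EFin; last 2 first.
- have [M _ HM] := ccontinuous_bounded `|r| cf.
  by exists M => _ [u _ <-]; apply: HM; rewrite cabs_polar.
- by exists (cabs (f (polar r 0))), 0.
congr ereal_sup; apply/seteqP; split => x /=.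
  move=> [z zr <-]; have [t _ zE] := polar_arg z 0.
  by exists (cabs (f z)) => //; exists t => //; rewrite -zr -zE.
move=> [_ [t _ <-] <-]; exists (polar r t) => //=.
by rewrite cabs_polar ger0_norm.
Qed.

Lemma rmean_powR_dominated p (Q b : R) : (0 < p)%E -> 0 < Q -> 0 < b -> exists2 C, 0 < C & forall f h r,
  cholomorphic f -> (forall z, ccontinuous h z) -> radially_dominated h f -> 0 <= r ->
  ((rmean p h r `^ Q)%:E <= C%:E * gauss_mean b Q (rmean p f) r)%E.
Proof.
move=> p0 Q0 b0; case: p p0 => [k| |] //; rewrite ?lte_fin => k0; last first.
  exact: nsup_powR_dominated.
(* M_k^Q is a constant times [nint] to the power Q / k, which may be any positive number. Hence the
   need for arbitrary powers in the radial estimates. *)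
have Qk : 0 < k^-1 * Q by rewrite mulr_gt0// invr_gt0.
have [C C0 HC] := nint_powR_dominated k0 Qk b0.
exists C; first exact: C0.
move=> f h r hf ch hd r0; have cf z := cholomorphic_ccontinuous z hf.
pose c : R := (2 * pi)^-1 `^ (k^-1 * Q).
have c0 : 0 < c by rewrite powR_gt0// invr_gt0.
have E g s : rmean k%:E g s `^ Q = c * nint k g s `^ (k^-1 * Q).
  by rewrite /rmean -powRrM powRM ?nint_ge0// invr_ge0 ltW.
rewrite E (_ : gauss_mean b Q (rmean k%:E f) r = c%:E * gauss_mean b (k^-1 * Q) (nint k f) r)%E.
  rewrite muleCA EFinM; apply: lee_wpmul2l; first by rewrite lee_fin ltW.
  exact: HC.
rewrite /gauss_mean -ge0_integralZl_EFin; last 4 first.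
- exact: measurable_itv.
- move=> t /=; rewrite in_itv /= => /andP[t1 _].
  by rewrite lee_fin !mulr_ge0 ?gauss_ker_ge0 ?powR_ge0//; lra.
- apply/measurable_EFinP; apply: measurable_funTS; apply: measurable_funM.
    by apply: continuous_measurable_fun; exact: continuous_gauss_kerM.
  by apply: (measurableT_comp (@measurable_powR R _)); exact: measurable_nint.
- exact: ltW.
by apply: eq_integral => t _; rewrite E -EFinM mulrCA.
Qed.

(** The weight has twice the exponent of the kernel, so their product exp(- b r^2) exp(- b t^2) is
    symmetric. Integrating first over r^2 >= t^2 - 16^2 gives a Gaussian tail, which restores the
    weight exp(- 2 b t^2) up to a constant. *)
Lemma gauss_mean_tonelli (b C : R) (N M : R -> R) : 0 < b -> 0 < C ->
  measurable_fun setT (N : rT -> R) -> measurable_fun setT (M : rT -> R) ->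
  (forall t, 0 <= N t) -> (forall t, 0 <= M t) ->
  (forall r, 0 <= r -> ((M r)%:E <= C%:E *
     \int[mu]_(t in `[1%R, outer_radius (16 ^+ 2) r]) (gauss_ker b r t * t * N t)%:E)%E) ->
  (\int[mu]_(r in `[0%R, +oo[) (M r * (expR (- (2 * b) * r ^+ 2) * r))%:E <=
   (C * (expR (b * 16 ^+ 2) / (2 * b)))%:E *
     \int[mu]_(r in `[0%R, +oo[) (N r * (expR (- (2 * b) * r ^+ 2) * r))%:E)%E.
Proof.
move=> b0 C0 mN mM N0 M0 HM.
pose W : set (rT * rT) := [set z | z.2 ^+ 2 <= z.1 ^+ 2 + 16 ^+ 2].
have mW : measurable W.
  pose g (z : rT * rT) : rT := z.2 ^+ 2 - z.1 ^+ 2.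
  have mg : measurable_fun setT g.
    apply: (@continuous_measurable_prod R (fun z => z.2 ^+ 2 - z.1 ^+ 2)) => z.
    apply: cvgB; apply: (@continuous_comp _ _ _ _ (fun x : R => x ^+ 2)).
    - exact: cvg_snd.
    - exact: exprn_continuous.
    - exact: cvg_fst.
    - exact: exprn_continuous.
  rewrite (_ : W = g @^-1` `]-oo, 16 ^+ 2]%classic); last first.
    by apply/seteqP; split => z; rewrite /W /g /= in_itv /= lerBlDl.
  by rewrite -[X in measurable X]setTI; apply: mg => //; exact: measurable_itv.
pose e (r : R) := expR (- b * r ^+ 2).
have ce : continuous e.
  apply: (@continuous_expR_comp R (fun r => - b * r ^+ 2)) => r.
  by apply: cvgM; [exact: cvg_cst|exact: exprn_continuous].
have me : measurable_fun setT (e : rT -> R) by exact: continuous_measurable_fun.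
have e0 r : 0 <= e r by exact: expR_ge0.
have e2 r : expR (- (2 * b) * r ^+ 2) = e r * e r by rewrite /e -expRD; congr expR; ring.
have mnorm : measurable_fun setT ((fun r : R => `|r|) : rT -> R).
  by apply: continuous_measurable_fun; exact: norm_continuous.
(* The absolute values only serve to have a nonnegative integrand on the whole plane. *)
pose X (z : rT * rT) : \bar R := (\1_W z * (e z.1 * `|z.1|) * (e z.2 * `|z.2| * N z.2))%:E.
have X0 z : (0 <= X z)%E.
  by rewrite lee_fin !mulr_ge0// ?indicE.
have mX : measurable_fun setT X.
  have m1 : measurable_fun setT ((fun r => e r * `|r|) : rT -> R) by exact: measurable_funM.
  have m2 : measurable_fun setT ((fun r => e r * `|r| * N r) : rT -> R) by exact: measurable_funM.
  apply/measurable_EFinP; apply: measurable_funM; first apply: measurable_funM.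
  - exact: measurable_indic.
  - exact: (measurableT_comp m1 measurable_fst).
  - exact: (measurableT_comp m2 measurable_snd).
pose A := `[0%R, +oo[%classic : set rT.
pose B := `[1%R, +oo[%classic : set rT.
have mA : measurable A by exact: measurable_itv.
have mB : measurable B by exact: measurable_itv.
have [E1 E2] := integral_rect mu mu mA mB mX X0.
have mXA := measurable_integral1 mu mB mX X0.
apply: (@le_trans _ _ (C%:E * \int[mu]_(r in A) \int[mu]_(t in B) X (r, t))%E).
  rewrite -ge0_integralZl_EFin//; last 3 first.
  - by move=> r _; apply: integral_ge0 => t _; exact: X0.
  - exact: measurable_funTS.
  - exact: ltW.
  have mK : measurable_fun setT ((fun r => M r * (expR (- (2 * b) * r ^+ 2) * r)) : rT -> R).
    apply: measurable_funM => //; apply: measurable_funM; last exact: measurable_id.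
    rewrite (_ : (fun r : R => _) = fun r => e r * e r); last by apply/funext => r; exact: e2.
    exact: measurable_funM.
  apply: ge0_le_integral => //.
  - move=> r; rewrite /A /= in_itv /= andbT => r0.
    by rewrite lee_fin !mulr_ge0 ?expR_ge0.
  - by apply: measurable_funTS; exact/measurable_EFinP.
  - by apply: measurable_funTS; apply: emeasurable_funM => //; exact: measurable_cst.
  move=> r; rewrite /A /= in_itv /= andbT => r0.
  have er0 : 0 <= e r * e r * r by rewrite !mulr_ge0.
  have := lee_wpmul2l (ltac:(by rewrite lee_fin) : (0 <= (e r * e r * r)%:E)%E) (HM r r0).
  rewrite -EFinM e2 mulrC => /le_trans; apply.
  rewrite muleCA; apply: lee_wpmul2l; first by rewrite lee_fin ltW.
  pose I := `[1%R, outer_radius (16 ^+ 2) r]%classic : set rT.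
  have mI : measurable I by exact: measurable_itv.
  have mG : measurable_fun setT ((fun t => (gauss_ker b r t * t * N t)%:E) : rT -> \bar R).
    apply/measurable_EFinP; apply: measurable_funM => //.
    by apply: continuous_measurable_fun; exact: continuous_gauss_kerM.
  rewrite -ge0_integralZl_EFin//; last 2 first.
  - move=> t /=; rewrite in_itv /= => /andP[t1 _].
    by rewrite lee_fin !mulr_ge0 ?gauss_ker_ge0//; lra.
  - exact: measurable_funTS.
  apply: (@le_trans _ _ (\int[mu]_(t in I) X (r, t))%E).
    rewrite le_eqVlt; apply/orP; left; apply/eqP; apply: eq_integral => t; rewrite inE /I /= in_itv /= => /andP[t1 t2].
    have t0 : 0 <= t by lra.
    have rt : W (r, t).
      have := t2; rewrite /outer_radius -{1}(ger0_norm t0) -sqrtr_sqr ler_sqrt//.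
      by rewrite addr_ge0 ?sqr_ge0 ?exprn_ge0.
    rewrite /X indicE mem_set// mul1r /= !ger0_norm// -EFinM; congr (_%:E).
    have -> : gauss_ker b r t = expR (b * r ^+ 2) * e t.
      by rewrite /gauss_ker /e -expRD; congr expR; ring.
    have E : e r * expR (b * r ^+ 2) = 1 by rewrite /e -expRD mulNr addNr expR0.
    have -> : e r * e r * r * (expR (b * r ^+ 2) * e t * t * N t) =
      (e r * expR (b * r ^+ 2)) * (e r * r * (e t * t * N t)) by ring.
    by rewrite E mul1r.
  apply: ge0_subset_integral => //.
  - by apply: measurable_funTS; exact: (measurableT_comp mX (pair1_measurable r)).
  - by apply: subset_itv; rewrite ?bnd_simp.
rewrite -E1 E2 (EFinM C) -muleA; apply: lee_wpmul2l; first by rewrite lee_fin ltW.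
pose c := expR (b * 16 ^+ 2) / (2 * b).
have c0 : 0 <= c by rewrite divr_ge0 ?expR_ge0// mulr_ge0// ltW.
have mNe : measurable_fun setT ((fun t => (N t * (expR (- (2 * b) * t ^+ 2) * t))%:E) : rT -> \bar R).
  apply/measurable_EFinP; apply: measurable_funM => //; apply: measurable_funM; last exact: measurable_id.
  rewrite (_ : (fun r : R => _) = fun r => e r * e r); last by apply/funext => r; exact: e2.
  exact: measurable_funM.
have inner t : B t -> (\int[mu]_(r in A) X (r, t) <= (c * (N t * (expR (- (2 * b) * t ^+ 2) * t)))%:E)%E.
  rewrite /B /= in_itv /= andbT => t1; have t0 : 0 <= t by lra.
  (* The square root of a negative number being 0, [rho] is 0 for t < 16, and the tail is then the
     whole half-line. *)
  pose rho := outer_radius (- 16 ^+ 2) t.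
  have rho0 : 0 <= rho by exact: sqrtr_ge0.
  have rho2 : t ^+ 2 - 16 ^+ 2 <= rho ^+ 2.
    rewrite /rho /outer_radius; have [x0|x0] := leP 0 (t ^+ 2 - 16 ^+ 2); first by rewrite sqr_sqrtr.
    exact: le_trans (ltW x0) (sqr_ge0 _).
  pose S := `[rho, +oo[%classic : set rT.
  have mS : measurable S by exact: measurable_itv.
  pose D := e t * t * N t.
  have D0 : 0 <= D by rewrite !mulr_ge0.
  pose F (r : rT) : \bar R := (D * (e r * r))%:E.
  apply: (@le_trans _ _ (\int[mu]_(r in A) (F \_ S) r)%E).
    apply: ge0_le_integral => //.
    - by apply: measurable_funTS; exact: (measurableT_comp mX (pair2_measurable t)).
    - apply: measurable_funTS; apply/(measurable_restrictT _ _).1 => //; apply: measurable_funTS.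
      apply/measurable_EFinP; apply: measurable_funM; first exact: measurable_cst.
      by apply: measurable_funM => //; exact: measurable_id.
    move=> r; rewrite /A /= in_itv /= andbT => r0.
    rewrite /X indicE; have [rtW|rtW] := boolP ((r, t) \in W); last first.
      rewrite mul0r mul0r; apply: erestrict_ge0 => s; rewrite /S /= in_itv /= andbT => s0.
      by rewrite lee_fin !mulr_ge0//; lra.
    rewrite patchT; last first.
      rewrite inE /S /= in_itv /= andbT -(ger0_norm r0) -sqrtr_sqr ler_wsqrtr//.
      by move: rtW; rewrite inE /W /=; lra.
    by rewrite /= !ger0_norm// lee_fin mul1r mulrC.
  rewrite -integral_mkcondr.
  apply: (@le_trans _ _ (D * (expR (- b * rho ^+ 2) / (2 * b)))%:E).
    rewrite EFinM -(integral_gauss_tail b0 rho0) -ge0_integralZl_EFin//; last 2 first.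
    - by move=> r; rewrite /S /= in_itv /= andbT => r1; rewrite lee_fin mulr_ge0 ?expR_ge0//; lra.
    - by apply: measurable_funTS; apply/measurable_EFinP; apply: measurable_funM => //; exact: measurable_id.
    apply: ge0_subset_integral => //.
    - exact: measurableI.
    - apply: measurable_funTS; apply/measurable_EFinP; apply: measurable_funM; first exact: measurable_cst.
      by apply: measurable_funM => //; exact: measurable_id.
    - by move=> r; rewrite /S /= in_itv /= andbT => r1; rewrite lee_fin !mulr_ge0 ?expR_ge0//; lra.
  rewrite lee_fin e2 (_ : c * _ = D * (c * e t)); last by rewrite /D; ring.
  apply: ler_wpM2l => //; rewrite /c mulrAC ler_pM2r ?invr_gt0 ?mulr_gt0//.
  rewrite /e -expRD ler_expR; nra.
apply: (@le_trans _ _ (\int[mu]_(t in B) (c * (N t * (expR (- (2 * b) * t ^+ 2) * t)))%:E)%E).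
  apply: ge0_le_integral => //.
  - by move=> t _; apply: integral_ge0 => r _; exact: X0.
  - pose Xs (z : rT * rT) := X (z.2, z.1).
    have mXs : measurable_fun setT Xs by exact: measurableT_comp mX (@measurable_swap _ _ _ _).
    by apply: measurable_funTS; apply: (measurable_integral1 mu mA mXs) => z; exact: X0.
  - apply: measurable_funTS; apply/measurable_EFinP; apply: measurable_funM; first exact: measurable_cst.
    exact/measurable_EFinP.
rewrite -ge0_integralZl_EFin//; last 2 first.
- by move=> t; rewrite /= in_itv /= andbT => t0; rewrite lee_fin !mulr_ge0 ?expR_ge0.
- exact: measurable_funTS.
apply: ge0_subset_integral => //.
- apply: measurable_funTS; apply/measurable_EFinP; apply: measurable_funM; first exact: measurable_cst.
  exact/measurable_EFinP.
- by move=> t; rewrite /= in_itv /= andbT => t0; rewrite lee_fin; do 2 apply: mulr_ge0 => //; rewrite mulr_ge0 ?expR_ge0.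
- by apply: subset_itv; rewrite ?bnd_simp.
Qed.

End norms.

Section norm_domination.
Variable R : realType.
Local Notation mu := (@lebesgue_measure R).
Local Notation rT := (measurableTypeR R).
Implicit Types (f h : R[i] -> R[i]) (p q : \bar R).

Lemma mixed_norm_rmean p (s alpha : R) f : (0 < p)%E -> (forall z, ccontinuous f z) ->
  mixed_norm p s%:E alpha f = (((alpha * s)%:E * \int[mu]_(r in `[0%R, +oo[)
    (rmean p f r `^ s * (expR (- (alpha * s / 2) * r ^+ 2) * r))%:E) `^ s^-1)%E.
Proof.
move=> p0 cf; congr (_ `^ _)%E; congr (_ * _)%E; apply: eq_integral => r.
by rewrite inE /= in_itv /= andbT => r0; rewrite Mp_rmean// poweR_EFin -EFinM.
Qed.

(** In both cases [b] is chosen so that the weight, raised to the power q when q is finite, is exp(-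
    2 b r^2), twice the exponent of the kernel. For q finite the conclusion is
    [gauss_mean_tonelli]. *)
Lemma mixed_norm_dominated p q (alpha : R) : (0 < p)%E -> (0 < q)%E -> 0 < alpha ->
  exists2 C, 0 < C & forall f h, cholomorphic f -> cholomorphic h -> radially_dominated h f ->
  (mixed_norm p q alpha h <= C%:E * mixed_norm p q alpha f)%E.
Proof.
move=> p0; case: q => [s| |] //; rewrite ?lte_fin => s0 a0.
  pose b := alpha * s / 4; have b0 : 0 < b by rewrite divr_gt0// mulr_gt0.
  have [C C0 HC] := rmean_powR_dominated p0 s0 b0.
  pose C1 := C * (expR (b * 16 ^+ 2) / (2 * b)).
  have C10 : 0 < C1 by rewrite mulr_gt0// divr_gt0 ?expR_gt0// mulr_gt0.
  exists (C1 `^ s^-1); first exact: powR_gt0.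
  move=> f h hf hh hd.
  have cf z := cholomorphic_ccontinuous z hf; have ch z := cholomorphic_ccontinuous z hh.
  rewrite !mixed_norm_rmean// -poweR_EFin.
  have I0 g : (0 <= \int[mu]_(r in `[0%R, +oo[)
      (rmean p g r `^ s * (expR (- (alpha * s / 2) * r ^+ 2) * r))%:E)%E.
    apply: integral_ge0 => r; rewrite /= in_itv /= andbT => r0.
    by rewrite lee_fin !mulr_ge0 ?powR_ge0 ?expR_ge0.
  have as0 : (0 <= (alpha * s)%:E)%E by rewrite lee_fin mulr_ge0// ltW.
  rewrite -poweRM; last 2 first.
  - by rewrite lee_fin ltW.
  - exact: mule_ge0.
  apply: gt0_ler_poweR.
  - by rewrite invr_ge0 ltW.
  - by rewrite in_itv /= leey andbT mule_ge0.
  - by rewrite in_itv /= leey andbT mule_ge0 ?mule_ge0// lee_fin ltW.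
  rewrite muleCA; apply: lee_wpmul2l => //.
  have mr g : cholomorphic g -> measurable_fun setT ((fun r => rmean p g r `^ s) : rT -> R).
    by move=> hg; apply: (measurableT_comp (@measurable_powR R s)); exact: measurable_rmean.
  have -> : alpha * s / 2 = 2 * b by rewrite /b; field.
  apply: (@gauss_mean_tonelli R b C (fun r => rmean p f r `^ s) (fun r => rmean p h r `^ s)) => //.
  - exact: mr.
  - exact: mr.
  - by move=> r; exact: powR_ge0.
  - by move=> r; exact: powR_ge0.
  - by move=> r r0; exact: HC.
(* For q infinite the exponent is Q = 1: a finite norm S means rmean(t) <= S exp(2 b t^2), and the
   kernel turns this into S exp(2 b r^2) exp(- b (r^2 - t^2)), integrable uniformly in [r]; the
   weight cancels exp(2 b r^2). *)
pose b := alpha / 4; have b0 : 0 < b by rewrite divr_gt0.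
have [C C0 HC] := rmean_powR_dominated p0 ltr01 b0.
pose c2 := expR (b * 16 ^+ 2) / (2 * b).
have c20 : 0 < c2 by rewrite divr_gt0 ?expR_gt0// mulr_gt0.
have C10 : 0 < C * c2 by rewrite mulr_gt0.
exists (C * c2) => // f h hf hh hd.
have cf z := cholomorphic_ccontinuous z hf; have ch z := cholomorphic_ccontinuous z hh.
have N0 : (0 <= mixed_norm p +oo alpha f)%E.
  apply: (@le_trans _ _ (Mp p f 0 * (expR (- (alpha / 2) * 0 ^+ 2))%:E)%E).
    by rewrite Mp_rmean// mule_ge0// lee_fin ?rmean_ge0 ?expR_ge0.
  by apply: ereal_sup_ubound; exists 0 => //=.
set N := mixed_norm p +oo alpha f in N0 *.
have [->|Ny] := eqVneq N +oo%E; first by rewrite gt0_muley ?leey// lte_fin.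
have NE : N = (fine N)%:E by rewrite fineK// ge0_fin_numE// lt_neqAle Ny leey.
set S := fine N in NE; have S0 : 0 <= S by rewrite -lee_fin -NE.
have fS t : 0 <= t -> rmean p f t <= S * expR (2 * b * t ^+ 2).
  move=> t0; have : (Mp p f t * (expR (- (alpha / 2) * t ^+ 2))%:E <= S%:E)%E.
    by rewrite -NE; apply: ereal_sup_ubound; exists t.
  rewrite Mp_rmean// -EFinM lee_fin -ler_pdivlMr ?expR_gt0// => /le_trans; apply.
  rewrite -expRN ler_wpM2l// ler_expR le_eqVlt; apply/orP; left; apply/eqP.
  by rewrite /b; field.
apply: ge_ereal_sup => _ [r /= r0 <-]; rewrite Mp_rmean// -EFinM.
have := HC f h r hf ch hd r0; rewrite powRr1 ?rmean_ge0// => Hr.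
have I1 : (gauss_mean b 1 (rmean p f) r <= (S * expR (2 * b * r ^+ 2) * c2)%:E)%E.
  pose g (t : R) := expR (- (b * (r ^+ 2 - t ^+ 2))) * t.
  have mg : measurable_fun setT ((fun t => (g t)%:E) : rT -> \bar R).
    apply/measurable_EFinP; apply: continuous_measurable_fun => t.
    apply: cvgM; last exact: cvg_id.
    apply: (@continuous_expR_comp R (fun t => - (b * (r ^+ 2 - t ^+ 2)))) => {}t.
    apply: cvgN; apply: cvgM; [exact: cvg_cst|].
    by apply: cvgB; [exact: cvg_cst|exact: exprn_continuous].
  have D0 : 0 <= S * expR (2 * b * r ^+ 2) by rewrite mulr_ge0 ?expR_ge0.
  rewrite EFinM.
  apply: (@le_trans _ _ ((S * expR (2 * b * r ^+ 2))%:E *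
      \int[mu]_(t in `[1%R, outer_radius (16 ^+ 2) r]) (g t)%:E)%E); last first.
    apply: lee_wpmul2l; first by rewrite lee_fin.
    by apply: integral_gauss_ker_le => //; rewrite exprn_ge0.
  rewrite -ge0_integralZl_EFin//; last 2 first.
  - by move=> t; rewrite /= in_itv /= => /andP[t1 _]; rewrite lee_fin mulr_ge0 ?expR_ge0//; lra.
  - exact: measurable_funTS.
  apply: ge0_le_integral => //.
  - move=> t; rewrite /= in_itv /= => /andP[t1 _].
    by rewrite lee_fin !mulr_ge0 ?gauss_ker_ge0 ?powR_ge0//; lra.
  - apply/measurable_EFinP; apply: measurable_funTS; apply: measurable_funM.
      by apply: continuous_measurable_fun; exact: continuous_gauss_kerM.
    by apply: (measurableT_comp (@measurable_powR R 1)); exact: measurable_rmean.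
  - apply: measurable_funTS; apply: emeasurable_funM => //; exact: measurable_cst.
  move=> t; rewrite /= in_itv /= => /andP[t1 _]; have t0 : 0 <= t by lra.
  rewrite powRr1 ?rmean_ge0// -EFinM lee_fin.
  apply: (@le_trans _ _ (gauss_ker b r t * t * (S * expR (2 * b * t ^+ 2)))).
    by apply: ler_wpM2l; [rewrite mulr_ge0 ?gauss_ker_ge0|exact: fS].
  rewrite /g /gauss_ker le_eqVlt; apply/orP; left; apply/eqP.
  have -> : expR (b * (r ^+ 2 - t ^+ 2)) * t * (S * expR (2 * b * t ^+ 2)) =
    S * t * (expR (b * (r ^+ 2 - t ^+ 2)) * expR (2 * b * t ^+ 2)) by ring.
  have -> : S * expR (2 * b * r ^+ 2) * (expR (- (b * (r ^+ 2 - t ^+ 2))) * t) =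
    S * t * (expR (2 * b * r ^+ 2) * expR (- (b * (r ^+ 2 - t ^+ 2)))) by ring.
  by rewrite -!expRD; congr (_ * expR _); ring.
have {}Hr := le_trans Hr (lee_wpmul2l (ltac:(by rewrite lee_fin ltW) : (0 <= C%:E)%E) I1).
move: Hr; rewrite -EFinM lee_fin NE -EFinM lee_fin => Hr.
apply: le_trans (ler_wpM2r (expR_ge0 _) Hr) _.
have E : expR (2 * b * r ^+ 2) * expR (- (alpha / 2) * r ^+ 2) = 1.
  by rewrite -expRD -[RHS]expR0; congr expR; rewrite /b; field.
have -> : C * (S * expR (2 * b * r ^+ 2) * c2) * expR (- (alpha / 2) * r ^+ 2) =
  C * c2 * S * (expR (2 * b * r ^+ 2) * expR (- (alpha / 2) * r ^+ 2)) by ring.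
by rewrite E mulr1.
Qed.

End norm_domination.

(** * The Hausdorff operator *)

Section inv_integral.
Variable R : realType.
Variable mu : {measure set (measurableTypeR R) -> \bar R}.
Implicit Types (u v : R -> R) (f : R[i] -> R[i]).

(** Integral of [u] against the image of dmu(t)/t under s = 1/t. Under the two hypotheses made below
    this image is a probability measure carried by ]0, 1], and the operator becomes an average of
    the dilations f(s z). *)
Definition inv_integral u : R := \int[mu]_(t in `]0, +oo[) (u t^-1 / t).

Hypothesis mu_normalized : (\int[mu]_(t in `]0%R, +oo[) (t^-1)%:E = 1)%E.

Let D : set (measurableTypeR R) := `]0, +oo[%classic.
Let mD : measurable D. Proof. exact: measurable_itv. Qed.

Lemma measurable_inv_weight u : continuous u ->
  measurable_fun D ((fun t : R => u t^-1 / t) : measurableTypeR R -> R).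
Proof.
move=> cu; apply: open_continuous_measurable_fun; first exact: interval_open.
move=> t; rewrite inE /D /= in_itv /= andbT => t0.
have t0' : t != 0 by rewrite gt_eqF.
apply: cvgM; last exact: inv_continuous.
by apply: (@continuous_comp _ _ _ (fun t : R => t^-1) u); [exact: inv_continuous|exact: cu].
Qed.

Let measurable_inv : measurable_fun D ((fun t : R => t^-1) : measurableTypeR R -> R).
Proof.
by apply: eq_measurable_fun (measurable_inv_weight (@cst_continuous R R 1)) => t _; rewrite div1r.
Qed.

Hypothesis mu_lt1 : mu `]0, 1[%classic = 0%E.

(** The points t < 1 are negligible, so only s = 1/t in ]0, 1] counts, and the total mass of
    dmu(t)/t is 1. *)
Lemma inv_weight_norm_le u (M : R) : continuous u ->
  (forall s, 0 <= s -> s <= 1 -> `|u s| <= M) ->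
  (\int[mu]_(t in D) `|(u t^-1 / t)%:E| <= M%:E)%E.
Proof.
move=> cu uM.
have M0 : 0 <= M by apply: le_trans (uM 0 (lexx _) ler01); exact: normr_ge0.
have mN : measurable (`]0, 1[%classic : set (measurableTypeR R)) by exact: measurable_itv.
have mu1 : measurable_fun D ((fun t : R => `|(u t^-1 / t)%:E|%E) : measurableTypeR R -> \bar R).
  by apply: measurableT_comp => //; apply/measurable_EFinP; exact: measurable_inv_weight.
rewrite (ge0_negligible_integral mN mD mu1)//.
have mDN : measurable (D `\` `]0, 1[) by exact: measurableD.
apply: (@le_trans _ _ (\int[mu]_(t in D `\` `]0%R, 1%R[) (M * t^-1)%:E)%E).
  apply: ge0_le_integral => //.
  - by apply: measurable_funS mu1 => // t [].
  - have mM : measurable_fun D ((fun t : R => (M * t^-1)%:E) : measurableTypeR R -> \bar R).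
      by apply/measurable_EFinP; apply: measurable_funM.
    by apply: measurable_funS mM => // t [].
  move=> t; rewrite /D /= !in_itv /= andbT => -[t0 tn1].
  have t1 : 1 <= t by have [//|t1] := leP 1 t; exfalso; apply: tn1; rewrite t0.
  rewrite lee_fin normrM normfV (ger0_norm (ltW t0)) ler_pM2r ?invr_gt0//.
  by apply: uM; rewrite ?invr_ge0 ?(ltW t0)// invf_le1.
apply: (@le_trans _ _ (\int[mu]_(t in D) (M * t^-1)%:E)%E).
  apply: ge0_subset_integral => //.
  - by apply/measurable_EFinP; apply: measurable_funM.
  - by move=> t; rewrite /D /= in_itv /= andbT => t0; rewrite lee_fin mulr_ge0 ?invr_ge0// ltW.
under eq_integral do rewrite EFinM.
rewrite ge0_integralZl_EFin//.
- by rewrite mu_normalized mule1.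
- by move=> t; rewrite /D /= in_itv /= andbT => t0; rewrite lee_fin invr_ge0 ltW.
- exact/measurable_EFinP.
Qed.

Let unit_bounded u : continuous u -> exists M, forall s, 0 <= s -> s <= 1 -> `|u s| <= M.
Proof.
move=> cu.
have [|c _ H] := @EVT_max R (fun s => `|u s|) 0 1 ler01.
  apply: continuous_subspaceT => s.
  by apply: (@continuous_comp _ _ _ u (fun x : R => `|x|)); [exact: cu|exact: norm_continuous].
by exists `|u c| => s s0 s1; apply: H; rewrite in_itv /= s0.
Qed.

Lemma inv_integrable u : continuous u -> mu.-integrable D (fun t : R => (u t^-1 / t)%:E).
Proof.
move=> cu; have [M HM] := unit_bounded cu.
apply/integrableP; split; first by apply/measurable_EFinP; exact: measurable_inv_weight.
by apply: le_lt_trans (inv_weight_norm_le cu HM) _; rewrite ltry.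
Qed.

Lemma inv_integral_le u M : continuous u -> (forall s, 0 <= s -> s <= 1 -> `|u s| <= M) ->
  `|inv_integral u| <= M.
Proof.
move=> cu HM; rewrite -lee_fin EFin_normr_Rintegral//; last exact: inv_integrable.
apply: le_trans (inv_weight_norm_le cu HM); apply: le_abse_integral => //.
by apply/measurable_EFinP; exact: measurable_inv_weight.
Qed.

Lemma inv_integralB u v : continuous u -> continuous v ->
  inv_integral (fun s => u s - v s) = inv_integral u - inv_integral v.
Proof.
move=> cu cv; rewrite -RintegralB//; try exact: inv_integrable.
by congr Rintegral; apply/funext => t; rewrite mulrBl.
Qed.

Lemma inv_integralZ (c : R) u : continuous u ->
  inv_integral (fun s => c * u s) = c * inv_integral u.
Proof.
move=> cu; rewrite -RintegralZl//; last exact: inv_integrable.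
by congr Rintegral; apply/funext => t; rewrite mulrA.
Qed.

Definition cinv_integral (g : R -> R[i]) : R[i] :=
  inv_integral (fun s => complex.Re (g s)) +i* inv_integral (fun s => complex.Im (g s)).

Let ccont (g : R -> R[i]) := continuous (fun s => complex.Re (g s)) /\ continuous (fun s => complex.Im (g s)).

Lemma cinv_integral_le g (M : R) : ccont g -> (forall s, 0 <= s -> s <= 1 -> cabs (g s) <= M) ->
  cabs (cinv_integral g) <= 2 * M.
Proof.
move=> [c1 c2] gM; apply: le_trans (cabs_le_ReIm _) _.
rewrite mulr_natl mulr2n; apply: lerD; apply: inv_integral_le => // s s0 s1.
  exact: le_trans (ler_Re_cabs _) (gM _ s0 s1).
exact: le_trans (ler_Im_cabs _) (gM _ s0 s1).
Qed.

Let ccont_lin g1 g2 g3 (h : R[i]) : ccont g1 -> ccont g2 -> ccont g3 ->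
  ccont (fun s => g1 s - g2 s - g3 s * h).
Proof.
move=> [a1 b1] [a2 b2] [a3 b3].
have cZ c u : continuous u -> continuous (fun s => u s * c).
  by move=> cu s; apply: cvgM; [exact: cu|exact: cvg_cst].
have cB u v : continuous u -> continuous v -> continuous (fun s => u s - v s).
  by move=> cu cv s; apply: cvgB; [exact: cu|exact: cv].
have cD u v : continuous u -> continuous v -> continuous (fun s => u s + v s).
  by move=> cu cv s; apply: cvgD; [exact: cu|exact: cv].
split.
  rewrite (_ : (fun _ => _) = fun s : R => complex.Re (g1 s) - complex.Re (g2 s) -
     (complex.Re (g3 s) * complex.Re h - complex.Im (g3 s) * complex.Im h)).
    by apply: (cB); [exact: (cB)|apply: (cB); exact: (cZ)].
  by apply/funext => x; rewrite !complex_ReB complex_ReM.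
rewrite (_ : (fun _ => _) = fun s : R => complex.Im (g1 s) - complex.Im (g2 s) -
     (complex.Re (g3 s) * complex.Im h + complex.Im (g3 s) * complex.Re h)).
  by apply: (cB); [exact: (cB)|apply: cD; exact: (cZ)].
by apply/funext => x; rewrite !complex_ImB complex_ImM.
Qed.

Lemma cinv_integral_lin g1 g2 g3 (h : R[i]) : ccont g1 -> ccont g2 -> ccont g3 ->
  cinv_integral (fun s => g1 s - g2 s - g3 s * h) =
  cinv_integral g1 - cinv_integral g2 - cinv_integral g3 * h.
Proof.
move=> [a1 b1] [a2 b2] [a3 b3].
have cZ c u : continuous u -> continuous (fun s => c * u s).
  by move=> cu s; apply: cvgM; [exact: cvg_cst|exact: cu].
have cB u v : continuous u -> continuous v -> continuous (fun s => u s - v s).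
  by move=> cu cv s; apply: cvgB; [exact: cu|exact: cv].
have Eb u1 u2 x1 u3 x2 v3 : continuous u1 -> continuous u2 -> continuous u3 -> continuous v3 ->
   inv_integral (fun s => u1 s - u2 s - (x1 * u3 s - x2 * v3 s)) =
   inv_integral u1 - inv_integral u2 - (x1 * inv_integral u3 - x2 * inv_integral v3).
  move=> cu1 cu2 cu3 cv3.
  have cr : continuous (fun s => x1 * u3 s - x2 * v3 s) by apply: cB; exact: cZ.
  rewrite (inv_integralB (cB _ _ cu1 cu2) cr) (inv_integralB cu1 cu2).
  by rewrite (inv_integralB (cZ x1 _ cu3) (cZ x2 _ cv3)) !inv_integralZ.
rewrite /cinv_integral; apply/eqP; rewrite eq_complex; apply/andP; split; apply/eqP.
  transitivity (inv_integral (fun s => complex.Re (g1 s) - complex.Re (g2 s) -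
      (complex.Re h * complex.Re (g3 s) - complex.Im h * complex.Im (g3 s)))).
    congr inv_integral; apply/funext => s.
    by rewrite !complex_ReB complex_ReM; ring.
  by rewrite Eb// !complex_ReB complex_ReM /=; ring.
transitivity (inv_integral (fun s => complex.Im (g1 s) - complex.Im (g2 s) -
    (complex.Im h * complex.Re (g3 s) - (- complex.Re h) * complex.Im (g3 s)))).
  congr inv_integral; apply/funext => s.
  by rewrite !complex_ImB complex_ImM; ring.
by rewrite Eb// !complex_ImB complex_ImM /=; ring.
Qed.

Let div_realE (z : R[i]) (t : R) : z / t%:C = z * (t^-1)%:C.
Proof. by rewrite -fmorphV. Qed.

Lemma hausdorffE f z : hausdorff mu f z = cinv_integral (fun s => f (z * s%:C)).
Proof.
by rewrite /hausdorff /cinv_integral; congr (_ +i* _); congr Rintegral; apply/funext => t;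
  rewrite div_realE.
Qed.

Let ccont_ray f z : (forall z, ccontinuous f z) -> ccont (fun s => f (z * s%:C)).
Proof.
move=> cf; have H s : {for s, continuous (fun s : R => complex.Re (z * s%:C))} /\
    {for s, continuous (fun s : R => complex.Im (z * s%:C))}.
  split.
    rewrite (_ : (fun _ => _) = fun s : R => complex.Re z * s).
      by apply: cvgM; [exact: cvg_cst|exact: cvg_id].
    by apply/funext => x; rewrite complex_ReM /= mulr0 subr0.
  rewrite (_ : (fun _ => _) = fun s : R => complex.Im z * s).
    by apply: cvgM; [exact: cvg_cst|exact: cvg_id].
  by apply/funext => x; rewrite complex_ImM /= mulr0 add0r.
by split => s; have [H1 H2] := H s; have [] := ccontinuous_comp H1 H2 (cf _).
Qed.

Lemma hausdorff_integrable_continuous f z : (forall z, ccontinuous f z) -> hausdorff_integrable mu f z.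
Proof.
move=> cf; have [c1 c2] := ccont_ray z cf.
split; [have := inv_integrable c1|have := inv_integrable c2];
  by congr (integrable _ _ _); apply/funext => t; rewrite div_realE.
Qed.

Lemma hausdorff_dominated f : (forall z, ccontinuous f z) -> radially_dominated (hausdorff mu f) f.
Proof.
move=> cf r th M r0 fM; rewrite hausdorffE; apply: cinv_integral_le; first exact: ccont_ray.
move=> s s0 s1; have -> : polar r th * s%:C = polar (r * s) th.
  by apply/eqP; rewrite eq_complex complex_ReM complex_ImM /=; apply/andP; split; apply/eqP; ring.
by apply: fM; [rewrite mulr_ge0|rewrite ler_piMr].
Qed.

(** Differentiation under the integral by the uniform quadratic remainder of [cholomorphic_taylor1],
    the candidate being the average of s f'(s z). The dilated points stay in a fixed disc because s
    <= 1. *)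
Lemma hausdorff_cholomorphic f : cholomorphic f -> cholomorphic (hausdorff mu f).
Proof.
move=> hf z; have cf w := cholomorphic_ccontinuous w hf.
have [D' HD] := choice hf.
have cD w : ccontinuous D' w.
  move=> e e0; have [K K0 HK] := cholomorphic_taylor1 (cabs w + 1) HD.
  exists (Num.min 1 (e / (K + 1))); first by rewrite lt_min ltr01 divr_gt0//; lra.
  move=> y; rewrite lt_min => /andP[y1 y2].
  have yw : cabs y <= cabs w + 1 by have := cabsD (y - w) w; rewrite subrK; lra.
  have [H _] := HK w y ltac:(lra) yw.
  have K1 : 0 < K + 1 by lra.
  apply: le_lt_trans H _; move: y2; rewrite ltr_pdivlMr// => y2.
  have := cabs_ge0 (y - w); nra.
pose d (s : R) := D' (z * s%:C) * s%:C.
have cd : ccont d.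
  have [c1 c2] := ccont_ray z cD; split => s.
    rewrite (_ : (fun _ => _) = fun s : R => complex.Re (D' (z * s%:C)) * s).
      by apply: cvgM; [exact: c1|exact: cvg_id].
    by apply/funext => x; rewrite /d complex_ReM /= mulr0 subr0.
  rewrite (_ : (fun _ => _) = fun s : R => complex.Im (D' (z * s%:C)) * s).
    by apply: cvgM; [exact: c2|exact: cvg_id].
  by apply/funext => x; rewrite /d complex_ImM /= mulr0 add0r.
exists (cinv_integral d) => e e0.
have [K K0 HK] := cholomorphic_taylor1 (cabs z + 1) HD.
(* 2 K |h|^2 has to be at most e |h|, the 2 coming from [cinv_integral_le]; the 1 avoids a division
   by zero. *)
exists (Num.min 1 (e / (2 * K + 1))).
  by rewrite lt_min ltr01 divr_gt0//; lra.
move=> h; rewrite lt_min => /andP[h1 h2].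
have h0 := cabs_ge0 h.
rewrite !hausdorffE -cinv_integral_lin; [|exact: ccont_ray|exact: ccont_ray|exact: cd].
apply: (@le_trans _ _ (2 * (K * cabs h ^+ 2))); last first.
  have : (2 * K + 1) * cabs h <= e by rewrite mulrC -ler_pdivlMr ?(ltW h2)//; lra.
  by rewrite expr2; nra.
apply: cinv_integral_le.
  by apply: ccont_lin; [exact: ccont_ray|exact: ccont_ray|exact: cd].
move=> s s0 s1.
have cs : cabs s%:C = s by rewrite cabs_real ger0_norm.
have le w : cabs w <= cabs z + 1 -> cabs (w * s%:C) <= cabs z + 1.
  by move=> H; rewrite cabsM cs; apply: le_trans H; rewrite ler_piMr// cabs_ge0.
have zh : cabs (z + h) <= cabs z + 1 by have := cabsD z h; lra.
have [_] := HK (z * s%:C) ((z + h) * s%:C) (le z ltac:(lra)) (le (z + h) zh).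
have E : (z + h) * s%:C - z * s%:C = h * s%:C by ring.
rewrite E (_ : D' (z * s%:C) * (h * s%:C) = d s * h); last by rewrite /d; ring.
move=> /le_trans; apply; rewrite cabsM cs ler_wpM2l// exprMn ler_piMr ?exprn_ge0//.
by rewrite expr_le1.
Qed.

End inv_integral.

Section moments.
Variable R : realType.
Variable mu : {measure set (measurableTypeR R) -> \bar R}.
Implicit Types (f : R[i] -> R[i]).

Lemma entireP f : entire f <-> cholomorphic f.
Proof.
split=> hf z; first exact: derivable_has_cderiv.
by have [l] := hf z; exact: has_cderiv_derivable.
Qed.

Let D : set (measurableTypeR R) := `]0, +oo[%classic.
Let mD : measurable D. Proof. exact: measurable_itv. Qed.

Lemma hausdorff_bounded_of_null (p q : \bar R) (alpha : R) :
  (\int[mu]_(t in `]0%R, +oo[) (t^-1)%:E = 1)%E -> mu `]0, 1[%classic = 0%E ->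
  (0 < p)%E -> (0 < q)%E -> 0 < alpha ->
  hausdorff_bounded mu (mixed_norm p q alpha) (mixed_norm p q alpha).
Proof.
move=> mu1 mu01 p0 q0 a0.
have [C C0 HC] := mixed_norm_dominated p0 q0 a0.
have bound f : entire_space (mixed_norm p q alpha) f ->
    (mixed_norm p q alpha (hausdorff mu f) <= C%:E * mixed_norm p q alpha f)%E.
  move=> [/entireP hf _]; apply: HC => //; first exact: hausdorff_cholomorphic.
  by apply: hausdorff_dominated => // z; exact: cholomorphic_ccontinuous.
split; last by exists C.
move=> f Xf; have [/entireP hf Nf] := Xf.
split; first by move=> z; apply: hausdorff_integrable_continuous => // w; exact: cholomorphic_ccontinuous.
split; first exact/entireP/hausdorff_cholomorphic.
by apply: le_lt_trans (bound f Xf) _; rewrite lte_mul_pinfty// lee_fin ltW.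
Qed.

Let measurable_moment n : measurable_fun D ((fun t : R => ((t ^+ n.+1)^-1)%:E) : measurableTypeR R -> \bar R).
Proof.
apply/measurable_EFinP.
have H := @measurable_inv_weight R (fun t => t ^+ n) (@exprn_continuous R n).
by apply: eq_measurable_fun H => t _; rewrite exprSr invfM exprVn mulrC.
Qed.

Lemma moment_le1 n : (\int[mu]_(t in `]0%R, +oo[) (t^-1)%:E = 1)%E -> mu `]0, 1[%classic = 0%E ->
  (mu_moment mu n <= 1)%E.
Proof.
move=> mu1 mu01.
have cu : continuous (fun t : R => t ^+ n) by exact: exprn_continuous.
have := @inv_weight_norm_le R mu mu1 mu01 (fun t => t ^+ n) 1 cu _; move=> H.
apply: le_trans (H _); last first.
  by move=> s s0 s1; rewrite ger0_norm ?exprn_ge0// exprn_ile1.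
rewrite /mu_moment le_eqVlt; apply/orP; left; apply/eqP; apply: eq_integral => t.
rewrite inE /= in_itv /= andbT => t0.
rewrite ger0_norm; last by rewrite mulr_ge0 ?exprn_ge0 ?invr_ge0// ltW.
by rewrite exprSr invfM exprVn mulrC.
Qed.

Lemma null_of_moment_growth :
  (forall l : R, 1 < l -> exists C : R, forall n, (mu_moment mu n <= (C * l ^+ n)%:E)%E) ->
  mu `]0, 1[%classic = 0%E.
Proof.
move=> growth.
have null_a (a : R) : 0 < a -> a < 1 -> mu `]0, a]%classic = 0%E.
  (* The midpoint of 1 and 1/a: both l > 1 and a l = (a + 1)/2 < 1 hold, so the bound C a (a l)^n
     tends to 0. *)
  move=> a0 a1; pose l := (1 + a^-1) / 2.
  have ai : 1 < a^-1 by rewrite invf_gt1.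
  have l1 : 1 < l by rewrite /l; lra.
  have al : a * l = (a + 1) / 2 by rewrite /l; field; rewrite gt_eqF.
  clearbody l; have [C HC] := growth l l1.
  set A := `]0, a]%classic.
  have mA : measurable (A : set (measurableTypeR R)) by exact: measurable_itv.
  have H n : (mu A <= (C * a * (a * l) ^+ n)%:E)%E.
    have H1 : (((a ^+ n.+1)^-1)%:E * mu A <= mu_moment mu n)%E.
      rewrite -integral_cst//.
      apply: (@le_trans _ _ (\int[mu]_(t in A) ((t ^+ n.+1)^-1)%:E)%E).
        apply: ge0_le_integral => //.
        - by move=> t _; rewrite lee_fin invr_ge0 exprn_ge0// ltW.
        - by apply: measurable_funS (measurable_moment n) => //; move=> t; rewrite /A /D /= !in_itv /= andbT => /andP[].
        move=> t; rewrite /A /= in_itv /= => /andP[t0 ta].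
        rewrite lee_fin lef_pV2 ?posrE ?exprn_gt0//.
        by apply: lerXn2r; rewrite ?nnegrE// ltW.
      apply: ge0_subset_integral; [exact: mA|exact: mD|exact: (measurable_moment n)| |].
      - by move=> t; rewrite /D /= in_itv /= andbT => t0; rewrite lee_fin invr_ge0 exprn_ge0// ltW.
      - by move=> t; rewrite /A /D /= !in_itv /= andbT => /andP[].
    have an0 : (0 <= (a ^+ n.+1)%:E)%E by rewrite lee_fin exprn_ge0// ltW.
    have := lee_wpmul2l an0 (le_trans H1 (HC n)).
    rewrite muleA -!EFinM mulfV ?mul1e; last by rewrite expf_neq0// gt_eqF.
    by move=> /le_trans; apply; rewrite lee_fin le_eqVlt; apply/orP; left; apply/eqP;
       rewrite exprMn exprS; ring.
  have fin : mu A \is a fin_num.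
    by rewrite ge0_fin_numE//; apply: le_lt_trans (H 0%N) _; rewrite ltry.
  have yE : mu A = (fine (mu A))%:E by rewrite fineK.
  set y := fine _ in yE; rewrite yE; congr (_%:E); apply/eqP; rewrite eq_le.
  have y0 : 0 <= y by rewrite -lee_fin -yE.
  rewrite y0 andbT.
  have cv : (fun n => C * a * (a * l) ^+ n) @ \oo --> (C * a * 0 : R).
    apply: cvgM; first exact: cvg_cst.
    apply: cvg_expr; rewrite ger0_norm; rewrite al; lra.
  rewrite -(mulr0 (C * a)) -(cvg_lim (@Rhausdorff R) cv); apply: limr_ge; first by apply/cvg_ex; eexists; exact: cv.
  by apply: nearW => n; rewrite -lee_fin -yE.
(* With [k.+2] the right end points stay positive, also for k = 0. *)
have -> : `]0, 1[%classic = \bigcup_(k : nat) `]0, 1 - k.+2%:R^-1]%classic :> set (measurableTypeR R).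
  apply/seteqP; split => t; last first.
    move=> [k _] /=; rewrite !in_itv /= => /andP[-> tk] /=.
    apply: le_lt_trans tk _; rewrite ltrBlDr ltrDl invr_gt0//.
  rewrite /= in_itv /= => /andP[t0 t1].
  have d0 : 0 < (1 - t)^-1 by rewrite invr_gt0 subr_gt0.
  exists (Num.truncn (1 - t)^-1) => //=; rewrite in_itv /= t0 /=.
  set N := Num.truncn _.
  have NE : (1 - t)^-1 <= N.+2%:R.
    have /andP[_ /ltW/le_trans] := truncn_itv (ltW d0); apply.
    by rewrite ler_nat.
  have : N.+2%:R^-1 <= 1 - t.
    by rewrite -(invrK (1 - t)) lef_pV2 ?posrE// ltr0Sn.
  by rewrite lerBrDl -lerBrDr.
have mI k : measurable (`]0, 1 - k.+2%:R^-1]%classic : set (measurableTypeR R)) by exact: measurable_itv.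
apply: measure_negligible; first exact: bigcup_measurable.
apply: negligible_bigcup => k; apply/negligibleP; first exact: mI.
apply: null_a.
  by rewrite subr_gt0 invf_lt1 ?ltr0Sn// ltr1n.
by rewrite ltrBlDr ltrDl invr_gt0 ltr0Sn.
Qed.

End moments.

(** * Test functions *)

Section monomials.
Variable R : realType.
Local Notation leb := (@lebesgue_measure R).
Local Notation rT := (measurableTypeR R).
Implicit Types (g : R[i] -> R[i]) (p q : \bar R) (alpha c r l : R).

Lemma monomial_cholomorphic n : cholomorphic (fun z : R[i] => z ^+ n).
Proof.
elim: n => [|n IH] z; first by exists 0; exact: has_cderiv_cst.
have [l hl] := IH z; exists (1 * z ^+ n + z * l).
have H := has_cderivM (has_cderiv_id z) hl.
rewrite (_ : (fun w => w ^+ n.+1) = fun w => w * w ^+ n)//.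
by apply/funext => w; rewrite exprS.
Qed.

Lemma Mp_radial p g c r : (0 < p)%E -> 0 <= r -> 0 <= c ->
  (forall z, cabs z = r -> cabs (g z) = c) -> Mp p g r = c%:E.
Proof.
move=> p0 r0 c0 gc; case: p p0 => [k| |] //; rewrite ?lte_fin => k0 /=.
  have twopi : 0 < 2 * pi :> R by rewrite mulr_gt0// pi_gt0.
  rewrite (_ : (\int[leb]_(t in _) _)%E = (\int[leb]_(t in `[0%R, (2 * pi)%R]) (c `^ k)%:E)%E); last first.
    by apply: eq_integral => t _; rewrite gc// cabs_polar ger0_norm.
  rewrite integral_cst//= lebesgue_measure_itv /= lte_fin twopi -EFinB -!EFinM poweR_EFin.
  rewrite subr0 mulrCA mulVf ?gt_eqF// mulr1 -powRrM mulfV ?gt_eqF//.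
  by rewrite powRr1.
rewrite (_ : [set _ | z in _] = [set c%:E]) ?ereal_sup1//.
apply/seteqP; split => x /=; first by move=> [z /gc -> <-].
move=> ->; exists (polar r 0); last by rewrite gc// cabs_polar ger0_norm.
by rewrite cabs_polar ger0_norm.
Qed.

(** Mixed norm of a function of modulus c |z|^n. The exponent p disappears, since the circular means
    are normalised and agree on functions of constant modulus. *)
Definition pow_norm q alpha c n : \bar R :=
  match q with
  | EFin s => ((alpha * s)%:E * \int[leb]_(r in `[0%R, +oo[)
         (((c * r ^+ n) `^ s) * (expR (- (alpha * s / 2) * r ^+ 2) * r))%:E) `^ s^-1
  | +oo => ereal_sup [set (c * r ^+ n * expR (- (alpha / 2) * r ^+ 2))%:E
                     | r in [set r : R | (0 <= r)%R]]
  | -oo => 0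
  end%E.

Lemma mixed_norm_radial p q alpha g c n : (0 < p)%E -> (0 < q)%E -> 0 <= c ->
  (forall z, cabs (g z) = c * cabs z ^+ n) -> mixed_norm p q alpha g = pow_norm q alpha c n.
Proof.
move=> p0 q0 c0 gc.
have ME r : 0 <= r -> Mp p g r = (c * r ^+ n)%:E.
  by move=> r0; apply: Mp_radial => //; [rewrite mulr_ge0// exprn_ge0|move=> z <-].
case: q q0 => [s| |] // s0 /=.
  congr (_ `^ _)%E; congr (_ * _)%E; apply: eq_integral => r.
  by rewrite inE /= in_itv /= andbT => r0; rewrite ME.
by congr ereal_sup; apply/seteqP; split => x /= [r r0 <-]; exists r => //; rewrite ME// EFinM.
Qed.

(** The norm of z^n for q infinite, that is (n / (e alpha))^(n/2). It is the reference to which the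
    norms for the other values of q are compared. *)
Definition peak alpha n : R := sup [set r ^+ n * expR (- (alpha / 2) * r ^+ 2) | r in [set r : R | 0 <= r]].

Let peak_has_sup alpha n : 0 < alpha ->
  has_sup [set r ^+ n * expR (- (alpha / 2) * r ^+ 2) | r in [set r : R | 0 <= r]].
Proof.
move=> a0; split; first by exists (0 ^+ n * expR (- (alpha / 2) * 0 ^+ 2)); exists 0 => //=.
have a2 : 0 < alpha / 2 by rewrite divr_gt0.
(* From x^(n+1) / (n+1)! <= exp(x) with x = alpha r^2 / 2, which bounds r^(2 n + 2), hence r^n for r
   > 1. *)
pose K := (n.+1)`!%:R / (alpha / 2) ^+ n.+1.
have K0 : 0 <= K by rewrite divr_ge0 ?exprn_ge0// ltW.
exists (1 + K) => _ [r /= r0 <-].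
set x := alpha / 2 * r ^+ 2; have x0 : 0 <= x by rewrite mulr_ge0 ?exprn_ge0// ltW.
have rn : r ^+ n <= 1 + K * expR x.
  have := expR_ge1Dxn n x0 => H.
  have {}H : x ^+ n.+1 / n.+1`!%:R <= expR x by lra.
  have [r1|r1] := leP r 1.
    by apply: (@le_trans _ _ 1); [rewrite exprn_ile1|rewrite lerDl mulr_ge0// expR_ge0].
  have : (r ^+ 2) ^+ n.+1 <= K * expR x.
    have -> : (r ^+ 2) ^+ n.+1 = K * (x ^+ n.+1 / n.+1`!%:R).
      have cancel (F A X : R) : F != 0 -> A != 0 -> X = F / A * (A * X / F).
        by move=> F0 A0; field; rewrite F0.
      rewrite /K /x [X in _ * (X / _)]exprMn; apply: cancel; last by rewrite gt_eqF// exprn_gt0.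
      by rewrite pnatr_eq0 -lt0n fact_gt0.
    exact: ler_wpM2l.
  have : r ^+ n <= (r ^+ 2) ^+ n.+1.
    rewrite -exprM; apply: ler_weXn2l; first exact: ltW.
    by rewrite mul2n -addnn (leq_trans (leqnSn n))// leq_addr.
  lra.
rewrite mulNr -/x expRN ler_pdivrMr ?expR_gt0//.
apply: le_trans rn _; rewrite mulrDl mul1r lerD2r.
have := expR_ge1Dx x; lra.
Qed.

Lemma peak_ub alpha n r : 0 < alpha -> 0 <= r -> r ^+ n * expR (- (alpha / 2) * r ^+ 2) <= peak alpha n.
Proof.
move=> a0 r0; have [_ hu] := peak_has_sup n a0.
by apply: ub_le_sup => //; exists r.
Qed.

Lemma peak_gt0 alpha n : 0 < alpha -> 0 < peak alpha n.
Proof.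
move=> a0; apply: lt_le_trans (peak_ub n a0 ler01).
by rewrite mulr_gt0 ?expR_gt0// exprn_gt0.
Qed.

Lemma peak_le alpha n m (K : R) : 0 < alpha -> 0 <= m ->
  (forall r, 0 <= r -> m * r ^+ n * expR (- (alpha / 2) * r ^+ 2) <= K) -> m * peak alpha n <= K.
Proof.
move=> a0; rewrite le_eqVlt => /orP[/eqP <- H|m0 H].
  by rewrite mul0r; apply: le_trans (H 0 (lexx _)); rewrite !mul0r.
rewrite mulrC -ler_pdivlMr//; apply: ge_sup; first by have [] := peak_has_sup n a0.
by move=> _ [r /= r0 <-]; rewrite ler_pdivlMr// mulrC mulrA; exact: H.
Qed.

(* Rescaling r to r / l trades a factor l ^ n for a Gaussian factor. *)
Lemma peak_decay alpha n l r : 0 < alpha -> 1 < l -> 0 <= r ->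
  r ^+ n * expR (- (alpha / 2) * r ^+ 2) <=
  l ^+ n * peak alpha n * expR (- (alpha / 2 * (1 - l ^- 2)) * r ^+ 2).
Proof.
move=> a0 l1 r0; have l0 : 0 < l by lra.
have rl : 0 <= r / l by rewrite divr_ge0// ltW.
have H := peak_ub n a0 rl.
have -> : r ^+ n * expR (- (alpha / 2) * r ^+ 2) =
  l ^+ n * ((r / l) ^+ n * expR (- (alpha / 2) * (r / l) ^+ 2)) *
    expR (- (alpha / 2 * (1 - l ^- 2)) * r ^+ 2).
  have E : - (alpha / 2) * r ^+ 2 = - (alpha / 2) * (r / l) ^+ 2 + - (alpha / 2 * (1 - l ^- 2)) * r ^+ 2.
    by field; rewrite gt_eqF.
  rewrite [in LHS]E expRD mulrA; congr (_ * _); rewrite mulrA; congr (_ * _).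
  by rewrite -exprMn mulrCA mulfV ?gt_eqF// mulr1.
by rewrite ler_wpM2r ?expR_ge0// ler_wpM2l// exprn_ge0// ltW.
Qed.

(** The factor l^n spent in [peak_decay] leaves a Gaussian whose integral does not depend on [n].
    This loss is harmless because only growth slower than every l^n is needed. *)
Lemma pow_norm_le_peak q alpha l : (0 < q)%E -> 0 < alpha -> 1 < l -> exists2 K, 0 < K & forall n,
  (pow_norm q alpha 1 n <= (K * l ^+ n * peak alpha n)%:E)%E.
Proof.
move=> q0 a0 l1; have l0 : 0 < l by lra.
have l2 : l ^- 2 < 1 by rewrite invf_lt1 ?exprn_gt0// exprn_egt1.
case: q q0 => [s| |] //; rewrite ?lte_fin => s0; last first.
  exists 1 => // n; apply: ge_ereal_sup => _ [r /= r0 <-]; rewrite lee_fin !mul1r.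
  apply: le_trans (peak_decay n a0 l1 r0) _.
  rewrite ler_piMr ?mulr_ge0 ?exprn_ge0 ?(ltW (peak_gt0 _ _)) ?(ltW l0)//.
  rewrite -[leRHS]expR0 ler_expR mulNr oppr_le0 !mulr_ge0 ?exprn_ge0//; last by lra.
  by rewrite ltW.
pose b := alpha / 2 * (1 - l ^- 2) * s.
have b0 : 0 < b by rewrite !mulr_gt0 ?subr_gt0// divr_gt0.
pose K1 := alpha * s / (2 * b).
have K10 : 0 < K1 by apply: divr_gt0; apply: mulr_gt0.
exists (K1 `^ s^-1) => [|n]; first exact: powR_gt0.
have S0 := peak_gt0 n a0; set S := peak alpha n in S0 *.
have lS : 0 < l ^+ n * S by rewrite mulr_gt0// exprn_gt0.
have as0 : 0 < alpha * s by rewrite mulr_gt0.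
have me : measurable_fun setT ((fun r => expR (- b * r ^+ 2) * r) : rT -> R).
  apply: continuous_measurable_fun => t.
  apply: cvgM; last exact: cvg_id.
  apply: (@continuous_expR_comp R (fun t => - b * t ^+ 2)) => {}t.
  by apply: cvgM; [exact: cvg_cst|exact: exprn_continuous].
have mf : measurable_fun setT ((fun r => (1 * r ^+ n) `^ s * (expR (- (alpha * s / 2) * r ^+ 2) * r)) : rT -> R).
  apply: measurable_funM.
    apply: (measurableT_comp (@measurable_powR R s)); apply: continuous_measurable_fun => t.
    by apply: cvgM; [exact: cvg_cst|exact: exprn_continuous].
  apply: continuous_measurable_fun => t.
  apply: cvgM; last exact: cvg_id.
  apply: (@continuous_expR_comp R (fun t => - (alpha * s / 2) * t ^+ 2)) => {}t.
  by apply: cvgM; [exact: cvg_cst|exact: exprn_continuous].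
have I1 : (\int[leb]_(r in `[0%R, +oo[) ((1 * r ^+ n) `^ s * (expR (- (alpha * s / 2) * r ^+ 2) * r))%:E
   <= ((l ^+ n * S) `^ s / (2 * b))%:E)%E.
  have E := @integral_gauss_tail R b 0 b0 (lexx _); rewrite expr0n/= mulr0 expR0 div1r in E.
  rewrite EFinM -E -ge0_integralZl_EFin; last 4 first.
  - exact: measurable_itv.
  - by move=> r; rewrite /= in_itv /= andbT => r0; rewrite lee_fin mulr_ge0 ?expR_ge0.
  - by apply: measurable_funTS; exact/measurable_EFinP.
  - exact: powR_ge0.
  apply: ge0_le_integral => //.
  - by move=> r; rewrite /= in_itv /= andbT => r0; rewrite lee_fin !mulr_ge0 ?powR_ge0 ?expR_ge0.
  - by apply: measurable_funTS; exact/measurable_EFinP.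
  - apply/measurable_EFinP; apply: measurable_funTS; apply: measurable_funM => //.
  move=> r; rewrite /= in_itv /= andbT => r0; rewrite -EFinM lee_fin mul1r.
  rewrite (mulrA (_ `^ _) (expR _) r) [leRHS](mulrA (_ `^ _) (expR _) r) ler_wpM2r//.
  have -> : expR (- (alpha * s / 2) * r ^+ 2) = expR (- (alpha / 2) * r ^+ 2) `^ s.
    by rewrite -expRM; congr expR; ring.
  have -> : expR (- b * r ^+ 2) = expR (- (alpha / 2 * (1 - l ^- 2)) * r ^+ 2) `^ s.
    by rewrite -expRM; congr expR; rewrite /b; ring.
  rewrite -(powRM s (exprn_ge0 n r0) (expR_ge0 _)) -(powRM s (ltW lS) (expR_ge0 _)).
  apply: ge0_ler_powR; rewrite ?nnegrE ?(ltW s0) ?mulr_ge0 ?expR_ge0 ?exprn_ge0 ?(ltW l0) ?(ltW S0)//.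
  exact: peak_decay.
have I0 : (0 <= \int[leb]_(r in `[0%R, +oo[) ((1 * r ^+ n) `^ s * (expR (- (alpha * s / 2) * r ^+ 2) * r))%:E)%E.
  by apply: integral_ge0 => r; rewrite /= in_itv /= andbT => r0; rewrite lee_fin !mulr_ge0 ?powR_ge0 ?expR_ge0.
have -> : (K1 `^ s^-1 * l ^+ n * S)%:E = (((alpha * s)%:E * ((l ^+ n * S) `^ s / (2 * b))%:E) `^ s^-1)%E.
  rewrite -EFinM poweR_EFin; congr (_%:E).
  have -> : alpha * s * ((l ^+ n * S) `^ s / (2 * b)) = K1 * (l ^+ n * S) `^ s.
    by rewrite /K1; field; rewrite gt_eqF.
  by rewrite powRM ?powR_ge0 ?(ltW K10)// -powRrM mulfV ?gt_eqF// powRr1 ?(ltW lS)// mulrA.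
have as0' : (0 <= (alpha * s)%:E)%E by rewrite lee_fin ltW.
apply: gt0_ler_poweR.
- by rewrite invr_ge0 ltW.
- by rewrite in_itv /= leey andbT mule_ge0.
- by rewrite in_itv /= leey andbT mule_ge0// lee_fin divr_ge0 ?powR_ge0// mulr_ge0// ltW.
by apply: lee_wpmul2l.
Qed.

Lemma pow_norm_scale (s : R) alpha c n : 0 < s -> 0 < alpha -> 0 <= c ->
  (pow_norm s%:E alpha c n = c%:E * pow_norm s%:E alpha 1 n)%E.
Proof.
move=> s0 a0 c0; rewrite /pow_norm.
have I0 : (0 <= \int[leb]_(r in `[0%R, +oo[) ((1 * r ^+ n) `^ s * (expR (- (alpha * s / 2) * r ^+ 2) * r))%:E)%E.
  by apply: integral_ge0 => r; rewrite /= in_itv /= andbT => r0; rewrite lee_fin !mulr_ge0 ?powR_ge0 ?expR_ge0.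
have {2}-> : c = (c `^ s) `^ s^-1 by rewrite -powRrM mulfV ?gt_eqF// powRr1.
have as0 : (0 <= (alpha * s)%:E)%E by rewrite lee_fin mulr_ge0// ltW.
rewrite -poweR_EFin -poweRM; last 2 first.
- by rewrite lee_fin powR_ge0.
- exact: mule_ge0.
congr (_ `^ _)%E; rewrite muleCA; congr (_ * _)%E.
rewrite -ge0_integralZl_EFin//; last 3 first.
- by move=> r; rewrite /= in_itv /= andbT => r0; rewrite lee_fin !mulr_ge0 ?powR_ge0 ?expR_ge0.
- apply/measurable_EFinP; apply: measurable_funTS; apply: measurable_funM.
    apply: (measurableT_comp (@measurable_powR R s)); apply: continuous_measurable_fun => t.
    by apply: cvgM; [exact: cvg_cst|exact: exprn_continuous].
  apply: continuous_measurable_fun => t.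
  apply: cvgM; last exact: cvg_id.
  apply: (@continuous_expR_comp R (fun t => - (alpha * s / 2) * t ^+ 2)) => {}t.
  by apply: cvgM; [exact: cvg_cst|exact: exprn_continuous].
- exact: powR_ge0.
apply: eq_integral => r; rewrite inE /= in_itv /= andbT => r0.
by rewrite mul1r powRM ?exprn_ge0// -EFinM -mulrA.
Qed.

Lemma pow_norm_gt0 (s : R) alpha n : 0 < s -> 0 < alpha -> (0 < pow_norm s%:E alpha 1 n)%E.
Proof.
move=> s0 a0; apply: poweR_gt0; apply: mule_gt0; first by rewrite lte_fin mulr_gt0.
have mI : measurable (`[1%R, 2%R]%classic : set rT) by exact: measurable_itv.
pose e := expR (- (alpha * s / 2) * 2 ^+ 2).
apply: (@lt_le_trans _ _ (\int[leb]_(r in `[1%R, 2%R]) e%:E)%E).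
  rewrite integral_cst//= lebesgue_measure_itv /= lte_fin ifT; last by lra.
  by rewrite -EFinB -EFinM lte_fin mulr_gt0 ?expR_gt0//; lra.
have mf : measurable_fun setT ((fun r => ((1 * r ^+ n) `^ s * (expR (- (alpha * s / 2) * r ^+ 2) * r))%:E) : rT -> \bar R).
  apply/measurable_EFinP; apply: measurable_funM.
    apply: (measurableT_comp (@measurable_powR R s)); apply: continuous_measurable_fun => t.
    by apply: cvgM; [exact: cvg_cst|exact: exprn_continuous].
  apply: continuous_measurable_fun => t.
  apply: cvgM; last exact: cvg_id.
  apply: (@continuous_expR_comp R (fun t => - (alpha * s / 2) * t ^+ 2)) => {}t.
  by apply: cvgM; [exact: cvg_cst|exact: exprn_continuous].
apply: (@le_trans _ _ (\int[leb]_(r in `[1%R, 2%R]) ((1 * r ^+ n) `^ s * (expR (- (alpha * s / 2) * r ^+ 2) * r))%:E)%E).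
  apply: ge0_le_integral => //.
  - by move=> r _; rewrite lee_fin expR_ge0.
  - exact: measurable_funTS.
  move=> r; rewrite /= in_itv /= => /andP[r1 r2]; rewrite lee_fin mul1r.
  have rn : 1 <= (r ^+ n) `^ s.
    have p1 : 1 = 1 `^ s :> R by rewrite powR1.
    rewrite [leLHS]p1; apply: ge0_ler_powR; rewrite ?nnegrE ?(ltW s0) ?exprn_ege1//.
    by rewrite exprn_ge0//; lra.
  have er : e <= expR (- (alpha * s / 2) * r ^+ 2).
    rewrite /e ler_expR !mulNr lerN2 ler_wpM2l//; last by apply: lerXn2r; rewrite ?nnegrE; lra.
    by rewrite divr_ge0// mulr_ge0// ltW.
  have e0 : 0 <= e by exact: expR_ge0.
  rewrite -[leLHS]mul1r; apply: ler_pM => //.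
  by rewrite -[leLHS]mulr1; apply: ler_pM.
apply: ge0_subset_integral => //.
- exact: measurable_funTS.
- by move=> r; rewrite /= in_itv /= andbT => r0; rewrite lee_fin !mulr_ge0 ?powR_ge0 ?expR_ge0.
- by move=> r; rewrite /= !in_itv /= andbT => /andP[r1 _]; lra.
Qed.

End monomials.

(** * Necessity: growth of the moments *)

Section necessity.
Variable R : realType.
Variable mu : {measure set (measurableTypeR R) -> \bar R}.
Local Notation monomial n := (fun z : R[i] => z ^+ n).

(** The value at 1 of the operator on z^n is the moment itself, so convergence of the integral at
    that single point makes the moment finite. *)
Lemma hausdorff_monomial n : hausdorff_integrable mu (monomial n) 1 ->
  exists2 m, 0 <= m & mu_moment mu n = m%:E /\ forall z, hausdorff mu (monomial n) z = m%:C * z ^+ n.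
Proof.
pose D : set (measurableTypeR R) := `]0, +oo[%classic.
have mD : measurable D by exact: measurable_itv.
pose F (t : R) := (t ^+ n.+1)^-1.
have E z t : (z / t%:C) ^+ n = z ^+ n * ((t^-1) ^+ n)%:C :> R[i].
  by rewrite exprMn -fmorphV rmorphXn.
have FE (t : R) : (t^-1) ^+ n / t = F t by rewrite /F exprSr invfM exprVn mulrC.
move=> [H _].
have iF : mu.-integrable D (fun t : R => (F t)%:E).
  move: H; congr (integrable _ _ _); apply/funext => t.
  by rewrite E expr1n mul1r /= FE.
have F0 t : D t -> 0 <= F t.
  by rewrite /D /= in_itv /= andbT => t0; rewrite invr_ge0 exprn_ge0// ltW.
have fin : mu_moment mu n \is a fin_num by exact: integrable_fin_num iF.
exists (fine (mu_moment mu n)); first by apply: fine_ge0; apply: integral_ge0 => t tD; rewrite lee_fin F0.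
split; first by rewrite fineK.
move=> z; apply/eqP; rewrite eq_complex complex_ReM complex_ImM /=; apply/andP; split; apply/eqP.
  rewrite mul0r subr0 mulrC -[RHS](RintegralZl (complex.Re (z ^+ n)) mD iF).
  by congr Rintegral; apply/funext => t; rewrite E complex_ReM /= mulr0 subr0 -mulrA FE.
rewrite mul0r addr0 mulrC -[RHS](RintegralZl (complex.Im (z ^+ n)) mD iF).
by congr Rintegral; apply/funext => t; rewrite E complex_ImM /= mulr0 add0r -mulrA FE.
Qed.

(** Covers (ii), with q2 = q1, and (iii), with q2 infinite; p1 and p2 are free because norms of
    monomials ignore them. For q2 infinite the left norm is the moment times [peak], to be compared
    with [pow_norm_le_peak]. For q2 = q1 finite, homogeneity lets the norm of z^n be cancelled, so
    the moments are bounded by C. *)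
Lemma moment_growth (p1 p2 q1 q2 : \bar R) (alpha : R) :
  (0 < p1)%E -> (0 < p2)%E -> (0 < q1)%E -> 0 < alpha -> q2 = q1 \/ q2 = +oo%E ->
  hausdorff_bounded mu (mixed_norm p1 q1 alpha) (mixed_norm p2 q2 alpha) ->
  forall l : R, 1 < l -> exists C : R, forall n, (mu_moment mu n <= (C * l ^+ n)%:E)%E.
Proof.
move=> p10 p20 q10 a0 q12 [wd [C C0 HC]] l l1.
have [K K0 HK] := pow_norm_le_peak q10 a0 l1.
have l0 : 0 <= l by lra.
have q20 : (0 < q2)%E by case: q12 => -> //.
have fE n : mixed_norm p1 q1 alpha (monomial n) = pow_norm q1 alpha 1 n.
  by apply: mixed_norm_radial => // z; rewrite mul1r cabsX.
have Xf n : entire_space (mixed_norm p1 q1 alpha) (monomial n).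
  split; first exact/entireP/monomial_cholomorphic.
  by rewrite fE; apply: le_lt_trans (HK n) _; rewrite ltry.
have HN n : exists2 m, 0 <= m & mu_moment mu n = m%:E /\
    (pow_norm q2 alpha m n <= C%:E * pow_norm q1 alpha 1 n)%E.
  have [m m0 [mE Hf]] := hausdorff_monomial (proj1 (wd _ (Xf n)) 1).
  exists m => //; split=> //; rewrite -fE; apply: le_trans (HC _ (Xf n)).
  rewrite le_eqVlt (@mixed_norm_radial R p2 q2 alpha _ m n) ?eqxx// => z.
  by rewrite Hf cabsM cabs_real ger0_norm// cabsX.
have [q2y|q2y] := eqVneq q2 +oo%E.
  exists (C * K) => n; have [m m0 [-> H]] := HN n; rewrite lee_fin.
  have S0 := peak_gt0 n a0.
  rewrite -(ler_pM2r S0); apply: peak_le => // r r0.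
  rewrite -lee_fin; have := le_trans H (lee_wpmul2l (ltac:(by rewrite lee_fin ltW) : (0 <= C%:E)%E) (HK n)).
  rewrite -EFinM !(mulrA C) => /(le_trans _); apply; rewrite q2y.
  by apply: ereal_sup_ubound; exists r.
have {}q12 : q2 = q1 by case: q12 => // /eqP; rewrite (negbTE q2y).
exists C => n; have [m m0 [-> H]] := HN n; rewrite lee_fin.
case: q1 q10 q12 HK fE Xf H {wd HC HN} => [s| |] // s0 q12 HK fE Xf H; last by rewrite q12 in q2y.
rewrite lte_fin in s0; rewrite q12 pow_norm_scale// in H.
have E0 := pow_norm_gt0 n s0 a0.
have Efin : pow_norm s%:E alpha 1 n = (fine (pow_norm s%:E alpha 1 n))%:E.
  by rewrite fineK// ge0_fin_numE ?(ltW E0)//; apply: le_lt_trans (HK n) _; rewrite ltry.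
rewrite Efin in E0 H; rewrite lte_fin in E0; rewrite -!EFinM lee_fin ler_pM2r// in H.
by apply: le_trans H _; rewrite ler_peMr ?(ltW C0)// exprn_ege1// ltW.
Qed.

End necessity.

Theorem theorem4p1 (R : realType)
    (mu : {measure set (measurableTypeR R) -> \bar R})
    (mu_pos_half_line : mu `]-oo, 0]%classic = 0%E)
    (mu_normalized : (\int[mu]_(t in `]0%R, +oo[) (t^-1)%:E = 1)%E) :
  [<-> forall (p : \bar R) (alpha : R), (0 < p)%E -> 0 < alpha ->
         hausdorff_bounded mu (fock_norm p alpha) (fock_norm p alpha);
       exists (p : \bar R) (alpha : R), [/\ (0 < p)%E, 0 < alpha &
         hausdorff_bounded mu (fock_norm p alpha) (fock_norm p alpha)];
       exists (p q : \bar R) (alpha : R),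
         [/\ (0 < p)%E, (0 < q)%E, 0 < alpha &
         hausdorff_bounded mu (mixed_norm +oo%E q alpha)
                              (mixed_norm p +oo%E alpha)];
       mu `]0, 1[%classic = 0%E;
       (ereal_sup (range (mu_moment mu)) < +oo)%E;
       forall (p q : \bar R) (alpha : R),
         (0 < p)%E -> (0 < q)%E -> 0 < alpha ->
         hausdorff_bounded mu (mixed_norm p q alpha) (mixed_norm p q alpha)].
Proof.
have sufficient := hausdorff_bounded_of_null mu_normalized.
have y0 : (0 < +oo :> \bar R)%E by exact: ltry.
tfae.
- by move=> H; exists 1%E, 1; split; [exact: lte01|exact: ltr01|exact: (H _ _ lte01 ltr01)].
- move=> [p [alpha [p0 a0 H]]].
  have null := null_of_moment_growth (moment_growth p0 p0 p0 a0 (or_introl erefl) H).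
  (* At p = q = +oo the source and target of (iii) are the same space, so sufficiency applies. *)
  by exists +oo%E, +oo%E, 1; split; [exact: y0|exact: y0|exact: ltr01|exact: (sufficient _ _ _ null y0 y0 ltr01)].
- move=> [p [q [alpha [p0 q0 a0 H]]]].
  exact: (null_of_moment_growth (moment_growth y0 p0 q0 a0 (or_intror erefl) H)).
- move=> null; apply: (@le_lt_trans _ _ 1%E); last by rewrite ltry.
  by apply: ge_ereal_sup => _ [n _ <-]; exact: moment_le1.
- move=> sup_fin.
  have null : mu `]0, 1[%classic = 0%E.
    apply: null_of_moment_growth => l l1.
    have M0 : (0 <= mu_moment mu 0)%E.
      by apply: integral_ge0 => t; rewrite /= in_itv /= andbT => t0; rewrite lee_fin invr_ge0 exprn_ge0// ltW.
    set S := ereal_sup _ in sup_fin.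
    have SM n : (mu_moment mu n <= S)%E by apply: ereal_sup_ubound; exists n.
    have S0 : (0 <= S)%E by exact: le_trans M0 (SM 0%N).
    have SE : S = (fine S)%:E by rewrite fineK// ge0_fin_numE.
    (* A bounded sequence grows slower than every l^n with l > 1. *)
    exists (fine S) => n; apply: le_trans (SM n) _; rewrite SE lee_fin.
    by rewrite ler_peMr ?fine_ge0// exprn_ege1// ltW.
  by move=> p q alpha; exact: (sufficient p q alpha null).
- by move=> H p alpha p0 a0; exact: (H p p alpha p0 p0 a0).
Qed.
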